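(* Let $\rho\in\mathbb R$ and $T\in[0,\infty)$. (1) Let $(K_t)_{t\in[0,T]}$ be a family of half-plane hulls, parametrized by half-plane capacity and driven by a continuous function $W$ with $W_0=0$. If $z_0\in\mathbb H$ and $z_0\notin K_T$, then $$I^C_{\rho,z_0}((K_t))=I^C((K_t))+\rho\log\frac{\sin\theta_T}{\sin\theta_0}-\frac{\rho(8+\rho)}{8}\log\frac{|g_T'(z_0)|y_T}{y_0},$$ where $z_t=g_t(z_0)=x_t+iy_t$ with $x_t,y_t\in\mathbb R$, and $\theta_t=\arg(z_t-W_t)\in(0,\pi)$. (2) Let $(K_t)_{t\in[0,T]}$ be a family of half-plane hulls as in (1). If $z_0\in\mathbb R\setminus\{0\}$ and $z_0\notin K_T$, then, with $z_t=g_t(z_0)$, $$I^C_{\rho,z_0}((K_t))=I^C((K_t))-\rho\log\frac{|W_T-z_T|}{|z_0|}-\frac{\rho(4+\rho)}{4}\log|g_T'(z_0)|.$$ (3) Let $(K_t)_{t\in[0,T]}$ be a family of disk hulls, parametrized by conformal radius and driven by $W_t=e^{iw_t}$ with $w$ continuous and $w_0=0$. If $z_0=e^{iv_0}\in\partial\mathbb D$, $v_0\in(0,2\pi)$, and $z_0\notin K_T$, then, with $z_t=g_t(z_0)$, $$I^R_{\rho,z_0}((K_t))=I^R((K_t))-\rho\log\frac{|W_T-z_T|}{|W_0-z_0|}-\frac{\rho(4+\rho)}{8}\log\big(|g_T'(z_0)|^2|g_T'(0)|\big).$$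
   Context: $\mathbb H$ is the upper half-plane, $\mathbb D$ the unit disk. A half-plane hull is a compact $K\subset\overline{\mathbb H}$ with $\mathbb H\setminus K$ simply connected and $K=\overline{K\cap\mathbb H}$; its mapping-out function $g_K:\mathbb H\setminus K\to\mathbb H$ is the conformal map with $g_K(z)=z+a_Kz^{-1}+o(z^{-1})$ at $\infty$. A family is parametrized by half-plane capacity if $a_{K_t}=2t$, and driven by $W$ if $g_t=g_{K_t}$ solves $\partial_tg_t(z)=\frac{2}{g_t(z)-W_t}$, $g_0(z)=z$. A disk hull is a compact $K\subset\overline{\mathbb D}$ with $0\notin K$, $\mathbb D\setminus K$ simply connected, $K=\overline{K\cap\mathbb D}$; its mapping-out function $g_K:\mathbb D\setminus K\to\mathbb D$ is the conformal map with $g_K(0)=0$, $g_K'(0)>0$. A family is parametrized by conformal radius if $g_{K_t}'(0)=e^t$, and driven by $W_t=e^{iw_t}$ if $g_t=g_{K_t}$ solves $\partial_tg_t(z)=g_t(z)\frac{W_t+g_t(z)}{W_t-g_t(z)}$, $g_0(z)=z$. At boundary points $g_t$, $g_t'$ are defined by Schwarz reflection. Energies. $I^C_{\rho,z_0}((K_t))=\frac12\int_0^T\big(\dot W_t-\rho\,\mathrm{Re}\frac1{W_t-z_t}\big)^2dt$ and $I^C((K_t))=\frac12\int_0^T\dot W_t^2dt$ if $W$ is absolutely continuous, and both are $\infty$ otherwise. $I^R_{\rho,e^{iv_0}}((K_t))=\frac12\int_0^T\big(\dot w_t-\frac\rho2\cot\frac{w_t-v_t}2\big)^2dt$, with $v$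 the continuous function, equal to $v_0$ at time $0$, such that $e^{iv_t}=g_t(e^{iv_0})$, and $I^R((K_t))=\frac12\int_0^T\dot w_t^2dt$ if $w$ is absolutely continuous, and both are $\infty$ otherwise. The identities are identities in $[0,\infty]$: they hold also when the energies are infinite. *)

(* Defs.v *)
From HB Require Import structures.
From mathcomp Require Import all_boot all_order all_algebra.
From mathcomp Require Import complex.
From mathcomp Require Import all_classical all_reals all_analysis.

Set Implicit Arguments.
Unset Strict Implicit.
Unset Printing Implicit Defensive.

Import Order.TTheory GRing.Theory Num.Theory.
Import numFieldNormedType.Exports.

Local Open Scope classical_set_scope.
Local Open Scope complex_scope.
Local Open Scope ring_scope.

(* [R[i]] seen as a numClosedFieldType [K], so that it carries the topology and
   the normed-module structure over itself that MathComp-Analysis puts on [K]: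
   [derivable f z 1] is complex differentiability of [f : CC R -> CC R] at [z],
   and [derive1 f z] is the complex derivative. The norm [`|z|] is
   [CC R]-valued, whence [modulus]. *)
Notation CC R := (Num.ClosedField.sort (complex R : numClosedFieldType)).

Definition modulus (R : realType) (z : CC R) : R := complex.Re `|z|.

Definition expi (R : realType) (x : R) : CC R := cos x +i* sin x.

Definition cot (R : realType) (x : R) : R := cos x / sin x.

Definition upper_half_plane (R : realType) : set (CC R) :=
  [set z | 0 < complex.Im z].

Definition unit_disk (R : realType) : set (CC R) := [set z | modulus z < 1].

Arguments upper_half_plane : clear implicits.
Arguments unit_disk : clear implicits.

Definition simply_connected (R : realType) (U : set (CC R)) : Prop :=
  connected U /\
  forall gamma : R -> CC R,
    {within `[0, 1], continuous gamma} ->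
    (forall s : R, s \in `[0, 1] -> U (gamma s)) ->
    gamma 0 = gamma 1 ->
    exists (h : R * R -> CC R) (c : CC R),
      [/\ {within `[0, 1] `*` `[0, 1], continuous h},
          forall p : R * R, (`[0, 1] `*` `[0, 1]) p -> U (h p),
          forall s : R, s \in `[0, 1] -> h (0, s) = gamma s,
          forall s : R, s \in `[0, 1] -> h (1, s) = c &
          forall r : R, r \in `[0, 1] -> h (r, 0) = h (r, 1)].

Definition holomorphic_on (R : realType) (U : set (CC R)) (f : CC R -> CC R) :=
  forall z : CC R, U z -> derivable f z 1.

Definition conformal_map (R : realType) (U V : set (CC R)) (f : CC R -> CC R) :=
  holomorphic_on U f /\ set_bij U V f.

(* [f] has derivative [l] at [u] along [D]; one-sided at an endpoint of an
   interval [D]. *)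
Definition has_derivative_within (R : realType) (D : set R) (f : R -> CC R)
    (u : R) (l : CC R) : Prop :=
  (f s - f u) / (s - u)%:C @[s --> within D u^'] --> l.

Definition absolutely_continuous (R : realType) (a b : R) (f : R -> R) : Prop :=
  forall e : R, 0 < e -> exists2 d : R, 0 < d &
    forall (n : nat) (x y : 'I_n -> R),
      (forall i, [/\ a <= x i, x i <= y i & y i <= b]) ->
      (forall i j, i != j -> y i <= x j \/ y j <= x i) ->
      \sum_i (y i - x i) < d ->
      \sum_i `|f (y i) - f (x i)| < e.

Record half_plane_hull (R : realType) (K : set (CC R)) : Prop := {
  half_plane_hull_compact : compact K;
  half_plane_hull_sub : K `<=` [set z | 0 <= complex.Im z];
  half_plane_hull_sc : simply_connected (upper_half_plane R `\` K);
  half_plane_hull_closure : K = closure (K `&` upper_half_plane R) }.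

(* [g] maps out [K] and [g z = z + a / z + o(1 / z)] at infinity; the values of
   [g] off [upper_half_plane R `\` K] are irrelevant. *)
Record half_plane_mapping_out (R : realType) (K : set (CC R)) (g : CC R -> CC R)
    (a : R) : Prop := {
  half_plane_mapping_out_conformal :
    conformal_map (upper_half_plane R `\` K) (upper_half_plane R) g;
  half_plane_mapping_out_infty :
    forall e : R, 0 < e -> exists M : R, forall z : CC R,
      (upper_half_plane R `\` K) z -> M < modulus z ->
      modulus (g z - z - a%:C / z) <= e * modulus z^-1 }.

(* The holomorphic extension [G] of [g] by reflection in the real line, to the
   complement of the union of [K] and its mirror image; this set contains the
   real points outside [K]. *)
Record half_plane_reflection (R : realType) (K : set (CC R))
    (g G : CC R -> CC R) : Prop := {
  half_plane_reflection_holo :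
    holomorphic_on [set z | ~ K z /\ ~ K z^*%C] G;
  half_plane_reflection_ext :
    forall z : CC R, (upper_half_plane R `\` K) z -> G z = g z;
  half_plane_reflection_sym :
    forall z : CC R, ~ K z -> ~ K z^*%C -> G z^*%C = (G z)^*%C }.

Record chordal_family (R : realType) (T : R) (K : R -> set (CC R))
    (g : R -> CC R -> CC R) (W : R -> R) : Prop := {
  chordal_hull : forall t : R, t \in `[0, T] -> half_plane_hull (K t);
  chordal_growing :
    forall s t : R, 0 <= s -> s <= t -> t <= T -> K s `<=` K t;
  chordal_capacity :
    forall t : R, t \in `[0, T] -> half_plane_mapping_out (K t) (g t) (2 * t);
  chordal_driving : {within `[0, T], continuous W};
  chordal_start : forall z : CC R, upper_half_plane R z -> g 0 z = z;
  chordal_loewner : forall (t : R) (z : CC R), t \in `[0, T] ->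
    (upper_half_plane R `\` K t) z ->
    forall s : R, s \in `[0, t] ->
      has_derivative_within `[0, t] (fun r => g r z) s
        (2 / (g s z - (W s)%:C)) }.

(* [derive1 W] exists almost everywhere when [W] is absolutely continuous on
   [[0, T]]; its default values elsewhere do not affect the integrals. *)
Definition chordal_energy (R : realType) (T : R) (W : R -> R) : \bar R :=
  if `[< absolutely_continuous 0 T W >] then
    ((2^-1)%:E *
     \int[lebesgue_measure]_(t in `[0%R, T]) ((derive1 W t) ^+ 2)%:E)%E
  else +oo%E.

(* [z] is the trajectory of the marked point, [z t = g_t(z_0)]. *)
Definition chordal_rho_energy (R : realType) (rho T : R) (W : R -> R)
    (z : R -> CC R) : \bar R :=
  if `[< absolutely_continuous 0 T W >] then
    ((2^-1)%:E *
     \int[lebesgue_measure]_(t in `[0%R, T])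
       ((derive1 W t - rho * complex.Re ((W t)%:C - z t)^-1) ^+ 2)%:E)%E
  else +oo%E.

Record disk_hull (R : realType) (K : set (CC R)) : Prop := {
  disk_hull_compact : compact K;
  disk_hull_sub : K `<=` [set z | modulus z <= 1];
  disk_hull_0 : ~ K 0;
  disk_hull_sc : simply_connected (unit_disk R `\` K);
  disk_hull_closure : K = closure (K `&` unit_disk R) }.

Record disk_mapping_out (R : realType) (K : set (CC R)) (g : CC R -> CC R)
    (r : R) : Prop := {
  disk_mapping_out_conformal :
    conformal_map (unit_disk R `\` K) (unit_disk R) g;
  disk_mapping_out_0 : g 0 = 0;
  disk_mapping_out_pos : 0 < r;
  disk_mapping_out_derive : derive1 g 0 = r%:C }.

(* The holomorphic extension [G] of [g] by reflection in the unit circle. As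
   [0^-1 = 0], the set below contains [0] when [K] does not. *)
Record disk_reflection (R : realType) (K : set (CC R))
    (g G : CC R -> CC R) : Prop := {
  disk_reflection_holo :
    holomorphic_on [set z | ~ K z /\ ~ K (z^*%C)^-1] G;
  disk_reflection_ext :
    forall z : CC R, (unit_disk R `\` K) z -> G z = g z;
  disk_reflection_sym :
    forall z : CC R, z != 0 -> ~ K z -> ~ K (z^*%C)^-1 ->
      G (z^*%C)^-1 = ((G z)^*%C)^-1 }.

Record radial_family (R : realType) (T : R) (K : R -> set (CC R))
    (g : R -> CC R -> CC R) (w : R -> R) : Prop := {
  radial_hull : forall t : R, t \in `[0, T] -> disk_hull (K t);
  radial_growing :
    forall s t : R, 0 <= s -> s <= t -> t <= T -> K s `<=` K t;
  radial_conformal_radius :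
    forall t : R, t \in `[0, T] -> disk_mapping_out (K t) (g t) (expR t);
  radial_driving : {within `[0, T], continuous w};
  radial_start : forall z : CC R, unit_disk R z -> g 0 z = z;
  radial_loewner : forall (t : R) (z : CC R), t \in `[0, T] ->
    (unit_disk R `\` K t) z ->
    forall s : R, s \in `[0, t] ->
      has_derivative_within `[0, t] (fun r => g r z) s
        (g s z * ((expi (w s) + g s z) / (expi (w s) - g s z))) }.

Definition radial_energy (R : realType) (T : R) (w : R -> R) : \bar R :=
  if `[< absolutely_continuous 0 T w >] then
    ((2^-1)%:E *
     \int[lebesgue_measure]_(t in `[0%R, T]) ((derive1 w t) ^+ 2)%:E)%E
  else +oo%E.

(* [v] is the continuous lift with [expi (v t) = g_t(expi v_0)]. *)
Definition radial_rho_energy (R : realType) (rho T : R) (w v : R -> R)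
    : \bar R :=
  if `[< absolutely_continuous 0 T w >] then
    ((2^-1)%:E *
     \int[lebesgue_measure]_(t in `[0%R, T])
       ((derive1 w t - rho / 2 * cot ((w t - v t) / 2)) ^+ 2)%:E)%E
  else +oo%E.

(* Main.v *)
(** Write [z] for the trajectory of the marked point. When [W] is absolutely
    continuous, expanding the square reduces each identity to the fact that the
    logarithmic functional on the right-hand side, evaluated at time [t], has
    derivative [r^2 / 2 - r W'] at every [t] where [W] is differentiable, where
    [W' - r] is the integrand of the left-hand side; moreover its increments are
    bounded by those of [W] and of [t], so it is absolutely continuous.

    In (2) and (3) the marked point lies on the boundary, its trajectory comes
    from Schwarz reflection, and one has to show that it solves the Loewner
    equation, that is, that it never meets [W]. Let [h] be the height
    ([Im z], or [1 - |z|^2]). By Hopf's boundary point lemma for the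
    superharmonic function [h \o g_T], the quotient [h (g_T p) / h p] is bounded
    below for [p] near the marked point, so [ln h] drops by a bounded amount along
    the trajectory of [p]; its derivative is at most [- |z - W|^-2], which controls
    the distance between two trajectories. Boundary trajectories are therefore
    uniformly bi-Lipschitz functions of the starting point. If [W] met the marked
    trajectory, it would stay during a whole time interval within the image of a
    small boundary arc, hence close to one of [N] equally spaced trajectories: the
    sum of the [N] potentials would then drop at a rate of order [N^2], whereas its
    total drop is [O(N)].

    Finally [ln |g_T'|] is the time integral of the linearised equation, as one
    sees by comparing the trajectories of two points at distance [e -> 0]. *)
Require Import Defs.
From HB Require Import structures.
From mathcomp Require Import all_boot all_order all_algebra.
From mathcomp Require Import complex.
From mathcomp Require Import all_classical all_reals all_analysis.
From mathcomp Require Import measurable_realfun.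
From mathcomp Require Import ring lra.

Set Implicit Arguments.
Unset Strict Implicit.
Unset Printing Implicit Defensive.

Import Order.TTheory GRing.Theory Num.Theory.
Import numFieldNormedType.Exports.

Local Open Scope classical_set_scope.
Local Open Scope complex_scope.
Local Open Scope ring_scope.

(** * Absolutely continuous functions *)

(** The Loewner equation is available only at interior points, so a boundary trajectory is handled
    as a uniform limit of interior ones, with constants independent of the distance [e] to the
    boundary. A Hopf bound suits this: it bounds the quotient of final and initial height from below
    by a constant, and only the logarithm of that constant enters the estimates. No second
    derivative of [g_T] appears: superharmonicity is tested on four neighbours of a point, up to an
    error [O(e^3)], which is enough against a barrier with strictly positive Laplacian. Both
    equations have the form [Z' = al Z + be + ga / (Z - U)]. Divided differences of this field are
    explicit, so one argument serves the half-plane and the disk, and the geometry enters only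
    through a height function. The density of [W] is built from difference quotients along the steps
    [1 / (n + 1)] and identified by a one-sided monotonicity criterion. To cover infinite energies,
    the identity is first proved between integrals of nonnegative functions, the positive and
    negative parts of the derivative of the logarithmic functional standing on opposite sides. *)

Section clamp.
Context {R : realType}.
Implicit Types (a b s t : R).

Definition clamp a b t := Num.max a (Num.min t b).

Lemma clamp_ge a b t : a <= clamp a b t.
Proof. by rewrite le_max lexx. Qed.

Lemma clamp_le a b t : a <= b -> clamp a b t <= b.
Proof. by move=> ab; rewrite ge_max ab ge_min lexx orbT. Qed.

Lemma clampE a b t : a <= t -> t <= b -> clamp a b t = t.
Proof. by move=> /max_idPr at_ /min_idPl tb; rewrite /clamp tb. Qed.

Lemma clampl a b t : t <= a -> clamp a b t = a.
Proof. by move=> ta; apply/max_idPl; rewrite ge_min ta. Qed.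

Lemma clampr a b t : a <= b -> b <= t -> clamp a b t = b.
Proof.
by move=> ab bt; rewrite /clamp; move/min_idPr: bt => ->; apply/max_idPr.
Qed.

Lemma clamp_homo a b s t : s <= t -> clamp a b s <= clamp a b t.
Proof.
move=> st; rewrite /clamp ge_max; apply/andP; split; first by rewrite le_max lexx.
by rewrite le_max; apply/orP; right; rewrite le_min !ge_min st lexx orbT.
Qed.

Lemma clamp_sub_le a b s t : a <= b -> s <= t ->
  clamp a b t - clamp a b s <= t - s.
Proof.
move=> ab st; have [sa|/ltW as_] := leP s a.
  rewrite (clampl _ sa); have [tb|/ltW bt] := leP t b.
    have [ta|/ltW at_] := leP t a; first by rewrite clampl// subrr subr_ge0.
    by rewrite clampE//; lra.
  by rewrite clampr//; lra.
have [tb|/ltW bt] := leP t b.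
  by rewrite !clampE//; lra.
have [sb|/ltW bs] := leP s b; first by rewrite clampr// clampE//; lra.
by rewrite !clampr//; lra.
Qed.

Lemma clamp_dist a b s t : a <= b -> `|clamp a b s - clamp a b t| <= `|s - t|.
Proof.
move=> ab; have [st|/ltW ts] := leP s t.
  rewrite ler0_norm ?subr_le0 ?clamp_homo// ler0_norm ?subr_le0// !opprB.
  exact: clamp_sub_le.
rewrite ger0_norm ?subr_ge0 ?clamp_homo// ger0_norm ?subr_ge0//.
exact: clamp_sub_le.
Qed.

End clamp.

Lemma is_derive_realP {R : realType} (f : R -> R) (x l : R) :
  is_derive x (1 : R) f l <->
  forall e, 0 < e -> exists2 d, 0 < d &
    forall h, `|h| < d -> `|f (x + h) - f x - l * h| <= e * `|h|.
Proof.
split=> [[df <-] e e0|H].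
  have /cvgrPdist_le/(_ e e0)/nbhs_ballP[d/= d0 hd] : h^-1 *: ((f \o shift x) (h *: 1) - f x) @[h --> 0^'] --> 'D_1 f x.
    by [].
  exists d => // h hd'; have [->|h0] := eqVneq h 0.
    by rewrite addr0 subrr mulr0 subrr normr0 mulr0.
  have := hd h; rewrite /ball/= sub0r normrN => /(_ hd' h0).
  rewrite /= [h *: 1]mulr1 [h + x]addrC distrC => hh.
  have -> : f (x + h) - f x - 'D_1 f x * h =
      (h^-1 *: (f (x + h) - f x) - 'D_1 f x) * h.
    by rewrite mulrBl [h^-1 *: _]mulrC mulrAC -mulrA mulfV// mulr1.
  by rewrite normrM ler_wpM2r.
have cv : h^-1 *: ((f \o shift x) (h *: 1) - f x) @[h --> 0^'] --> l.
  apply/cvgrPdist_le => e /H[d d0 hd].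
  apply/nbhs_ballP; exists d => //= h; rewrite /ball/= sub0r normrN => /hd hh h0.
  rewrite /= [h *: 1]mulr1 [h + x]addrC distrC.
  rewrite -(ler_pM2r (_ : 0 < `|h|)) ?normr_gt0// -normrM mulrBl.
  by rewrite [h^-1 *: _]mulrC -mulrA mulVf// mulr1.
by split; [apply/cvg_ex; exists l|apply/cvg_lim].
Qed.

(** * One-sided absolute continuity and a monotonicity criterion *)

Section interval_chains.
Context {R : realType}.
Implicit Types (a b t e : R) (F G : R -> R) (s : seq (R * R)).
Local Notation mu := (@lebesgue_measure R).

(** The intervals are listed from right to left, so that a chain below [t] is prolonged to the right
    by a [cons]. *)
Fixpoint chain a t s : bool :=
  if s is p :: s' then [&& p.1 <= p.2, p.2 <= t & chain a p.1 s'] else a <= t.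

Definition chain_length s : R := \sum_(p <- s) (p.2 - p.1).

Definition chain_drop F s : R := \sum_(p <- s) (F p.1 - F p.2).

(** Only decreases are controlled. Every nondecreasing function qualifies, continuous or not, and
    this is how the variation function [phi] will enter. *)
Definition drop_continuous a b F := forall e, 0 < e -> exists2 d, 0 < d &
  forall s, chain a b s -> chain_length s < d -> chain_drop F s < e.

Lemma chain_le a t s : chain a t s -> a <= t.
Proof.
elim: s t => [//|p s IH] t /= /and3P[p12 p2t /IH ap1].
exact: le_trans ap1 (le_trans p12 p2t).
Qed.

Lemma chain_widen a t u s : t <= u -> chain a t s -> chain a u s.
Proof.
case: s => [|p s] /= tu; first by move=> h; exact: le_trans h tu.
by case/and3P => -> /= pt ->; rewrite (le_trans pt tu).
Qed.

Lemma drop_continuousD a b F G : drop_continuous a b F ->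
  drop_continuous a b G -> drop_continuous a b (F \+ G).
Proof.
move=> hF hG e e0.
have [d d0 hd] := hF _ (divr_gt0 e0 (ltr0n _ 2)).
have [d' d'0 hd'] := hG _ (divr_gt0 e0 (ltr0n _ 2)).
exists (Num.min d d'); first by rewrite lt_min d0 d'0.
move=> s cs; rewrite lt_min => /andP[/(hd _ cs) h1 /(hd' _ cs) h2].
rewrite [ltRHS]splitr; apply: le_lt_trans (ltrD h1 h2).
rewrite /chain_drop -big_split/=.
by apply: ler_sum => p _; rewrite /=; lra.
Qed.

(** Real induction from [a] to [b]. Off [N] one advances by some small [h] at cost [e * h]. On [N]
    one advances inside an open set [U] of measure less than [d] and stores the interval in a chain;
    its total length stays below [d], so all the stored drops together cost less than [e]. *)
Lemma ae_right_increment_le a b F (N : set R) : a <= b ->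
  drop_continuous a b F -> mu.-negligible N ->
  (forall x, a <= x -> x < b -> ~ N x -> forall e d, 0 < e -> 0 < d ->
     exists2 h, 0 < h < d & - (e * h) <= F (x + h) - F x) ->
  F a <= F b.
Proof.
move=> ab acF [M [mM M0 NM]] hF.
(* The loss is [e * (b - a)] from the steps off [N], one [e] from the chain and one [e] from the
   slack [eta]. *)
suff H e : 0 < e -> F a <= F b + e * (b - a + 2).
  apply/ler_addgt0Pr => e e0.
  have b0 : 0 < b - a + 2 by lra.
  have := H (e / (b - a + 2)) (divr_gt0 e0 b0).
  by rewrite divfK// gt_eqF.
move=> e0.
have [d d0 hd] := acF _ e0.
have [|U [oU MU mU]] := lebesgue_regularity_outer mM _ d0.
  by rewrite [ltLHS]M0.
have mUo : measurable U by exact: open_measurable.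
have {}mU : (mu U < d%:E)%E.
  suff -> : (mu U = mu (U `\` M))%E by [].
  rewrite -[in LHS](setDUK MU) measureU//.
  - by rewrite -[RHS]add0e; congr (_ + _)%E; exact: M0.
  - exact: measurableD.
  - by rewrite setDE setICA setICr setI0.
have Ufin : mu U \is a fin_num.
  by rewrite ge0_fin_numE// (lt_trans mU)// ltry.
have mUI t : measurable (U `&` `]a, t]).
  by apply: measurableI; last exact: measurable_itv.
have mUIU t : (mu (U `&` `]a, t]) <= mu U)%E.
  by apply: le_measure; [exact: mem_set (mUI _)|exact/mem_set|exact: subIsetl].
pose m t := fine (mu (U `&` `]a, t])).
have fm t : mu (U `&` `]a, t]) \is a fin_num.
  by rewrite ge0_fin_numE//; apply: le_lt_trans (mUIU t) _; rewrite -ge0_fin_numE.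
have m_le t u : t <= u -> m t <= m u.
  move=> tu; apply: fine_le => //; apply: le_measure; [exact: mem_set (mUI _)|exact: mem_set (mUI _)|].
  by apply: setIS; apply: subset_itvl; rewrite bnd_simp.
have m_lt t : m t < d.
  by rewrite -lte_fin fineK//; exact: le_lt_trans (mUIU t) mU.
have m_add t u : a <= t -> t <= u -> `]t, u] `<=` U -> m u = m t + (u - t).
  move=> le_at tu tuU; rewrite /m.
  have -> : U `&` `]a, u] = (U `&` `]a, t]) `|` `]t, u].
    rewrite -[X in _ `|` X](setIidr tuU) -setIUr; congr (_ `&` _).
    by rewrite -itv_bndbnd_setU// bnd_simp.
  rewrite measureU//; last 2 first.
    exact: mUI.
    apply/seteqP; split => x //= [[_]]; rewrite !in_itv/= => /andP[_ xt].
    by rewrite ltNge xt.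
  transitivity (fine (mu (U `&` `]a, t]) + mu `]t, u]%classic)%E) => //.
  have -> : mu `]t, u]%classic = (u - t)%:E.
    rewrite lebesgue_measure_itv/= lte_fin; case: ltP => //= ut.
    by (have -> : u = t by lra); rewrite subrr.
  by rewrite fineD.
(* The slack [eta] makes [good] pass to the supremum [c]: the last gap [(t, c)] is not stored in the
   chain, its drop is below [eta / 2]. *)
pose good t := forall eta, 0 < eta -> exists s, [/\ chain a t s,
  chain_length s <= m t &
  F a <= F t + e * (t - a) + chain_drop F s + eta].
have good_a : good a.
  move=> eta eta0; exists [::]; split => //=.
  - by rewrite /chain_length big_nil /m fine_ge0.
  - by rewrite /chain_drop big_nil; lra.
pose S := [set t | a <= t <= b /\ good t].
have Sa : S a by split => //; rewrite lexx.
have ubS : ubound S b by move=> t [/andP[]].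
have supS : has_sup S by split; [exists a|exists b].
pose c := sup S.
have ac : a <= c by apply: sup_upper_bound.
have cb : c <= b by apply: ge_sup => //; exists a.
have good_c : good c.
  move=> eta eta0.
  have [d' d'0 hd'] := acF _ (divr_gt0 eta0 (ltr0n _ 2)).
  have [t [/andP[le_at tb] gt] ct] := sup_adherent d'0 supS.
  have tc : t <= c by apply: sup_upper_bound => //; split => //; rewrite le_at.
  have [s [cs ls ds]] := gt _ (divr_gt0 eta0 (ltr0n _ 2)).
  exists s; split.
  - exact: chain_widen cs.
  - exact: le_trans ls (m_le _ _ tc).
  - have : chain_drop F [:: (t, c)] < eta / 2.
      apply: hd'; first by rewrite /= tc cb le_at.
      by rewrite /chain_length big_seq1/= -/c; rewrite -/c in ct; lra.
    rewrite /chain_drop big_seq1/= => h.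
    have : e * (t - a) <= e * (c - a) by rewrite ler_pM2l// lerB.
    rewrite -/(chain_drop F s) in ds *.
    lra.
have cbE : c = b.
  apply/eqP; rewrite eq_le cb/= leNgt; apply/negP => ltcb.
  suff [h /andP[h0 hb] gh] : exists2 h, 0 < h <= b - c & good (c + h).
    have : c + h <= c.
      by apply: sup_upper_bound => //; split => //; apply/andP; split; lra.
    lra.
  (* For [c] in [N] the step stays inside [U], so [m] grows by exactly the length of the stored
     interval; otherwise the hypothesis on right increments gives the step. *)
  have [Nc|Nc] := pselect (N c).
    have /nbhs_ballP[r/= r0 rU] : nbhs c U.
      by apply: open_nbhs_nbhs; split => //; apply: MU; exact: NM.
    exists (Num.min (r / 2) (b - c)).
      by rewrite lt_min ge_min lexx orbT divr_gt0//= subr_gt0 ltcb.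
    set h := Num.min _ _ => eta eta0.
    have h0 : 0 < h by rewrite lt_min divr_gt0//= subr_gt0.
    have hr : h <= r / 2 by rewrite ge_min lexx.
    have [s [cs ls ds]] := good_c _ eta0.
    exists ((c, c + h) :: s); split.
    - by rewrite /= cs lexx lerDl ltW.
    - rewrite /chain_length big_cons/= -/(chain_length s) (@m_add c (c + h))//.
      + by rewrite [c + h - c]addrAC subrr add0r addrC lerD2r.
      + by rewrite lerDl ltW.
      + move=> x/=; rewrite in_itv/= => /andP[cx xh]; apply: rU.
        rewrite /ball/= ltr_norml; apply/andP; split; lra.
    - rewrite /chain_drop big_cons/= -/(chain_drop F s).
      have : 0 <= e * h by rewrite mulr_ge0// ltW.
      rewrite -/(chain_drop F s) in ds.
      lra.
  have bc0 : 0 < b - c by rewrite subr_gt0.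
  have [h /andP[h0 hb] Fh] := hF c ac ltcb Nc e (b - c) e0 bc0.
  exists h; first by rewrite h0 ltW.
  move=> eta eta0; have [s [cs ls ds]] := good_c _ eta0.
  exists s; split.
  - by apply: chain_widen cs; rewrite lerDl ltW.
  - by apply: (le_trans ls); apply: m_le; rewrite lerDl ltW.
  - rewrite -/(chain_drop F s) in ds *; lra.
have [s [cs ls ds]] := good_c _ e0.
rewrite cbE in cs ls ds.
have := hd s cs (le_lt_trans ls (m_lt b)).
rewrite -/(chain_drop F s) in ds *; lra.
Qed.

End interval_chains.

(** * Indefinite integrals along chains *)

Section indefinite_integral.
Context {R : realType}.
Local Notation mu := (@lebesgue_measure R).
Variable f : R -> R.
Hypothesis intf : mu.-integrable setT (EFin \o f).

Definition indef (t : R) : R := (\int[mu]_(x in [set` `]-oo, t]]) f x)%R.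

Let intfA (A : set R) : measurable A -> mu.-integrable A (EFin \o f).
Proof. by move=> mA; apply: integrableS intf. Qed.

Lemma indefB s t : s <= t -> indef t - indef s = \int[mu]_(x in `]s, t]) f x.
Proof.
move=> st; rewrite /indef Rintegral_itvB//; exact: intfA.
Qed.

Lemma indef_ae_derivable :
  {ae mu, forall x, derivable indef x 1 /\ derive1 indef x = f x}.
Proof.
apply: FTC1Ny; first by move=> y; exact: intfA.
by apply: open_integrable_locally => //; exact: openT.
Qed.

Lemma measurable_chain (s : seq (R * R)) :
  measurable (\big[setU/set0]_(p <- s) `]p.1, p.2]%classic : set R).
Proof. by apply: bigsetU_measurable => p _; exact: measurable_itv. Qed.

Lemma chain_sub a t s : chain a t s ->
  \big[setU/set0]_(p <- s) `]p.1, p.2]%classic `<=` [set x : R | x <= t].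
Proof.
elim: s t => [|p s IH] t /=; first by move=> _ x; rewrite big_nil.
case/and3P => p12 p2t /IH H; rewrite big_cons => x [/=|/H/= xp].
  by rewrite in_itv/= => /andP[_ /le_trans]; exact.
exact: le_trans xp (le_trans p12 p2t).
Qed.

(** Intervals open on the left stay disjoint even when neighbours in the chain share an endpoint. *)
Lemma chain_disj a p s : chain a p.1 s ->
  `]p.1, p.2]%classic `&` \big[setU/set0]_(p <- s) `]p.1, p.2]%classic = set0 :> set R.
Proof.
move=> cs; apply/seteqP; split => x //= [+ /(chain_sub cs)/=].
by rewrite in_itv/= => /andP[px _]; rewrite leNgt px.
Qed.

Lemma chain_measure a t s : chain a t s ->
  mu (\big[setU/set0]_(p <- s) `]p.1, p.2]%classic) = (chain_length s)%:E.
Proof.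
elim: s t => [|p s IH] t /=; first by rewrite /chain_length !big_nil measure0.
case/and3P => p12 p2t cs; rewrite /chain_length !big_cons.
transitivity (mu `]p.1, p.2]%classic
    + mu (\big[setU/set0]_(p <- s) `]p.1, p.2]%classic))%E.
  apply: measureU; [exact: measurable_itv|exact: measurable_chain|].
  exact: chain_disj cs.
rewrite (IH _ cs) EFinD; congr (_ + _)%E.
rewrite lebesgue_measure_itv/= lte_fin; case: ltP => //= ut.
by (have -> : p.2 = p.1 by apply/eqP; rewrite eq_le ut p12); rewrite subrr.
Qed.

Lemma chain_indef a t s : chain a t s ->
  \sum_(p <- s) `|indef p.2 - indef p.1| <=
  \int[mu]_(x in \big[setU/set0]_(p <- s) `]p.1, p.2]%classic) `|f x|.
Proof.
have intnA (A : set R) : measurable A -> mu.-integrable A (EFin \o (fun x => `|f x|)).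
  by move=> mA; exact: (integrable_norm (intfA mA)).
elim: s t => [|p s IH] t /=; first by rewrite !big_nil Rintegral_set0.
case/and3P => p12 p2t cs; rewrite !big_cons Rintegral_setU//; first last.
- by rewrite disj_set2E; apply/eqP; exact: chain_disj cs.
- by apply: intnA; apply: measurableU; [exact: measurable_itv|exact: measurable_chain].
- exact: measurable_chain.
rewrite lerD//; last exact: IH cs.
rewrite indefB//; apply: le_normr_Rintegral => //; exact: intfA.
Qed.

Lemma indef_chain_small e : 0 < e -> exists2 d, 0 < d & forall a t s,
  chain a t s -> chain_length s < d -> \sum_(p <- s) `|indef p.2 - indef p.1| < e.
Proof.
move=> e0; have [d [d0 hd]] := integral_normr_continuous intf e0.
exists d => // a t s cs ls; apply: le_lt_trans (chain_indef cs) _.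
apply: hd; first exact: measurable_chain.
by rewrite [ltLHS](chain_measure cs) lte_fin.
Qed.

End indefinite_integral.

Section limn_esup_real.
Context {R : realType}.
Implicit Types (u : nat -> R) (r : R).

Lemma limn_esup_frequently u r : (r%:E < limn_esup (EFin \o u))%E ->
  forall N, exists2 n, (N <= n)%N & r < u n.
Proof.
move=> + N; rewrite limn_esup_lim => /lt_le_trans h.
have /h : (limn (esups (EFin \o u)) <= esups (EFin \o u) N)%E.
  apply: lime_le; first exact: is_cvg_esups.
  by exists N => //= n /= Nn; exact: nonincreasing_esups.
move=> /ereal_sup_gt[_ [n /= Nn <-]]; rewrite lte_fin => rn.
by exists n.
Qed.

Lemma limn_esup_eventually u r : (limn_esup (EFin \o u) < r%:E)%E ->
  exists N, forall n, (N <= n)%N -> u n < r.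
Proof.
rewrite limn_esup_lim.
have -> : limn (esups (EFin \o u)) = ereal_inf (range (esups (EFin \o u))).
  by apply/cvg_lim => //; exact: cvg_esups_inf.
move=> /ereal_inf_lt[_ [N _ <-]] h; exists N => n Nn.
rewrite -lte_fin; apply: le_lt_trans h.
by apply: ereal_sup_ubound; exists n.
Qed.

Let opp_EFin u : EFin \o (fun n => - u n) = -%E \o (EFin \o u).
Proof. by []. Qed.

Lemma limn_einf_frequently u r : (limn_einf (EFin \o u) < r%:E)%E ->
  forall N, exists2 n, (N <= n)%N & u n < r.
Proof.
move=> h N; have [|n Nn] := @limn_esup_frequently (fun n => - u n) (- r) _ N.
  by rewrite opp_EFin limn_esupN EFinN lteN2.
by rewrite ltrN2; exists n.
Qed.

Lemma limn_einf_eventually u r : (r%:E < limn_einf (EFin \o u))%E ->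
  exists N, forall n, (N <= n)%N -> r < u n.
Proof.
move=> h; have [|N hN] := @limn_esup_eventually (fun n => - u n) (- r).
  by rewrite opp_EFin limn_esupN EFinN lteN2.
by exists N => n /hN; rewrite ltrN2.
Qed.

End limn_esup_real.

(** * An absolutely continuous function is an indefinite integral *)

Section absolutely_continuous_ftc.
Context {R : realType}.
Local Notation mu := (@lebesgue_measure R).
Variables (a b : R) (F : R -> R).

Definition chain_variation s : R := \sum_(p <- s) `|F p.2 - F p.1|.

Hypothesis ab : a <= b.
Hypothesis acF : forall e, 0 < e -> exists2 d, 0 < d &
  forall p t s, chain p t s -> chain_length s < d -> chain_variation s < e.
Hypothesis Fa : forall t, t <= a -> F t = F a.
Hypothesis Fb : forall t, b <= t -> F t = F b.

Lemma ac_drop p r : drop_continuous p r F.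
Proof.
move=> e /acF[d d0 hd]; exists d => // s cs ls.
apply: le_lt_trans (hd _ _ _ cs ls); apply: ler_sum => x _.
by rewrite distrC ler_norm.
Qed.

Lemma ac_dropN p r : drop_continuous p r (- F).
Proof.
move=> e /acF[d d0 hd]; exists d => // s cs ls.
apply: le_lt_trans (hd _ _ _ cs ls); apply: ler_sum => x _.
by rewrite opprK addrC ler_norm.
Qed.

Lemma ac_continuous : continuous F.
Proof.
move=> x; apply/cvgrPdist_lt => e /acF[d d0 hd].
near=> t.
have xt : `|x - t| < d by near: t; exact: cvgr_dist_lt.
have [le|/ltW le] := leP x t.
- have := hd x t [:: (x, t)]; rewrite /chain_variation /chain_length !big_seq1/=.
  rewrite le !lexx distrC; apply => //.
  by apply: le_lt_trans xt; rewrite distrC ler_norm.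
- have := hd t x [:: (t, x)]; rewrite /chain_variation /chain_length !big_seq1/=.
  rewrite le !lexx; apply => //.
  by apply: le_lt_trans xt; rewrite ler_norm.
Unshelve. all: by end_near. Qed.

(** A countable family of steps keeps the upper and lower limits measurable, and
    [ae_right_increment_le] asks for no more than arbitrarily small steps. *)
Let q n t : R := (F (t + n.+1%:R^-1) - F t) * n.+1%:R.

Let qE n t : F (t + n.+1%:R^-1) - F t = q n t * n.+1%:R^-1.
Proof. by rewrite /q mulfK. Qed.

Let measurable_q n : measurable_fun setT (q n).
Proof.
have mF : measurable_fun setT F by exact: continuous_measurable_fun ac_continuous.
apply: measurable_funM => //; apply: measurable_funB => //.
by apply: measurableT_comp => //; exact: measurable_funD.
Qed.

Let sup_q t : \bar R := limn_esup (fun n => (q n t)%:E).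
Let inf_q t : \bar R := limn_einf (fun n => (q n t)%:E).

(* The point of [[inf_q t, sup_q t]] closest to [0]; this choice makes the
   candidate derivative [c] integrable without knowing that the quotients
   [q n t] converge. *)
Let c t : \bar R := maxe (inf_q t) (mine (sup_q t) 0%E).

Let inf_sup t : (inf_q t <= sup_q t)%E.
Proof. exact: limn_einf_sup. Qed.

Let c_le t : (c t <= sup_q t)%E.
Proof. by rewrite ge_max inf_sup ge_min lexx. Qed.

Let le_c t : (inf_q t <= c t)%E.
Proof. by rewrite le_max lexx. Qed.

Let measurable_c : measurable_fun setT c.
Proof.
apply: measurable_maxe.
  apply: measurableT_comp => //.
  apply: measurable_fun_limn_esup => n; apply: measurableT_comp => //.
  exact/measurable_EFinP.
apply: measurable_mine => //.
by apply: measurable_fun_limn_esup => n; apply/measurable_EFinP.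
Qed.

(** As [c t] is the point of the limit interval closest to [0], a large [|c t|] puts the whole
    interval on one side of [0], hence all late quotients are large. *)
Let lt_abs_c t r : (r%:E < `|c t|)%E ->
  exists N, forall n, (N <= n)%N -> r < `|q n t|.
Proof.
move=> rc; have [r0|r0] := ltP r 0.
  by exists 0%N => n _; exact: lt_le_trans r0 _.
have [c0|c0] := leP 0%E (c t).
  have : (r%:E < inf_q t)%E.
    move: rc; rewrite gee0_abs// lt_max => /orP[//|].
    by rewrite lt_min => /andP[_]; rewrite lte_fin ltNge r0.
  move=> /limn_einf_eventually[N hN]; exists N => n /hN h.
  exact: lt_le_trans h (ler_norm _).
have : (sup_q t < (- r)%:E)%E.
  have : (c t < (- r)%:E)%E.
    by move: rc; rewrite lee0_abs ?ltW// EFinN lteNr.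
  rewrite gt_max => /andP[_]; rewrite gt_min => /orP[//|].
  by rewrite lte_fin ltrNr oppr0 ltNge r0.
move=> /limn_esup_eventually[N hN]; exists N => n /hN h.
by rewrite -normrN; apply: lt_le_trans (ler_norm _); rewrite ltrNr.
Qed.

Let c_out t : ~~ (a <= t < b) -> c t = 0%E.
Proof.
move=> tab.
have [N hN] : exists N, forall n, (N <= n)%N -> q n t = 0.
  move: tab; rewrite negb_and -ltNge -leNgt => /orP[ta|bt]; last first.
    exists 0%N => n _; rewrite /q [F t]Fb// Fb ?subrr ?mul0r//.
    by rewrite (le_trans bt)// lerDl invr_ge0.
  have at0 : 0 < a - t by rewrite subr_gt0.
  have [N _ hN] := near_infty_natSinv_lt (PosNum at0).
  exists N => n Nn.
  have /= := hN _ Nn; rewrite ltrBrDl => /ltW h.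
  by rewrite /q [F t]Fa 1?ltW// Fa// subrr mul0r.
have q0 : (fun n => (q n t)%:E) @ \oo --> 0%E.
  by apply: cvg_near_cst; exists N => // n /= /hN ->.
have [i0 s0] := cvg_limn_einf_sup q0.
by rewrite /c /inf_q /sup_q i0 s0 minxx maxxx.
Qed.

Let increment_bound (I1 I0 P1 P0 f w e h r : R) : I1 - I0 - f * h <= e / 2 * h ->
  r <= P1 - P0 -> (w - e / 2) * h <= r -> f * h <= w * h ->
  - (e * h) <= P1 - I1 - (P0 - I0).
Proof. lra. Qed.

(** The variation function of [F] grows at least as fast as the indefinite integral of [|c|]. The
    truncation at [k] makes that integral available before [c] is known to be integrable. *)
Let int_min_c p r (k : nat) : p <= r ->
  (forall s, chain p r s -> chain_variation s <= 1) ->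
  (\int[mu]_(t in `]p, r]) mine `|c t| k%:R%:E <= 1)%E.
Proof.
move=> pr var1.
pose w t := fine (mine `|c t| k%:R%:E)%E.
have wE t : ((w t)%:E = mine `|c t| k%:R%:E)%E.
  rewrite fineK// fin_numElt; apply/andP; split.
    by rewrite lt_min ltNyr andbT (lt_le_trans _ (abse_ge0 _))// ltNy0.
  by rewrite gt_min ltry orbT.
have w_ge0 t : 0 <= w t by rewrite -lee_fin wE le_min abse_ge0 lee_fin ler0n.
have w_lek t : w t <= k%:R by rewrite -lee_fin wE ge_min lexx orbT.
have w_lec t : ((w t)%:E <= `|c t|)%E by rewrite wE ge_min lexx.
have mw : measurable_fun setT w.
  apply: measurableT_comp => //; apply: measurable_mine => //.
  exact: measurableT_comp.
pose f := w \_ `]p, r]%classic.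
have intw : mu.-integrable `]p, r] (EFin \o w).
  apply: measurable_bounded_integrable => //.
  - by rewrite [ltLHS]lebesgue_measure_itv/=; case: ifP => // _; rewrite -EFinB ltry.
  - exact: measurable_funS mw.
  - exists k%:R; split; first exact: num_real.
    by move=> M kM t _/=; rewrite ger0_norm// (le_trans (w_lek t))// ltW.
have intf : mu.-integrable setT (EFin \o f).
  by move: intw; rewrite integrable_mkcond//= restrict_EFin.
have fw t : f t <= w t by rewrite /f patchE; case: ifP.
pose phi t := sup [set chain_variation s | s in [set s | chain p t s]].
have has_sup_phi t : p <= t -> t <= r ->
    has_sup [set chain_variation s | s in [set s | chain p t s]].
  move=> pt tr; split.
    by exists (chain_variation [::]); exists [::] => //.
  by exists 1 => _ [s /= cs <-]; apply: var1; exact: chain_widen cs.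
have phi_add s t : p <= s -> s <= t -> t <= r ->
    `|F t - F s| <= phi t - phi s.
  move=> ps st tr; rewrite lerBrDr addrC -lerBrDr; apply: ge_sup.
    by exists (chain_variation [::]); exists [::].
  move=> _ [s' /= cs' <-]; rewrite lerBrDr; apply: sup_upper_bound.
    by apply: has_sup_phi => //; exact: le_trans st.
  exists ((s, t) :: s'); first by rewrite /= st lexx.
  by rewrite /chain_variation big_cons addrC.
have phi_le s t : p <= s -> s <= t -> t <= r -> phi s <= phi t.
  by move=> ps st tr; rewrite -subr_ge0; apply: le_trans (phi_add _ _ ps st tr).
have chain_phi t s : chain p t s -> t <= r -> chain_drop phi s <= 0.
  elim: s t => [|x s IH] t /=; first by rewrite /chain_drop big_nil.
  case/and3P => x12 x2t cs tr; rewrite /chain_drop big_cons.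
  have x2r := le_trans x2t tr.
  rewrite -[leRHS]addr0 lerD//; last exact: IH cs (le_trans x12 x2r).
  by rewrite subr_le0; apply: phi_le => //; exact: chain_le cs.
have drop_phi : drop_continuous p r phi.
  move=> e e0; exists 1 => // s cs _.
  exact: le_lt_trans (chain_phi _ _ cs (lexx r)) e0.
have drop_indef : drop_continuous p r (fun t => - indef f t).
  move=> e e0; have [d d0 hd] := indef_chain_small intf e0.
  exists d => // s cs /(hd _ _ _ cs); apply: le_lt_trans.
  by apply: ler_sum => x _; rewrite opprK addrC ler_norm.
(* Over a step [h = 1 / (n + 1)], [phi] gains at least [|q n x| * h], which is eventually at least
   [(w x - e / 2) * h], while [indef f] gains at most [(w x + e / 2) * h] at almost every [x]. *)
have : phi p - indef f p <= phi r - indef f r.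
  apply: (ae_right_increment_le pr (drop_continuousD drop_phi drop_indef)
    (indef_ae_derivable intf)).
  move=> x px xr Nx e d e0 d0.
  have [dI fx] : derivable (indef f) x 1 /\ derive1 (indef f) x = f x.
    exact: contrapT Nx.
  have e20 : 0 < e / 2 by rewrite divr_gt0.
  have /is_derive_realP/(_ _ e20)[d1 d10 hd1] : is_derive x (1 : R) (indef f) (f x).
    by split; [exact: dI|rewrite -derive1E; exact: fx].
  have [n0 hn0] : exists N, forall n, (N <= n)%N -> w x - e / 2 < `|q n x|.
    apply: lt_abs_c; apply: lt_le_trans (w_lec x).
    by rewrite lte_fin ltrBlDr ltrDl.
  have m0 : 0 < Num.min (Num.min d d1) (r - x).
    by rewrite !lt_min d0 d10 subr_gt0.
  have [n1 _ hn1] := near_infty_natSinv_lt (PosNum m0).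
  pose n := maxn n0 n1.
  have := hn1 n (leq_maxr _ _); have {hn0} := hn0 n (leq_maxl _ _).
  move: n => n hq /=; rewrite !lt_min => /andP[/andP[hd hd2] hr].
  set h : R := n.+1%:R^-1 in hd hd2 hr *.
  have h0 : 0 < h by rewrite invr_gt0.
  exists h; first by rewrite h0.
  have /hd1 : `|h| < d1 by rewrite gtr0_norm.
  rewrite (gtr0_norm h0) ler_norml => /andP[_ hI].
  have xh : x + h <= r by rewrite -lerBrDl ltW.
  have := phi_add x (x + h) px (ltac:(by rewrite lerDl ltW)) xh.
  rewrite qE normrM -/h (gtr0_norm h0) => hphi.
  have hqh : (w x - e / 2) * h <= `|q n x| * h by rewrite ler_pM2r// ltW.
  have fwh : f x * h <= w x * h by rewrite ler_pM2r.
  exact: increment_bound hI hphi hqh fwh.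
move=> hpr.
have : indef f r - indef f p <= 1.
  have : phi r <= 1.
    apply: ge_sup; first by exists (chain_variation [::]); exists [::].
    by move=> _ [s /= cs <-]; exact: var1.
  have : 0 <= phi p.
    apply: (sup_upper_bound (has_sup_phi p (lexx p) pr)).
    by exists [::]; [exact: lexx|rewrite /chain_variation big_nil].
  lra.
rewrite indefB// -lee_fin /Rintegral fineK; last first.
  by apply: integrable_fin_num => //; exact: integrableS intf.
apply: le_trans; rewrite le_eqVlt; apply/orP; left; apply/eqP.
by apply: eq_integral => t tpr; rewrite -wE /f patchE tpr.
Qed.

(** Monotone convergence as the truncation level tends to infinity. *)
Let int_abs_c p r : p <= r ->
  (forall s, chain p r s -> chain_variation s <= 1) ->
  (\int[mu]_(t in `]p, r]) `|c t| <= 1)%E.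
Proof.
move=> pr var1.
have cvg_min t : mine `|c t|%E k%:R%:E @[k --> \oo] --> (`|c t|)%E.
  have [ct|ct] := boolP ((`|c t|)%E \is a fin_num).
    apply: cvg_near_cst; exists (Num.bound (fine `|c t|%E)) => // k /= Nk.
    apply/min_idPl; rewrite -(fineK ct) lee_fin.
    by rewrite (le_trans (ltW (archi_boundP _)))// ?ler_nat// fine_ge0.
  have -> : (`|c t| = +oo)%E.
    by apply/eqP; move: ct; rewrite ge0_fin_numE// -leNgt leye_eq.
  have -> : (fun k => mine +oo%E k%:R%:E) = (fun k => k%:R%:E) :> (nat -> \bar R).
    by apply/funext => k; rewrite minye.
  by apply/cvgeryP; exact: cvgr_idn.
have min_le m n t : (m <= n)%N ->
    (mine `|c t| m%:R%:E <= mine `|c t| n%:R%:E)%E.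
  by move=> mn; rewrite le_min !ge_min lexx/= lee_fin ler_nat mn orbT.
have min_ge0 n t : (0 <= mine `|c t| n%:R%:E)%E.
  by rewrite le_min abse_ge0/= lee_fin.
have mmin n : measurable_fun `]p, r]%classic (fun t => mine `|c t|%E n%:R%:E).
  apply: measurable_mine => //; apply: measurableT_comp => //.
  exact: measurable_funS measurable_c.
have -> : (\int[mu]_(t in `]p, r]) `|c t| =
    \int[mu]_(t in `]p, r]) limn (fun n => mine `|c t| n%:R%:E))%E.
  by apply: eq_integral => t _; rewrite (cvg_lim _ (cvg_min t)).
rewrite monotone_convergence//; last by move=> t _ m n; exact: min_le.
apply: lime_le; last by apply: nearW => n; exact: int_min_c.
apply: ereal_nondecreasing_is_cvgn => m n mn.
by apply: ge0_le_integral => //; [exact: mmin|exact: mmin|move=> *; exact: min_le].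
Qed.

(** Absolute continuity with tolerance [1] bounds the variation by [1] on every interval of length
    [d / 2]; finitely many of these cover [[a, b]], and [c] vanishes elsewhere. *)
Let integrable_c : mu.-integrable setT c.
Proof.
apply/integrableP; split => //.
have [d d0 hd] := acF ltr01.
have d20 : 0 < d / 2 by rewrite divr_gt0.
have step (n : nat) : (\int[mu]_(t in `]a, (a + n%:R * (d / 2))%R]) `|c t| <= n%:R%:E)%E.
  elim: n => [|n IH]; first by rewrite mul0r addr0 set_itvoc0 integral_set0.
  pose u m := a + m%:R * (d / 2).
  have uS : u n.+1 = u n + d / 2 by rewrite /u -natr1; ring.
  have au : a <= u n by rewrite lerDl mulr_ge0// ltW.
  have unS : u n <= u n.+1 by rewrite uS lerDl ltW.
  rewrite -/(u n.+1) (@itv_bndbnd_setU _ _ _ (BRight (u n)))//.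
  rewrite ge0_integral_setU//; last 2 first.
  - by apply: measurableT_comp => //; exact: measurable_funS measurable_c.
  - apply/disj_setPS => t [/=]; rewrite !in_itv/= => /andP[_ tu] /andP[].
    by rewrite ltNge tu.
  rewrite -natr1 EFinD; apply: leeD => //.
  apply: int_abs_c => // s cs; apply: ltW; apply: (hd _ _ _ cs).
  have : chain_length s <= u n.+1 - u n.
    elim: s (u n.+1) (u n) cs {unS au IH uS} => [|x s IH] t0 t1 /=.
      by rewrite /chain_length big_nil subr_ge0.
    case/and3P => x12 xt0 /IH; rewrite /chain_length big_cons; lra.
  rewrite uS; lra.
have [n hn] : exists n : nat, b <= a + n%:R * (d / 2).
  exists (Num.bound ((b - a) / (d / 2))).
  rewrite -lerBlDl -ler_pdivrMr//; apply: ltW; apply: archi_boundP.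
  by rewrite divr_ge0// ?subr_ge0// ltW.
have -> : (\int[mu]_t `|c t| = \int[mu]_(t in `[a, b]) `|c t|)%E.
  rewrite [RHS]integral_mkcond; apply: eq_integral => t _.
  rewrite patchE; case: ifPn => // tab; rewrite c_out ?abse0//.
  apply: contra tab => /andP[ta tb].
  by rewrite inE/= in_itv/= ta ltW.
rewrite -integral_itv_obnd_cbnd; last first.
  by apply: measurableT_comp => //; exact: measurable_funS measurable_c.
apply: le_lt_trans (ltry n%:R); apply: le_trans (step n).
apply: ge0_subset_integral => //.
  by apply: measurableT_comp => //; exact: measurable_funS measurable_c.
by apply: subset_itvl; rewrite bnd_simp.
Qed.

(** The monotonicity criterion is applied to [F - indef f] and to its opposite. Since [c] lies
    between the lower and the upper limit of the quotients, infinitely many quotients exceed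
    [f x - e], and infinitely many lie below [f x + e]. *)
Lemma ac_eq_indef : exists f : R -> R, [/\ measurable_fun setT f,
  mu.-integrable setT (EFin \o f) &
  forall s t, s <= t -> F t - F s = indef f t - indef f s].
Proof.
pose f t := fine (c t).
have aec : {ae mu, forall x, setT x -> c x \is a fin_num}.
  exact: integrable_ae integrable_c.
have mf : measurable_fun setT f by exact: measurableT_comp.
have intf : mu.-integrable setT (EFin \o f).
  apply: (le_integrable _ _ _ integrable_c) => //; first exact/measurable_EFinP.
  by move=> x _; rewrite /f/=; case: (c x) => //= *; rewrite ?normr0 ?leey.
exists f; split => // s t st.
have drop_indef sg : `|sg| = 1 -> drop_continuous s t (fun x => sg * indef f x).
  move=> sg1 e e0; have [d d0 hd] := indef_chain_small intf e0.
  exists d => // l cl /(hd _ _ _ cl); apply: le_lt_trans.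
  apply: ler_sum => x _; rewrite -mulrBr.
  by rewrite (le_trans (ler_norm _))// normrM sg1 mul1r distrC.
have key sg : `|sg| = 1 -> drop_continuous s t (fun x => sg * F x) ->
    (forall x e, c x \is a fin_num -> 0 < e -> forall N, exists2 n, (N <= n)%N &
       sg * f x - e <= sg * q n x) ->
    sg * F s - sg * indef f s <= sg * F t - sg * indef f t.
  move=> sg1 dF freq.
  have nsg1 : `|- sg| = 1 by rewrite normrN.
  have ae2 : {ae mu, forall x, (derivable (indef f) x 1 /\
      derive1 (indef f) x = f x) /\ c x \is a fin_num}.
    have := negligibleU (indef_ae_derivable intf) aec.
    apply: negligibleS => x /= nPQ; apply: contrapT.
    by move=> /not_orP[/contrapT xI /contrapT xc]; apply: nPQ; split => //; exact: xc.
  have -> : sg * F s - sg * indef f s = sg * F s + - sg * indef f s by ring.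
  have -> : sg * F t - sg * indef f t = sg * F t + - sg * indef f t by ring.
  apply: (ae_right_increment_le st (drop_continuousD dF (drop_indef _ nsg1)) ae2).
  move=> x sx xt /contrapT[[dI fx] cx] e d e0 d0.
  have e20 : 0 < e / 2 by rewrite divr_gt0.
  have /is_derive_realP/(_ _ e20)[d1 d10 hd1] : is_derive x (1 : R) (indef f) (f x).
    by split; [exact: dI|rewrite -derive1E; exact: fx].
  have m0 : 0 < Num.min d d1 by rewrite lt_min d0.
  have [n1 _ hn1] := near_infty_natSinv_lt (PosNum m0).
  have [n /hn1/= + hq] := freq x _ cx e20 n1.
  rewrite lt_min => /andP[hd hdd1].
  set h : R := n.+1%:R^-1 in hd hdd1 *.
  have h0 : 0 < h by rewrite invr_gt0.
  exists h; first by rewrite h0.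
  have /hd1 : `|h| < d1 by rewrite gtr0_norm.
  rewrite (gtr0_norm h0) => hI.
  have hI2 : sg * (indef f (x + h) - indef f x - f x * h) <= e / 2 * h.
    by rewrite (le_trans (ler_norm _))// normrM sg1 mul1r.
  have hq2 : (sg * f x - e / 2) * h <= sg * (F (x + h) - F x).
    by rewrite /h qE -/h mulrA ler_pM2r.
  rewrite /=.
  have -> : sg * F (x + h) + - sg * indef f (x + h) -
    (sg * F x + - sg * indef f x) = sg * (F (x + h) - F x) -
    sg * (indef f (x + h) - indef f x - f x * h) - sg * (f x * h) by ring.
  have -> : - (e * h) = (sg * f x - e / 2) * h - e / 2 * h - sg * (f x * h) by field.
  by rewrite lerD2r; exact: lerB.
have k1 : 1 * F s - 1 * indef f s <= 1 * F t - 1 * indef f t.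
  apply: key; first exact: normr1.
    by move=> e /(ac_drop s t)[d d0 hd]; exists d => // l cl /(hd _ cl);
      apply: le_lt_trans; apply: ler_sum => x _; rewrite !mul1r.
  move=> x e cx e0 N.
  have /limn_esup_frequently/(_ N)[n Nn hn] : ((f x - e)%:E < sup_q x)%E.
    apply: lt_le_trans (c_le x); rewrite -(fineK cx) lte_fin.
    by rewrite ltrBlDr ltrDl.
  by exists n => //; rewrite !mul1r ltW.
have k2 : - 1 * F s - - 1 * indef f s <= - 1 * F t - - 1 * indef f t.
  apply: key; first by rewrite normrN1.
    by move=> e /(ac_dropN s t)[d d0 hd]; exists d => // l cl /(hd _ cl);
      apply: le_lt_trans; apply: ler_sum => x _; rewrite !mulN1r.
  move=> x e cx e0 N.
  have /limn_einf_frequently/(_ N)[n Nn hn] : (inf_q x < (f x + e)%:E)%E.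
    by apply: le_lt_trans (le_c x) _; rewrite -(fineK cx) lte_fin ltrDl.
  by exists n => //; rewrite !mulN1r -opprD lerN2 ltW.
apply/eqP; rewrite eq_le; apply/andP; split; move: k1 k2; rewrite !mulN1r !mul1r; lra.
Qed.

End absolutely_continuous_ftc.

Section absolutely_continuous_fundamental.
Context {R : realType}.
Local Notation mu := (@lebesgue_measure R).
Implicit Types (a b t : R) (F : R -> R) (s : seq (R * R)).

Lemma chain_nth a t s : chain a t s -> forall i, (i < size s)%N ->
  [/\ a <= (nth (0, 0) s i).1, (nth (0, 0) s i).1 <= (nth (0, 0) s i).2
    & (nth (0, 0) s i).2 <= t].
Proof.
elim: s t => [//|p s IH] t /= /and3P[p12 p2t cs] [|i] /= si.
  by split => //; exact: chain_le cs.
have [h1 h2 h3] := IH _ cs i si; split => //.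
exact: le_trans h3 (le_trans p12 p2t).
Qed.

Lemma chain_nth_lt a t s : chain a t s -> forall i j, (i < j)%N -> (j < size s)%N ->
  (nth (0, 0) s j).2 <= (nth (0, 0) s i).1.
Proof.
elim: s t => [//|p s IH] t /= /and3P[p12 p2t cs] [|i] [|j]//= ij sj.
  by have [] := chain_nth cs sj.
exact: (IH _ cs).
Qed.

Lemma absolutely_continuous_chain a b F : absolutely_continuous a b F ->
  forall e, 0 < e -> exists2 d, 0 < d & forall s, chain a b s ->
    chain_length s < d -> chain_variation F s < e.
Proof.
move=> acF e /acF[d d0 hd]; exists d => // s cs.
rewrite /chain_length /chain_variation !(big_nth (0, 0)) !big_mkord.
apply: (hd _ (fun i => (nth (0, 0) s i).1) (fun i => (nth (0, 0) s i).2)).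
  by move=> i; exact: chain_nth cs _ (ltn_ord i).
move=> i j; rewrite neq_ltn => /orP[] ij; [right|left];
  exact: chain_nth_lt cs _ _ ij (ltn_ord _).
Qed.

(** The function [F \o clamp a b] is constant outside [[a, b]], and it inherits absolute continuity
    because clamping sends a chain to a chain of [[a, b]] that is no longer. *)
Lemma absolutely_continuous_ftc a b F : a <= b -> absolutely_continuous a b F ->
  exists f : R -> R, [/\ measurable_fun setT f, mu.-integrable setT (EFin \o f),
    F b - F a = \int[mu]_(x in `]a, b]) f x &
    mu.-negligible [set x | a < x < b /\
      ~ (derivable F x 1 /\ derive1 F x = f x)]].
Proof.
move=> ab /absolutely_continuous_chain acF.
pose Fe t := F (clamp a b t).
have chain_clamp s p t : chain p t s ->
    chain a (clamp a b t) [seq (clamp a b x.1, clamp a b x.2) | x <- s].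
  elim: s t => [|x s IH] t /=; first by move=> _; exact: clamp_ge.
  by case/and3P => x12 x2t cs; rewrite !clamp_homo//= IH.
have acFe e : 0 < e -> exists2 d, 0 < d & forall p t s,
    chain p t s -> chain_length s < d -> chain_variation Fe s < e.
  move=> /acF[d d0 hd]; exists d => // p t s cs ls.
  have -> : chain_variation Fe s =
      chain_variation F [seq (clamp a b x.1, clamp a b x.2) | x <- s].
    by rewrite /chain_variation big_map.
  apply: hd; first exact: chain_widen (clamp_le t ab) (chain_clamp _ _ _ cs).
  apply: le_lt_trans ls; rewrite /chain_length big_map.
  elim: s t cs => [|x s IH] t /=; first by rewrite !big_nil.
  by case/and3P => x12 x2t cs; rewrite !big_cons lerD ?clamp_sub_le// (IH _ cs).
have Fea t : t <= a -> Fe t = Fe a by move=> ta; rewrite /Fe !clampl.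
have Feb t : b <= t -> Fe t = Fe b by move=> bt; rewrite /Fe !clampr.
have [f [mf intf FI]] := ac_eq_indef ab acFe Fea Feb.
exists f; split => //.
  rewrite -indefB// -FI// /Fe !clampE//.
have := indef_ae_derivable intf.
apply: negligibleS => x /= [/andP[ax xb] nF] [dI fx]; apply: nF.
have /is_derive_realP H : is_derive x (1 : R) (indef f) (f x).
  by split; [exact: dI|rewrite -derive1E; exact: fx].
have : is_derive x (1 : R) F (f x).
  apply/is_derive_realP => e /H[d d0 hd].
  exists (Num.min d (Num.min (x - a) (b - x))).
    by rewrite !lt_min d0 !subr_gt0 ax.
  move=> h; rewrite !lt_min => /and3P[/hd hI].
  rewrite !ltr_norml => /andP[h1 h2] /andP[h3 h4].
  suff -> : F (x + h) - F x = indef f (x + h) - indef f x by [].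
  have E1 : F x = Fe x by rewrite /Fe clampE// ltW.
  have E2 : F (x + h) = Fe (x + h) by rewrite /Fe clampE//; lra.
  rewrite E1 E2; have [h0|/ltW h0] := leP 0 h; first by rewrite FI// lerDl.
  by rewrite -[LHS]opprB -[RHS]opprB FI// gerDl.
by move=> [dF fF]; split => //; rewrite derive1E.
Qed.

End absolutely_continuous_fundamental.

(** * The energy identity *)

Section integral_nonmeasurable.
Import HBNNSimple.
Local Open Scope ereal_scope.
Context d (T : measurableType d) (R : realType).
Variable mu : {measure set T -> \bar R}.
Implicit Types (D N : set T) (f g : T -> \bar R).

(* No measurability is required of [f] and [g]: a simple function below [f] is
   pushed below [g] by setting it to [0] on the null set. *)
Lemma ge0_le_integral_ae D f g : (forall x, D x -> 0 <= f x) ->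
  (forall x, D x -> 0 <= g x) ->
  mu.-negligible [set x | D x /\ ~ (f x <= g x)] ->
  \int[mu]_(x in D) f x <= \int[mu]_(x in D) g x.
Proof.
move=> f0 g0 [N [mN N0 subN]].
rewrite !ge0_integralE//.
apply: ge_ereal_sup => _ [h /= hf <-].
pose h' := proj_nnsfun h (measurableC mN).

have -> : sintegral mu h = sintegral mu h'.
  rewrite -!integralT_nnsfun; apply: ge0_ae_eq_integral => //.
  - by apply/measurable_EFinP; exact: measurable_funPT.
  - by apply/measurable_EFinP; exact: measurable_funPT.
  - by move=> x _; rewrite lee_fin.
  - by move=> x _; rewrite lee_fin.
  exists N; split => // x /= hx; apply: contrapT => Nx; apply: hx => _.
  by rewrite mindicE mem_set// mulr1.
apply: ereal_sup_ubound; exists h' => //= x.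
rewrite mindicE; case: (boolP (x \in ~` N)) => [/set_mem/= Nx|_]; last first.
  by rewrite mulr0 patchE; case: ifPn => // /set_mem/g0.
rewrite mulr1 [leRHS]patchE.
apply: le_trans (hf x) _; rewrite patchE; case: ifPn => // /set_mem Dx.
by apply: contrapT => fg; apply: Nx; apply: subN.
Qed.

Lemma ge0_eq_integral_ae D f g : (forall x, D x -> 0 <= f x) ->
  (forall x, D x -> 0 <= g x) ->
  mu.-negligible [set x | D x /\ f x <> g x] ->
  \int[mu]_(x in D) f x = \int[mu]_(x in D) g x.
Proof.
move=> f0 g0 fg; apply/eqP; rewrite eq_le; apply/andP; split;
  apply: ge0_le_integral_ae => //; apply: negligibleS fg => x [Dx] h; split => //;
  by move=> E; apply: h; rewrite E.
Qed.

End integral_nonmeasurable.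

Section energy_identity.
Context {R : realType}.
Local Notation mu := (@lebesgue_measure R).

Lemma absolutely_continuous_le a b (W Phi : R -> R) C :
  absolutely_continuous a b W ->
  (forall s t, a <= s -> s <= t -> t <= b ->
     `|Phi t - Phi s| <= C * (`|W t - W s| + (t - s))) ->
  absolutely_continuous a b Phi.
Proof.
move=> acW PhiW e e0.
pose M := `|C| + 1.
have M0 : 0 < M by rewrite ltr_wpDl.
have e20 : 0 < e / (2 * M) by rewrite divr_gt0// mulr_gt0.
have [d d0 hd] := acW _ e20.
exists (Num.min d (e / (2 * M))); first by rewrite lt_min d0.
move=> n x y xy disj; rewrite lt_min => /andP[/(hd n x y xy disj) h1 h2].
apply: (@le_lt_trans _ _ (\sum_i M * (`|W (y i) - W (x i)| + (y i - x i)))).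
  apply: ler_sum => i _; have [ax xiy yb] := xy i.
  apply: le_trans (PhiW _ _ ax xiy yb) _; apply: ler_wpM2r.
    by rewrite addr_ge0// subr_ge0.
  by rewrite (le_trans (ler_norm C))// lerDl.
rewrite -mulr_sumr big_split/=.
have -> : e = M * (e / (2 * M) + e / (2 * M)).
  by field; rewrite gt_eqF.
by rewrite ltr_pM2l// ltrD.
Qed.

(** Finite terms may be moved across the equation even when [x] and [y] are infinite; then both
    sides are [+oo]. *)
Let half_ereal_eq (y x n p : \bar R) : (0 <= y)%E -> (0 <= x)%E ->
  n \is a fin_num -> p \is a fin_num -> (x + n = y + p)%E ->
  ((2^-1)%:E * x = (2^-1)%:E * y + ((fine p - fine n) / 2)%:E)%E.
Proof.
case: x => [x||]; case: y => [y||]; case: p => [p||]; case: n => [n||] //=.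
- by move=> _ _ _ _ [] E; rewrite -!EFinM -EFinD; congr EFin; lra.
- by move=> *; rewrite mulry gtr0_sg ?mul1e// invr_gt0.
Qed.

(** Almost everywhere [(W' - r)^2 = W'^2 + 2 Phi'], and [Phi] is absolutely continuous, hence the
    integral of its derivative [k]. The energies may be infinite, so nothing is subtracted before
    integration. *)
Lemma energy_identity T (W r Phi : R -> R) C : 0 <= T ->
  absolutely_continuous 0 T W ->
  {within `[0, T], continuous r} ->
  (forall s t, 0 <= s -> s <= t -> t <= T ->
     `|Phi t - Phi s| <= C * (`|W t - W s| + (t - s))) ->
  (forall t w, 0 < t < T -> is_derive t (1 : R) W w ->
     is_derive t (1 : R) Phi ((w - r t) ^+ 2 / 2 - w ^+ 2 / 2)) ->
  ((2^-1)%:E * \int[mu]_(t in `[0%R, T]) ((derive1 W t - r t) ^+ 2)%:E =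
   (2^-1)%:E * \int[mu]_(t in `[0%R, T]) ((derive1 W t) ^+ 2)%:E
   + (Phi T - Phi 0)%:E)%E.
Proof.
move=> T0 acW cr PhiW dPhi.
have [f [mf intf _ Nf]] := absolutely_continuous_ftc T0 acW.
have [k [mk intk Phik Nk]] :=
  absolutely_continuous_ftc T0 (absolutely_continuous_le acW PhiW).
pose D : set R := `[0, T]%classic.
have mD : measurable D by exact: measurable_itv.
have mr : measurable_fun D r by exact: subspace_continuous_measurable_fun.
have mfD : measurable_fun D f by exact: measurable_funS mf.
pose A t := ((f t - r t) ^+ 2)%:E; pose B t := ((f t) ^+ 2)%:E.
have NT : mu.-negligible [set x | D x /\ ~ (0 < x < T)].
  have : mu.-negligible ([set 0%R] `|` [set T]).
    by apply: negligibleU; apply/negligibleP => //; exact: lebesgue_measure_set1.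
  apply: negligibleS.
  move=> x []; rewrite /D/= in_itv/= => /andP[x0 xT] h.
  have [->|nx0] := eqVneq x 0; first by left.
  have [->|nxT] := eqVneq x T; first by right.
  by exfalso; apply: h; rewrite !lt_neqAle eq_sym nx0 nxT x0.
have NfT := negligibleU NT Nf.
have fgood x : D x -> ~ ([set x | D x /\ ~ (0 < x < T)] `|`
    [set x | 0 < x < T /\ ~ (derivable W x 1 /\ derive1 W x = f x)]) x ->
    0 < x < T /\ is_derive x (1 : R) W (f x).
  move=> Dx /not_orP[h1 h2].
  have x0T : 0 < x < T by apply: contrapT => h; apply: h1.
  split => //; have [dW fW] : derivable W x 1 /\ derive1 W x = f x.
    by apply: contrapT => h; apply: h2.
  by split; [exact: dW|rewrite -derive1E; exact: fW].
have -> : (\int[mu]_(t in D) ((derive1 W t - r t) ^+ 2)%:E = \int[mu]_(t in D) A t)%E.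
  apply: ge0_eq_integral_ae => [x _|x _|]; rewrite ?lee_fin ?sqr_ge0//.
  apply: negligibleS NfT => x [Dx h]; apply: contrapT => /(fgood _ Dx)[_ [_ fW]].
  by apply: h; rewrite /A derive1E fW.
have -> : (\int[mu]_(t in D) ((derive1 W t) ^+ 2)%:E = \int[mu]_(t in D) B t)%E.
  apply: ge0_eq_integral_ae => [x _|x _|]; rewrite ?lee_fin ?sqr_ge0//.
  apply: negligibleS NfT => x [Dx h]; apply: contrapT => /(fgood _ Dx)[_ [_ fW]].
  by apply: h; rewrite /B derive1E fW.
have mA : measurable_fun D A.
  apply/measurable_EFinP; apply: measurable_funX.
  exact: measurable_funB.
have mB : measurable_fun D B.
  by apply/measurable_EFinP; apply: measurable_funX.
(* Positive and negative parts of [2 Phi']; the factor [2] compensates the [1/2] in the energies.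
   The identity is integrated in the form [A + kn = B + kp], all terms being nonnegative. *)
pose kp t := Num.max (2 * k t) 0; pose kn t := Num.max (- (2 * k t)) 0.
have mkD : measurable_fun D k by exact: measurable_funS mk.
have int2k : mu.-integrable D (EFin \o (fun t => 2 * k t)).
  have : mu.-integrable D (EFin \o k) by exact: integrableS intk.
  have -> : EFin \o (fun t => 2 * k t) = (fun t => 2%:E * (EFin \o k) t)%E.
    by apply/funext => t; rewrite /= EFinM.
  exact: integrableZl.
have kpn t : 2 * k t = kp t - kn t.
  by rewrite /kp /kn; case: (leP (2 * k t) 0) => h; case: (leP (- (2 * k t)) 0) => h';
    lra.
have kp_ge0 t : 0 <= kp t by rewrite le_max lexx orbT.
have kn_ge0 t : 0 <= kn t by rewrite le_max lexx orbT.
have m2k : measurable_fun D (fun t => 2 * k t) by exact: measurable_funM.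
have mkp : measurable_fun D kp by exact: measurable_maxr.
have mkn : measurable_fun D kn.
  by apply: measurable_maxr => //; exact: measurableT_comp.
have intkp : mu.-integrable D (EFin \o kp).
  apply: (le_integrable _ _ _ int2k) => //; first exact/measurable_EFinP.
  move=> t _; rewrite lee_fin ger0_norm//= ge_max normr_ge0 andbT.
  exact: ler_norm.
have intkn : mu.-integrable D (EFin \o kn).
  apply: (le_integrable _ _ _ int2k) => //; first exact/measurable_EFinP.
  move=> t _; rewrite lee_fin ger0_norm//= ge_max normr_ge0 andbT.
  by rewrite -normrN ler_norm.
have ABk : (\int[mu]_(t in D) (A t + (kn t)%:E) = \int[mu]_(t in D) (B t + (kp t)%:E))%E.
  apply: ge0_eq_integral_ae => [x _|x _|].
  - by rewrite -EFinD lee_fin addr_ge0 ?sqr_ge0.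
  - by rewrite -EFinD lee_fin addr_ge0 ?sqr_ge0.
  apply: negligibleS (negligibleU NfT Nk) => x [Dx h]; apply: contrapT.
  move=> /not_orP[/(fgood _ Dx)[x0T dW] h2]; apply: h.
  have [_ kE] : derivable Phi x 1 /\ derive1 Phi x = k x.
    by apply: contrapT => hn; apply: h2.
  have [_] := dPhi _ _ x0T dW; rewrite -derive1E kE => kx.
  rewrite /A /B -!EFinD; congr EFin.
  by have := kpn x; rewrite kx; lra.
have integral_add (u : R -> \bar R) (v : R -> R) : measurable_fun D u ->
    (forall t, 0 <= u t)%E -> measurable_fun D v -> (forall t, 0 <= v t) ->
    (\int[mu]_(t in D) (u t + (v t)%:E) =
     \int[mu]_(t in D) u t + \int[mu]_(t in D) (v t)%:E)%E.
  move=> mu_ u0 mv v0; rewrite ge0_integralD//.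
    by move=> t _; rewrite lee_fin.
  exact/measurable_EFinP.
have A_ge0 t : (0 <= A t)%E by rewrite lee_fin sqr_ge0.
have B_ge0 t : (0 <= B t)%E by rewrite lee_fin sqr_ge0.
move: ABk; rewrite !integral_add//.
have -> : Phi T - Phi 0 = (\int[mu]_(t in D) kp t - \int[mu]_(t in D) kn t) / 2.
  rewrite -RintegralB//; apply: (mulIf (_ : 2 != 0)) => //.
  rewrite divfK// Phik Rintegral_itv_obnd_cbnd; last exact: integrableS intk.
  rewrite -RintegralZr//; last exact: integrableS intk.
  by apply: eq_Rintegral => t _; rewrite mulrC kpn.
rewrite /Rintegral.
have : (\int[mu]_(t in D) (kp t)%:E \is a fin_num)%E by exact: integrable_fin_num.
have : (\int[mu]_(t in D) (kn t)%:E \is a fin_num)%E by exact: integrable_fin_num.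
have : (0 <= \int[mu]_(t in D) A t)%E.
  exact: integral_ge0.
have : (0 <= \int[mu]_(t in D) B t)%E.
  exact: integral_ge0.
exact: half_ereal_eq.
Qed.

End energy_identity.

(** * Complex numbers and trajectories *)

Section complex_plane.
Context {R : realType}.
Implicit Types (z w : CC R) (x y : R).
Local Notation Re := complex.Re.
Local Notation Im := complex.Im.

Lemma Re_add z w : Re (z + w) = Re z + Re w. Proof. by case: z; case: w. Qed.
Lemma Im_add z w : Im (z + w) = Im z + Im w. Proof. by case: z; case: w. Qed.
Lemma Re_opp z : Re (- z) = - Re z. Proof. by case: z. Qed.
Lemma Im_opp z : Im (- z) = - Im z. Proof. by case: z. Qed.
Lemma Re_sub z w : Re (z - w) = Re z - Re w. Proof. by rewrite Re_add Re_opp. Qed.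
Lemma Im_sub z w : Im (z - w) = Im z - Im w. Proof. by rewrite Im_add Im_opp. Qed.
Lemma Re_mul z w : Re (z * w) = Re z * Re w - Im z * Im w.
Proof. by case: z; case: w. Qed.
Lemma Im_mul z w : Im (z * w) = Re z * Im w + Im z * Re w.
Proof. by case: z => a b; case: w => c d /=; rewrite [b * c]mulrC. Qed.
Lemma Re_inv z : Re z^-1 = Re z / (Re z ^+ 2 + Im z ^+ 2). Proof. by case: z. Qed.
Lemma Im_inv z : Im z^-1 = - Im z / (Re z ^+ 2 + Im z ^+ 2).
Proof. by case: z => a b /=; rewrite mulNr. Qed.
Lemma eq_ReIm z w : Re z = Re w -> Im z = Im w -> z = w.
Proof. by case: z => a b; case: w => c d /= -> ->. Qed.

Lemma normC_modulus z : `|z| = (modulus z)%:C.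
Proof. by rewrite /modulus normc_def. Qed.

Lemma modulus_ge0 z : 0 <= modulus z.
Proof. by rewrite /modulus normc_def sqrtr_ge0. Qed.

Lemma modulus_sq z : modulus z ^+ 2 = Re z ^+ 2 + Im z ^+ 2.
Proof. by rewrite /modulus normc_def /= sqr_sqrtr// addr_ge0 ?sqr_ge0. Qed.

Lemma modulusM z w : modulus (z * w) = modulus z * modulus w.
Proof. by rewrite {1}/modulus normrM !normC_modulus -rmorphM. Qed.

Lemma modulusN z : modulus (- z) = modulus z.
Proof. by rewrite /modulus normrN. Qed.

Lemma modulusB z w : modulus (z - w) = modulus (w - z).
Proof. by rewrite /modulus distrC. Qed.

Lemma modulus0 : modulus (0 : CC R) = 0.
Proof. by rewrite /modulus normr0. Qed.

Lemma modulus1 : modulus (1 : CC R) = 1.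
Proof. by rewrite /modulus normr1. Qed.

Lemma modulusV z : modulus z^-1 = (modulus z)^-1.
Proof.
by rewrite {1}/modulus normfV normC_modulus -fmorphV.
Qed.

Lemma modulusX z n : modulus (z ^+ n) = modulus z ^+ n.
Proof. by rewrite {1}/modulus normrX normC_modulus -rmorphXn. Qed.

Lemma ler_modulusD z w : modulus (z + w) <= modulus z + modulus w.
Proof.
have := ler_normD z w; rewrite !normC_modulus -rmorphD.
by rewrite lecR.
Qed.

Lemma ler_modulusB z w : modulus (z - w) <= modulus z + modulus w.
Proof. by rewrite -[modulus w]modulusN ler_modulusD. Qed.

Lemma ler_sub_modulus z w : modulus z - modulus w <= modulus (z - w).
Proof. by rewrite lerBlDr; apply: le_trans (ler_modulusD _ _); rewrite subrK. Qed.

Lemma modulus_eq0 z : (modulus z == 0) = (z == 0).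
Proof.
apply/eqP/eqP => [h|->]; last exact: modulus0.
by apply/eqP; rewrite -normr_eq0 normC_modulus h.
Qed.

Lemma modulus_gt0 z : (0 < modulus z) = (z != 0).
Proof. by rewrite lt_neqAle modulus_ge0 andbT eq_sym modulus_eq0. Qed.

Lemma modulusR x : modulus (x%:C : CC R) = `|x|.
Proof.
rewrite /modulus normc_def/= expr0n/= addr0 sqrtr_sqr.
by [].
Qed.

Lemma Re_le_modulus z : `|Re z| <= modulus z.
Proof.
rewrite -(ler_pXn2r (_ : 0 < 2)%N) ?nnegrE ?modulus_ge0// modulus_sq.
by rewrite real_normK ?num_real// lerDl sqr_ge0.
Qed.

Lemma Im_le_modulus z : `|Im z| <= modulus z.
Proof.
rewrite -(ler_pXn2r (_ : 0 < 2)%N) ?nnegrE ?modulus_ge0// modulus_sq.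
by rewrite real_normK ?num_real// lerDr sqr_ge0.
Qed.

Lemma modulus_le_ReIm z : modulus z <= `|Re z| + `|Im z|.
Proof.
rewrite -(ler_pXn2r (_ : 0 < 2)%N) ?nnegrE ?modulus_ge0 ?addr_ge0// modulus_sq.
rewrite sqrrD !real_normK ?num_real// lerD2r lerDl.
by rewrite mulrn_wge0// mulr_ge0.
Qed.

Lemma modulus_expi x : modulus (expi x) = 1.
Proof.
apply/eqP; rewrite -(@eqrXn2 _ 2) ?modulus_ge0// modulus_sq expr1n/=.
by rewrite cos2Dsin2.
Qed.

Lemma modulus_i : modulus ('i : CC R) = 1.
Proof.
by apply/eqP; rewrite -(@eqrXn2 _ 2) ?modulus_ge0// modulus_sq /= expr0n add0r !expr1n.
Qed.

Lemma modulus_nat n : modulus (n%:R : CC R) = n%:R.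
Proof.
have -> : (n%:R : CC R) = (n%:R)%:C by rewrite rmorph_nat.
by rewrite modulusR normr_nat.
Qed.

Lemma cvg_modulusP (T : Type) (F : set_system T) (FF : Filter F) (f : T -> CC R) (l : CC R) :
  f @ F --> l <-> forall e, 0 < e -> \forall x \near F, modulus (l - f x) < e.
Proof.
split=> [/cvgrPdist_lt H e e0|H].
  have : 0 < (e%:C : CC R) by rewrite ltcR.
  move=> /H; apply: filterS => x; rewrite normC_modulus.
  by rewrite ltcR.
apply/cvgrPdist_lt => e e0.
have eE : e = (Re e)%:C.
  by move: e0; rewrite ltcE => /andP[/eqP ime _]; apply: eq_ReIm.
have {}e0 : 0 < Re e by move: e0; rewrite eE ltcR.
apply: filterS (H _ e0) => x h; rewrite eE normC_modulus.
by rewrite ltcR.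
Qed.

Lemma nbhs_modulusP z (A : set (CC R)) :
  nbhs z A <-> exists2 d, 0 < d & forall w, modulus (w - z) < d -> A w.
Proof.
split.
  move=> /nbhs_ballP[e /= e0 eA].
  have eE : e = (Re e)%:C.
    by move: e0; rewrite ltcE => /andP[/eqP ime _]; apply: eq_ReIm.
  have {}e0 : 0 < Re e by move: e0; rewrite eE ltcR.
  exists (Re e) => // w wz; apply: eA; rewrite /ball/= normC_modulus modulusB eE.
  by rewrite ltcR.
move=> [d d0 dA]; apply/nbhs_ballP; exists d%:C => /=.
  by rewrite ltcR.
move=> w; rewrite /ball/= normC_modulus modulusB => h; apply: dA.
by move: h; rewrite ltcR.
Qed.

Lemma derivable_modulusP (f : CC R -> CC R) z : derivable f z 1 ->
  forall e, 0 < e -> exists2 d, 0 < d & forall h, modulus h < d ->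
    modulus (f (z + h) - f z - derive1 f z * h) <= e * modulus h.
Proof.
move=> df e e0.
have /cvg_modulusP/(_ e e0)/nbhs_modulusP[d d0 hd] :
    h^-1 *: (f (h + z) - f z) @[h --> 0^'] --> derive1 f z.
  move: df; rewrite /derivable /derive1.
  set g := (fun h => _); set g' := (fun h => _).
  by have -> : g = g' by apply/funext => h; rewrite /g /g'/= [h *: 1]mulr1.
exists d => // h hd'; have [->|h0] := eqVneq h 0.
  by rewrite addr0 subrr mulr0 subrr modulus0 mulr0.
have := hd h; rewrite subr0 => /(_ hd' h0).
rewrite [h + z]addrC modulusB => hh.
have -> : f (z + h) - f z - derive1 f z * h =
    (h^-1 *: (f (z + h) - f z) - derive1 f z) * h.
  by rewrite mulrBl [h^-1 *: _]mulrC mulrAC -mulrA mulfV// mulr1.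
by rewrite modulusM ler_wpM2r ?modulus_ge0// ltW.
Qed.

Lemma derivable_modulus_continuous (f : CC R -> CC R) z : derivable f z 1 ->
  forall e, 0 < e -> exists2 d, 0 < d & forall w, modulus (w - z) < d ->
    modulus (f w - f z) < e.
Proof.
move=> /derivable_modulusP/(_ 1 ltr01)[d d0 hd] e e0.
pose M := modulus (derive1 f z) + 1.
have M0 : 0 < M by rewrite ltr_wpDl ?modulus_ge0.
exists (Num.min d (e / M)); first by rewrite lt_min d0 divr_gt0.
move=> w; rewrite lt_min => /andP[/hd].
rewrite addrCA subrr addr0 mul1r => h1; rewrite ltr_pdivlMr// => h2.
apply: le_lt_trans h2.
have -> : f w - f z = f w - f z - derive1 f z * (w - z) + derive1 f z * (w - z).
  by rewrite subrK.
apply: le_trans (ler_modulusD _ _) _.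
have -> : modulus (w - z) * M =
    modulus (w - z) + modulus (derive1 f z) * modulus (w - z) by rewrite /M; ring.
by rewrite modulusM lerD2r.
Qed.

End complex_plane.

Section real_derivatives.
Context {R : realType}.
Implicit Types (f g : R -> R) (x a b : R).
Local Notation "'dr' x f a" := (is_derive (x : R) (1 : R) (f : R -> R) (a : R))
  (at level 10, x at next level, f at next level, a at next level).

Lemma is_derive_fun_eq f x a b : dr x f a -> a = b -> dr x f b.
Proof. by move=> h <-. Qed.

Lemma is_derive_funD f g x a b : dr x f a -> dr x g b ->
  dr x (fun t => f t + g t) (a + b).
Proof. by move=> hf hg; exact: (is_deriveD hf hg). Qed.

Lemma is_derive_funN f x a : dr x f a -> dr x (fun t => - f t) (- a).
Proof. by move=> hf; exact: (is_deriveN hf). Qed.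

Lemma is_derive_funB f g x a b : dr x f a -> dr x g b ->
  dr x (fun t => f t - g t) (a - b).
Proof. by move=> hf hg; exact: (is_deriveB hf hg). Qed.

Lemma is_derive_funM f g x a b : dr x f a -> dr x g b ->
  dr x (fun t => f t * g t) (a * g x + f x * b).
Proof.
move=> hf hg; apply: is_derive_fun_eq (is_deriveM hf hg) _.
by rewrite addrC [a * _]mulrC.
Qed.

Lemma is_derive_fun_cst c x : dr x (fun=> c) 0.
Proof. exact: is_derive_cst. Qed.

Lemma is_derive_fun_id x : dr x (fun t => t) 1.
Proof. exact: is_derive_id. Qed.

Lemma is_derive_fun_cmul c f x a : dr x f a -> dr x (fun t => c * f t) (c * a).
Proof.
move=> hf; apply: is_derive_fun_eq (is_derive_funM (is_derive_fun_cst c x) hf) _.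
by rewrite mul0r add0r.
Qed.

Lemma is_derive_fun_sqr f x a : dr x f a -> dr x (fun t => f t ^+ 2) (2 * f x * a).
Proof.
move=> hf; apply: is_derive_fun_eq (is_derive_funM hf hf) _.
by ring.
Qed.

Lemma is_derive_fun_comp f g x a b : dr (f x) g b -> dr x f a ->
  dr x (fun t => g (f t)) (b * a).
Proof. by move=> hg hf; exact: (is_derive1_comp hg hf). Qed.

Lemma is_derive_fun_ln f x a : 0 < f x -> dr x f a ->
  dr x (fun t => ln (f t)) (a / f x).
Proof.
move=> fx hf; apply: is_derive_fun_eq (is_derive_fun_comp (is_derive1_ln fx) hf) _.
by rewrite mulrC.
Qed.

Lemma is_derive_fun_expR f x a : dr x f a ->
  dr x (fun t => expR (f t)) (expR (f x) * a).
Proof. by move=> hf; exact: (is_derive_fun_comp (is_derive_expR _) hf). Qed.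

Lemma is_derive_fun_cos f x a : dr x f a ->
  dr x (fun t => cos (f t)) (- sin (f x) * a).
Proof. by move=> hf; exact: (is_derive_fun_comp (is_derive_cos _) hf). Qed.

Lemma is_derive_fun_sin f x a : dr x f a ->
  dr x (fun t => sin (f t)) (cos (f x) * a).
Proof. by move=> hf; exact: (is_derive_fun_comp (is_derive_sin _) hf). Qed.

Lemma is_derive_continuous f x a : dr x f a -> {for x, continuous f}.
Proof. by move=> [df _]; apply/differentiable_continuous/derivable1_diffP. Qed.

Lemma is_derive_mean f (df : R -> R) s t : s <= t ->
  (forall u, s <= u <= t -> dr u f (df u)) ->
  exists2 u, s <= u <= t & f t - f s = df u * (t - s).
Proof.
move=> st dff.
have [||u ust E] := @MVT_segment R f df s t st.
- by move=> u; rewrite in_itv/= => /andP[su ut]; apply: dff; rewrite !ltW.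
- apply/continuous_in_subspaceT => u; rewrite inE/= in_itv/= => /dff.
  exact: is_derive_continuous.
by exists u => //; move: ust; rewrite in_itv.
Qed.

Lemma is_derive_le0_nonincr f (df : R -> R) s t : s <= t ->
  (forall u, s <= u <= t -> dr u f (df u)) ->
  (forall u, s <= u <= t -> df u <= 0) -> f t <= f s.
Proof.
move=> st dff df0; have [u ust E] := is_derive_mean st dff.
by rewrite -subr_le0 E mulr_le0_ge0// ?df0// subr_ge0.
Qed.

Lemma is_derive_ge0_nondecr f (df : R -> R) s t : s <= t ->
  (forall u, s <= u <= t -> dr u f (df u)) ->
  (forall u, s <= u <= t -> 0 <= df u) -> f s <= f t.
Proof.
move=> st dff df0; have [u ust E] := is_derive_mean st dff.
by rewrite -subr_ge0 E mulr_ge0// ?df0// subr_ge0.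
Qed.

Lemma is_derive_bounded f (df : R -> R) s t c : s <= t ->
  (forall u, s <= u <= t -> dr u f (df u)) ->
  (forall u, s <= u <= t -> `|df u| <= c) -> `|f t - f s| <= c * (t - s).
Proof.
move=> st dff dfc; have [u ust E] := is_derive_mean st dff.
by rewrite E normrM (@ger0_norm _ (t - s)) ?subr_ge0// ler_wpM2r ?subr_ge0// dfc.
Qed.

End real_derivatives.

(** * Differentiation of complex trajectories *)

Section complex_trajectories.
Context {R : realType}.
Local Notation Re := complex.Re.
Local Notation Im := complex.Im.
Implicit Types (Z : R -> CC R) (l c : CC R) (u t T : R).

Definition cderive Z u l :=
  is_derive u (1 : R) (fun s => Re (Z s)) (Re l) /\
  is_derive u (1 : R) (fun s => Im (Z s)) (Im l).

Lemma cderiveD Z Z' u l l' : cderive Z u l -> cderive Z' u l' ->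
  cderive (fun s => Z s + Z' s) u (l + l').
Proof.
move=> [dr di] [dr' di']; split.
- under eq_fun do rewrite Re_add.
  by rewrite Re_add; exact: is_derive_funD.
- under eq_fun do rewrite Im_add.
  by rewrite Im_add; exact: is_derive_funD.
Qed.

Lemma cderiveZ c Z u l : cderive Z u l -> cderive (fun s => c * Z s) u (c * l).
Proof.
move=> [dr di]; split.
- under eq_fun do rewrite Re_mul.
  by rewrite Re_mul; apply: is_derive_funB; exact: is_derive_fun_cmul.
- under eq_fun do rewrite Im_mul.
  by rewrite Im_mul; apply: is_derive_funD; exact: is_derive_fun_cmul.
Qed.

Lemma cderiveB Z Z' u l l' : cderive Z u l -> cderive Z' u l' ->
  cderive (fun s => Z s - Z' s) u (l - l').
Proof.
move=> h h'; have := cderiveD h (cderiveZ (-1) h').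
by under eq_fun do rewrite mulN1r; rewrite mulN1r.
Qed.

Lemma is_derive_modulus_sq Z u l : cderive Z u l ->
  is_derive u (1 : R) (fun s => modulus (Z s) ^+ 2)
    (2 * (Re (Z u) * Re l + Im (Z u) * Im l)).
Proof.
move=> [dr di]; under eq_fun do rewrite modulus_sq.
apply: is_derive_fun_eq (is_derive_funD (is_derive_fun_sqr dr) (is_derive_fun_sqr di)) _.
by ring.
Qed.

Lemma Re_dot_mul (z l : CC R) : Re z * Re (l * z) + Im z * Im (l * z) = Re l * modulus z ^+ 2.
Proof. by rewrite modulus_sq Re_mul Im_mul; ring. Qed.

Lemma dot_le_modulus (z w : CC R) : Re z * Re w + Im z * Im w <= modulus z * modulus w.
Proof.
apply: le_trans (ler_norm _) _.
rewrite -(ler_pXn2r (_ : 0 < 2)%N) ?nnegrE ?mulr_ge0 ?modulus_ge0//.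
rewrite exprMn !modulus_sq real_normK ?num_real//.
rewrite -subr_ge0 (_ : _ - _ = (Re z * Im w - Im z * Re w) ^+ 2) ?sqr_ge0//.
by ring.
Qed.

(** The function [(|E|^2 + c^2) exp(-(2 L + 1) s)] is nonincreasing. The added [c^2] absorbs the
    forcing term, since [2 |E| c <= |E|^2 + c^2]; squares keep everything differentiable at zeros of
    [E]. *)
Lemma gronwall (E la ph : R -> CC R) t (L c : R) : 0 <= t -> 0 <= L -> 0 <= c ->
  (forall u, 0 <= u <= t -> [/\ cderive E u (la u * E u + ph u),
     modulus (la u) <= L & modulus (ph u) <= c]) ->
  modulus (E t) ^+ 2 <= (modulus (E 0) ^+ 2 + c ^+ 2) * expR ((2 * L + 1) * t).
Proof.
move=> t0 L0 c0 H.
pose F s := (modulus (E s) ^+ 2 + c ^+ 2) * expR (- (2 * L + 1) * s).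
have : F t <= F 0.
  pose dF u := (2 * (Re (E u) * Re (la u * E u + ph u) + Im (E u) * Im (la u * E u + ph u)))
    * expR (- (2 * L + 1) * u)
    + (modulus (E u) ^+ 2 + c ^+ 2) * (expR (- (2 * L + 1) * u) * - (2 * L + 1)).
  apply: (is_derive_le0_nonincr (df := dF) t0) => u /H[dE hla hph].
    apply: is_derive_fun_eq (is_derive_funM (is_derive_funD (is_derive_modulus_sq dE)
      (is_derive_fun_cst (c ^+ 2) u))
      (is_derive_fun_expR (is_derive_fun_cmul (- (2 * L + 1)) (is_derive_fun_id u)))) _.
    by rewrite /dF; ring.
  have -> : dF u = (2 * Re (la u) * modulus (E u) ^+ 2
      + 2 * (Re (E u) * Re (ph u) + Im (E u) * Im (ph u))
      - (2 * L + 1) * (modulus (E u) ^+ 2 + c ^+ 2)) * expR (- (2 * L + 1) * u).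
    rewrite -mulrA -Re_dot_mul /dF Re_add Im_add; ring.
  rewrite mulr_le0_ge0 ?expR_ge0//.
  have h1 : Re (la u) * modulus (E u) ^+ 2 <= L * modulus (E u) ^+ 2.
    rewrite ler_wpM2r ?sqr_ge0//; apply: le_trans hla.
    exact: le_trans (ler_norm _) (Re_le_modulus _).
  have h2 : Re (E u) * Re (ph u) + Im (E u) * Im (ph u) <= modulus (E u) * c.
    by apply: le_trans (dot_le_modulus _ _) _; rewrite ler_wpM2l ?modulus_ge0.
  have h3 : 2 * (modulus (E u) * c) <= modulus (E u) ^+ 2 + c ^+ 2.
    by rewrite -subr_ge0 (_ : _ - _ = (modulus (E u) - c) ^+ 2) ?sqr_ge0//; ring.
  have h4 : 0 <= L * c ^+ 2 by rewrite mulr_ge0 ?sqr_ge0.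
  nra.
rewrite /F mulr0 expR0 mulr1 mulNr expRN.
rewrite ler_pdivrMr ?expR_gt0//; apply: le_trans.
by rewrite lerDl sqr_ge0.
Qed.

(** Prolonging [Z] affinely beyond [0] and [T] with the slopes [l 0] and [l T] turns the one-sided
    derivatives at the endpoints into two-sided ones, so that ordinary calculus applies on the
    closed interval. *)
Lemma extend_trajectory T Z (l : R -> CC R) : 0 <= T ->
  (forall u, 0 <= u <= T -> has_derivative_within `[0, T] Z u (l u)) ->
  exists Z', forall u, 0 <= u <= T -> Z' u = Z u /\ cderive Z' u (l u).
Proof.
move=> T0 dZ.
pose Z' (s : R) : CC R := if s < 0 then Z 0 + l 0 * s%:C
  else if T < s then Z T + l T * (s - T)%:C else Z s.
have Z'E u : 0 <= u <= T -> Z' u = Z u.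
  by case/andP => u0 uT; rewrite /Z' ltNge u0 ltNge uT.
exists Z' => u uT; split; first exact: Z'E.
have /andP[u0 uT'] := uT.
have H e : 0 < e -> exists2 d, 0 < d & forall h, `|h| < d ->
    modulus (Z' (u + h) - Z' u - l u * h%:C) <= e * `|h|.
  move=> e0.
  have /cvg_modulusP/(_ e e0)/nbhs_ballP[d1/= d10 hd1] := dZ u uT.
  (* With these radii [u + h] leaves [[0, T]] on the left only if [u = 0] and on the right only if
     [u = T]; the value [1] is a placeholder at the endpoint itself. *)
  pose d2 := if u == 0 then 1 else u.
  pose d3 := if u == T then 1 else T - u.
  have d20 : 0 < d2.
    by rewrite /d2; case: (eqVneq u 0) => [//|nu0]; rewrite lt_neqAle eq_sym nu0.
  have d30 : 0 < d3.
    rewrite /d3; case: (eqVneq u T) => [//|nuT].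
    by rewrite subr_gt0 lt_neqAle nuT.
  exists (Num.min d1 (Num.min d2 d3)); first by rewrite !lt_min d10 d20.
  move=> h; rewrite !lt_min => /and3P[hh1 hh2 hh3].
  have [h0|nh0] := eqVneq h 0.
    by rewrite h0 addr0 subrr sub0r mulr0 oppr0 modulus0 normr0 mulr0.
  have eh0 : 0 <= e * `|h| by rewrite mulr_ge0// ltW.
  rewrite (Z'E u uT).
  have [uh0|uh0] := ltP (u + h) 0.
    have u00 : u = 0.
      apply: contraTeq hh2 => nu0; rewrite /d2 (negbTE nu0) -leNgt.
      by rewrite ltr0_norm; lra.
    rewrite /Z' uh0 u00 add0r.
    by rewrite addrAC addrK subrr modulus0.
  have [uhT|uhT] := ltP T (u + h).
    have uTT : u = T.
      apply: contraTeq hh3 => nuT; rewrite /d3 (negbTE nuT) -leNgt.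
      by rewrite gtr0_norm; lra.
    rewrite /Z' ltNge uh0/= uhT uTT [T + h]addrC addrK.
    by rewrite addrAC addrK subrr modulus0.
  rewrite Z'E ?uh0//.
  have := hd1 (u + h); rewrite /ball/= opprD addrA subrr sub0r normrN => /(_ hh1).
  have nuh : u + h != u by rewrite -subr_eq0 addrC addKr.
  move=> /(_ nuh) ; rewrite in_itv/= uh0 uhT => /(_ isT).
  rewrite [u + h - u]addrC addKr modulusB => hm.
  have hC0 : (h%:C : CC R) != 0 by rewrite -modulus_gt0 modulusR normr_gt0.
  have -> : Z (u + h) - Z u - l u * h%:C =
      ((Z (u + h) - Z u) / h%:C - l u) * h%:C by rewrite mulrBl divfK.
  by rewrite modulusM modulusR ler_wpM2r// ltW.
split; apply/is_derive_realP => e /H[d d0 hd]; exists d => // h /hd.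
- apply: le_trans; apply: le_trans (Re_le_modulus _).
  by rewrite !Re_sub Re_mul /= mulr0 subr0.
- apply: le_trans; apply: le_trans (Im_le_modulus _).
  by rewrite !Im_sub Im_mul /= mulr0 add0r.
Qed.

End complex_trajectories.

(** * Loewner flows *)

Section flows.
Context {R : realType}.
Local Notation Re := complex.Re.
Local Notation Im := complex.Im.
Variables (T al : R) (be ga U : R -> CC R).
Hypothesis T0 : 0 <= T.
Hypothesis al1 : `|al| <= 1.
Hypothesis ga2 : forall u, 0 <= u <= T -> modulus (ga u) <= 2.
Implicit Types (Z : R -> CC R) (u t e : R).

(* Both Loewner equations have this form: [al = 0], [be = 0], [ga = 2], [U = W]
   in the chordal case, [al = -1], [be = - 2 W], [ga = - 2 W ^+ 2], [U = W] in
   the radial case. *)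
Definition flow Z := forall u, 0 <= u <= T -> Z u != U u /\
  cderive Z u (al%:C * Z u + be u + ga u / (Z u - U u)).

(** The divided difference of the vector field at two points: the difference of two solutions
    satisfies a linear equation with this coefficient, without remainder. *)
Let la Z Z' u : CC R := al%:C - ga u / ((Z u - U u) * (Z' u - U u)).

Lemma flow_diff Z Z' u : flow Z -> flow Z' -> 0 <= u <= T ->
  cderive (fun s => Z s - Z' s) u (la Z Z' u * (Z u - Z' u)).
Proof.
move=> fZ fZ' uT; have [Zu dZ] := fZ u uT; have [Zu' dZ'] := fZ' u uT.
have -> : la Z Z' u * (Z u - Z' u) = al%:C * Z u + be u + ga u / (Z u - U u)
    - (al%:C * Z' u + be u + ga u / (Z' u - U u)).
  rewrite /la; field.
  by rewrite !subr_eq0 Zu Zu'.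
exact: cderiveB.
Qed.

Variable d : R.
Hypothesis d0 : 0 < d.

Definition separated_flow Z :=
  flow Z /\ forall u, 0 <= u <= T -> d <= modulus (Z u - U u).

(** A bound for [|la|] on separated flows, from [|al| <= 1] and [|ga| <= 2]; [M] is the resulting
    Gronwall factor. *)
Let L := 1 + 2 / d ^+ 2.
Let M := expR ((2 * L + 1) * T).

Let L0 : 0 <= L. Proof. by rewrite addr_ge0// divr_ge0// sqr_ge0. Qed.

Let M1 : 1 <= M.
Proof.
by rewrite -expR0 ler_expR mulr_ge0// addr_ge0// mulr_ge0.
Qed.

Let M0 : 0 < M. Proof. exact: expR_gt0. Qed.

Let modulus_la Z Z' u : separated_flow Z -> separated_flow Z' -> 0 <= u <= T ->
  modulus (la Z Z' u) <= L.
Proof.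
move=> [_ sZ] [_ sZ'] uT; rewrite /la.
apply: le_trans (ler_modulusB _ _) _; apply: lerD; first by rewrite modulusR.
rewrite modulusM modulusV modulusM; apply: ler_pM.
- exact: modulus_ge0.
- by rewrite invr_ge0 mulr_ge0 ?modulus_ge0.
- exact: ga2.
- rewrite lef_pV2 ?posrE ?exprn_gt0// ?mulr_gt0//.
  + by rewrite expr2; apply: ler_pM; rewrite ?(ltW d0) ?sZ ?sZ'.
  + exact: lt_le_trans d0 (sZ _ uT).
  + exact: lt_le_trans d0 (sZ' _ uT).
Qed.

(** As [M >= 1], one has [M <= M^2], so [M] itself serves after taking square roots. *)
Let sqrt_bound (a c t : R) : 0 <= t <= T -> 0 <= a -> 0 <= c ->
  a ^+ 2 <= c ^+ 2 * expR ((2 * L + 1) * t) -> a <= c * M.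
Proof.
move=> /andP[t0 tT] a0 c0 h.
rewrite -(ler_pXn2r (_ : 0 < 2)%N) ?nnegrE ?mulr_ge0 ?(ltW M0)//.
apply: le_trans h _; rewrite exprMn ler_wpM2l ?sqr_ge0//.
apply: (@le_trans _ _ M).
  by rewrite ler_expR ler_wpM2l// addr_ge0// mulr_ge0.
by rewrite expr2 ler_peMr// ltW.
Qed.

Lemma flow_dist Z Z' t : separated_flow Z -> separated_flow Z' -> 0 <= t <= T ->
  modulus (Z t - Z' t) <= modulus (Z 0 - Z' 0) * M.
Proof.
move=> sZ sZ' tT; have /andP[t0 tT'] := tT.
apply: (sqrt_bound tT); rewrite ?modulus_ge0//.
have := @gronwall R (fun s => Z s - Z' s) (la Z Z') (fun=> 0) t L 0 t0 L0 (lexx 0).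
rewrite expr0n addr0; apply => u /andP[u0 ut].
have uT : 0 <= u <= T by rewrite u0 (le_trans ut tT').
split; last by rewrite modulus0.
  by rewrite addr0; apply: flow_diff uT; [exact: sZ.1|exact: sZ'.1].
exact: modulus_la.
Qed.

Let la0 Z u := la Z Z u.

(** The Taylor remainder of [ga / (z - U)] beyond first order, in closed form. *)
Let rest Z Z' u : CC R :=
  ga u * ((Z' u - Z u) ^+ 2 / ((Z u - U u) ^+ 2 * (Z' u - U u))).

Let flow_expand Z Z' u : separated_flow Z -> separated_flow Z' -> 0 <= u <= T ->
  cderive (fun s => Z' s - Z s) u (la0 Z u * (Z' u - Z u) + rest Z Z' u).
Proof.
move=> [fZ _] [fZ' _] uT; have [Zu _] := fZ u uT; have [Zu' _] := fZ' u uT.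
have -> : la0 Z u * (Z' u - Z u) + rest Z Z' u = la Z' Z u * (Z' u - Z u).
  rewrite /la0 /rest /la; field.
  by rewrite !subr_eq0 Zu Zu'.
exact: flow_diff.
Qed.

Let modulus_rest Z Z' u e : separated_flow Z -> separated_flow Z' -> 0 <= u <= T ->
  modulus (Z' u - Z u) <= e -> modulus (rest Z Z' u) <= 2 * (e ^+ 2 / d ^+ 3).
Proof.
move=> [_ sZ] [_ sZ'] uT he.
have e0 : 0 <= e by exact: le_trans (modulus_ge0 _) he.
rewrite /rest modulusM; apply: ler_pM; rewrite ?modulus_ge0 ?ga2//.
rewrite modulusM modulusX modulusV modulusM modulusX.
apply: ler_pM; rewrite ?invr_ge0 ?exprn_ge0 ?mulr_ge0 ?exprn_ge0 ?modulus_ge0//.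
  by rewrite ler_pXn2r// nnegrE modulus_ge0.
have A0 := lt_le_trans d0 (sZ _ uT); have A0' := lt_le_trans d0 (sZ' _ uT).
rewrite lef_pV2 ?posrE ?exprn_gt0 ?mulr_gt0 ?exprn_gt0//.
rewrite [d ^+ 3]exprSr; apply: ler_pM; rewrite ?exprn_ge0 ?(ltW d0) ?sZ'//.
by rewrite ler_pXn2r ?nnegrE ?(ltW d0) ?modulus_ge0 ?sZ.
Qed.

Let C2 := 4 * (M ^+ 2 / d ^+ 3) * M.

(** The linearised flow is complex linear, so a factor [om] between two initial displacements
    persists up to the quadratic remainders. *)
Let flow_second Z Z1 Z2 om e t : separated_flow Z -> separated_flow Z1 ->
  separated_flow Z2 -> modulus om = 1 -> 0 <= e -> modulus (Z1 0 - Z 0) <= e ->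
  Z2 0 - Z 0 = om * (Z1 0 - Z 0) -> 0 <= t <= T ->
  modulus ((Z2 t - Z t) - om * (Z1 t - Z t)) <= C2 * e ^+ 2.
Proof.
move=> sZ sZ1 sZ2 om1 e0 Z1e Z2Z1 tT; have /andP[t0 tT'] := tT.
pose c := 4 * ((e * M) ^+ 2 / d ^+ 3).
have c0 : 0 <= c by rewrite mulr_ge0// divr_ge0// ?sqr_ge0// exprn_ge0// ltW.
have -> : C2 * e ^+ 2 = c * M.
  by rewrite /C2 /c; field; rewrite gt_eqF.
apply: (sqrt_bound tT); rewrite ?modulus_ge0//.
have := @gronwall R (fun s => (Z2 s - Z s) - om * (Z1 s - Z s)) (la0 Z)
  (fun u => rest Z Z2 u - om * rest Z Z1 u) t L c t0 L0 c0.
rewrite Z2Z1 subrr modulus0 expr0n add0r; apply => u /andP[u0 ut].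
have uT : 0 <= u <= T by rewrite u0 (le_trans ut tT').
have Z2e : modulus (Z2 0 - Z 0) <= e by rewrite Z2Z1 modulusM om1 mul1r.
have h1 : modulus (Z1 u - Z u) <= e * M.
  by apply: le_trans (flow_dist sZ1 sZ uT) _; rewrite ler_wpM2r// ltW.
have h2 : modulus (Z2 u - Z u) <= e * M.
  by apply: le_trans (flow_dist sZ2 sZ uT) _; rewrite ler_wpM2r// ltW.
split; last 2 first.
- exact: modulus_la.
- apply: le_trans (ler_modulusB _ _) _; rewrite modulusM om1 mul1r.
  have := modulus_rest sZ sZ1 uT h1; have := modulus_rest sZ sZ2 uT h2.
  by rewrite /c; lra.
have -> : la0 Z u * (Z2 u - Z u - om * (Z1 u - Z u)) + (rest Z Z2 u - om * rest Z Z1 u)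
  = la0 Z u * (Z2 u - Z u) + rest Z Z2 u - om * (la0 Z u * (Z1 u - Z u) + rest Z Z1 u).
  by ring.
by apply: cderiveB; [|apply: cderiveZ]; exact: flow_expand.
Qed.

(* The four directions [1, 'i, -1, -'i] kill the first and second order terms of
   the flow, which is a discrete form of harmonicity in the initial point. *)
Lemma flow_four_points Z : separated_flow Z -> exists2 C, 0 <= C &
  forall e Z1 Z2 Z3 Z4, 0 <= e -> separated_flow Z1 -> separated_flow Z2 ->
  separated_flow Z3 -> separated_flow Z4 ->
  Z1 0 = Z 0 + e%:C -> Z2 0 = Z 0 + 'i * e%:C ->
  Z3 0 = Z 0 - e%:C -> Z4 0 = Z 0 - 'i * e%:C ->
  modulus (Z1 T + Z2 T + Z3 T + Z4 T - 4%:R * Z T) <= C * e ^+ 3.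
Proof.
move=> sZ.
(* Three cross products of size [C2 e^2 * 2 e M], divided by [d^3], and four cubic remainders, all
   multiplied by [|ga| <= 2]. *)
pose C3 := 2 * (6 * C2 * M / d ^+ 3 + 4 * M ^+ 3 / d ^+ 4).
have C20 : 0 <= C2.
  by rewrite !mulr_ge0 ?invr_ge0 ?exprn_ge0 ?(ltW M0) ?(ltW d0).
have C30 : 0 <= C3.
  by rewrite !(mulr_ge0, addr_ge0) ?invr_ge0 ?exprn_ge0 ?(ltW M0) ?(ltW d0).
exists (C3 * M); first by rewrite mulr_ge0// ltW.
move=> e Z1 Z2 Z3 Z4 e0 s1 s2 s3 s4 E1 E2 E3 E4.
have TT : 0 <= T <= T by rewrite T0 lexx.
have -> : Z1 T + Z2 T + Z3 T + Z4 T - 4%:R * Z T =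
    (Z1 T - Z T) + (Z2 T - Z T) + (Z3 T - Z T) + (Z4 T - Z T) by ring.
have -> : C3 * M * e ^+ 3 = (C3 * e ^+ 3) * M by ring.
have c0 : 0 <= C3 * e ^+ 3 by rewrite mulr_ge0// exprn_ge0.
apply: (sqrt_bound TT); rewrite ?modulus_ge0//.
have := @gronwall R (fun s => (Z1 s - Z s) + (Z2 s - Z s) + (Z3 s - Z s) + (Z4 s - Z s))
  (la0 Z) (fun u => rest Z Z1 u + rest Z Z2 u + rest Z Z3 u + rest Z Z4 u)
  T L (C3 * e ^+ 3) T0 L0 c0.
have -> : (Z1 0 - Z 0) + (Z2 0 - Z 0) + (Z3 0 - Z 0) + (Z4 0 - Z 0) = 0.
  by rewrite E1 E2 E3 E4; ring.
rewrite modulus0 expr0n add0r; apply => u uT.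
have ii : 'i * 'i = -1 :> CC R by apply: eq_ReIm; rewrite /= ?Re_mul ?Im_mul/=; ring.
have mi : modulus ('i : CC R) = 1.
  have : modulus ('i : CC R) ^+ 2 = 1 by rewrite modulus_sq/= expr0n expr1n add0r.
  by move=> /eqP; rewrite sqrp_eq1 ?modulus_ge0// => /eqP.
have D1 : Z1 0 - Z 0 = e%:C by rewrite E1; ring.
have m1 : modulus (Z1 0 - Z 0) <= e by rewrite D1 modulusR ger0_norm.
have m2 : modulus (Z2 0 - Z 0) <= e.
  by rewrite E2 addrAC subrr add0r modulusM mi mul1r modulusR ger0_norm.
have m3 : modulus (Z3 0 - Z 0) <= e.
  by rewrite E3 addrAC subrr add0r modulusN modulusR ger0_norm.
have m4 : modulus (Z4 0 - Z 0) <= e.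
  by rewrite E4 addrAC subrr add0r modulusN modulusM mi mul1r modulusR ger0_norm.
have hD Z' : separated_flow Z' -> modulus (Z' 0 - Z 0) <= e -> modulus (Z' u - Z u) <= e * M.
  by move=> sZ' h; apply: le_trans (flow_dist sZ' sZ uT) _; rewrite ler_wpM2r// ltW.
have h1 := hD _ s1 m1; have h2 := hD _ s2 m2.
have h3 := hD _ s3 m3; have h4 := hD _ s4 m4.
split; last 2 first.
- exact: modulus_la.
- have [fZ dZ] := sZ; have A0 := lt_le_trans d0 (dZ u uT).
  have F2 : modulus ((Z2 u - Z u) - 'i * (Z1 u - Z u)) <= C2 * e ^+ 2.
    by apply: flow_second => //; rewrite D1 E2; ring.
  have F3 : modulus ((Z3 u - Z u) - (-1) * (Z1 u - Z u)) <= C2 * e ^+ 2.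
    apply: flow_second => //; first by rewrite modulusN modulus1.
    by rewrite D1 E3; ring.
  have F4 : modulus ((Z4 u - Z u) - (- 'i) * (Z1 u - Z u)) <= C2 * e ^+ 2.
    apply: flow_second => //; first by rewrite modulusN.
    by rewrite D1 E4; ring.
  pose A := Z u - U u.
  have nz Z' : separated_flow Z' -> Z' u - U u != 0.
    by move=> [fZ' _]; rewrite subr_eq0; have [] := fZ' u uT.
  (* One more Taylor order is split off: [rest] is [ga] times the square of the displacement over
     [A^3], minus this [O(e^3)] term. *)
  pose cub Z' : CC R := (Z' u - Z u) ^+ 3 / (A ^+ 3 * (Z' u - U u)).
  have restE Z' : separated_flow Z' ->
      rest Z Z' u = ga u * ((Z' u - Z u) ^+ 2 / A ^+ 3 - cub Z').
    move=> sZ'; rewrite /rest /cub /A; field.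
    by rewrite !nz.
  have cubE Z' : separated_flow Z' -> modulus (Z' u - Z u) <= e * M ->
      modulus (cub Z') <= (e * M) ^+ 3 / d ^+ 4.
    move=> sZ' hZ'; have A0' := lt_le_trans d0 (sZ'.2 u uT).
    rewrite /cub modulusM modulusX modulusV modulusM modulusX.
    apply: ler_pM; rewrite ?invr_ge0 ?exprn_ge0 ?mulr_ge0 ?exprn_ge0 ?modulus_ge0//.
      by rewrite ler_pXn2r// nnegrE ?modulus_ge0// mulr_ge0// ltW.
    rewrite lef_pV2 ?posrE ?exprn_gt0 ?mulr_gt0 ?exprn_gt0//.
    rewrite [d ^+ 4]exprSr; apply: ler_pM; rewrite ?exprn_ge0 ?(ltW d0)//; last exact: sZ'.2.
    by rewrite ler_pXn2r ?nnegrE ?(ltW d0) ?modulus_ge0 ?dZ.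
  (* The squares of the four directions sum to [0], so the sum of squared displacements is a sum of
     differences [x^2 - om^2 x1^2]. Each factors into an [O(e^2)] term given by [flow_second] and an
     [O(e)] term. *)
  have -> : rest Z Z1 u + rest Z Z2 u + rest Z Z3 u + rest Z Z4 u = ga u *
     ((((Z2 u - Z u) - 'i * (Z1 u - Z u)) * ((Z2 u - Z u) + 'i * (Z1 u - Z u))
     + ((Z3 u - Z u) - (-1) * (Z1 u - Z u)) * ((Z3 u - Z u) + (-1) * (Z1 u - Z u))
     + ((Z4 u - Z u) - (- 'i) * (Z1 u - Z u)) * ((Z4 u - Z u) + (- 'i) * (Z1 u - Z u)))
     / A ^+ 3 - (cub Z1 + cub Z2 + cub Z3 + cub Z4)).
    rewrite !restE//.
    set x1 := Z1 u - Z u; set x2 := Z2 u - Z u; set x3 := Z3 u - Z u; set x4 := Z4 u - Z u.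
    have -> : (x2 - 'i * x1) * (x2 + 'i * x1) + (x3 - -1 * x1) * (x3 + -1 * x1)
        + (x4 - - 'i * x1) * (x4 + - 'i * x1) =
        x2 ^+ 2 + x3 ^+ 2 + x4 ^+ 2 - (2%:R * ('i * 'i) + 1) * x1 ^+ 2 by ring.
    by rewrite ii; ring.
  have crossE (x y om : CC R) : modulus om = 1 -> modulus (x - om * y) <= C2 * e ^+ 2 ->
      modulus x <= e * M -> modulus y <= e * M ->
      modulus ((x - om * y) * (x + om * y)) <= C2 * e ^+ 2 * (2 * (e * M)).
    move=> om1 hxy hx hy; rewrite modulusM; apply: ler_pM; rewrite ?modulus_ge0//.
    by apply: le_trans (ler_modulusD _ _) _; rewrite modulusM om1 mul1r; lra.
  have G2 := crossE _ _ _ mi F2 h2 h1.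
  have G3 := crossE _ _ _ (etrans (modulusN _) (@modulus1 R)) F3 h3 h1.
  have G4 := crossE _ _ _ (etrans (modulusN _) mi) F4 h4 h1.
  rewrite modulusM.
  have -> : C3 * e ^+ 3 = 2 * (3 * (C2 * e ^+ 2 * (2 * (e * M))) / d ^+ 3
      + 4 * ((e * M) ^+ 3 / d ^+ 4)).
    by rewrite /C3; field; rewrite gt_eqF.
  apply: ler_pM; rewrite ?modulus_ge0 ?ga2//.
  apply: le_trans (ler_modulusB _ _) _; apply: lerD.
    rewrite modulusM modulusV modulusX; apply: ler_pM; rewrite ?invr_ge0 ?exprn_ge0 ?modulus_ge0//.
      apply: le_trans (ler_modulusD _ _) _.
      have := ler_modulusD (((Z2 u - Z u) - 'i * (Z1 u - Z u)) * ((Z2 u - Z u) + 'i * (Z1 u - Z u))) (((Z3 u - Z u) - (-1) * (Z1 u - Z u)) * ((Z3 u - Z u) + (-1) * (Z1 u - Z u))).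
      by lra.
    rewrite lef_pV2 ?posrE ?exprn_gt0//.
    by rewrite ler_pXn2r ?nnegrE ?(ltW d0) ?modulus_ge0 ?dZ.
  have k1 := cubE _ s1 h1; have k2 := cubE _ s2 h2.
  have k3 := cubE _ s3 h3; have k4 := cubE _ s4 h4.
  apply: le_trans (ler_modulusD _ _) _.
  have j1 := ler_modulusD (cub Z1 + cub Z2) (cub Z3).
  have j2 := ler_modulusD (cub Z1) (cub Z2).
  by lra.
have -> : la0 Z u * (Z1 u - Z u + (Z2 u - Z u) + (Z3 u - Z u) + (Z4 u - Z u)) +
   (rest Z Z1 u + rest Z Z2 u + rest Z Z3 u + rest Z Z4 u) =
   (la0 Z u * (Z1 u - Z u) + rest Z Z1 u) + (la0 Z u * (Z2 u - Z u) + rest Z Z2 u)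
   + (la0 Z u * (Z3 u - Z u) + rest Z Z3 u) + (la0 Z u * (Z4 u - Z u) + rest Z Z4 u).
  by ring.
by do 3 (apply: cderiveD; last exact: flow_expand); exact: flow_expand.
Qed.

End flows.

(** * Hopf's boundary point lemma *)

Section boundary_point_lemma.
Context {R : realType}.
Local Notation Re := complex.Re.
Local Notation Im := complex.Im.

(** The extreme value theorem on an annulus, pulled back to [R * R], where boxes are compact. *)
Lemma compact_plane_min (v : CC R -> R) (p : CC R) (r a b : R) :
  (forall z, a <= modulus (z - p) ^+ 2 <= b -> modulus (z - p) <= r) ->
  (forall z, a <= modulus (z - p) ^+ 2 <= b -> forall e, 0 < e ->
     exists2 d, 0 < d & forall w, modulus (w - z) < d -> `|v w - v z| < e) ->
  (exists z, a <= modulus (z - p) ^+ 2 <= b) ->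
  exists2 c, a <= modulus (c - p) ^+ 2 <= b &
    forall z, a <= modulus (z - p) ^+ 2 <= b -> v c <= v z.
Proof.
move=> Kr vK [z0 z0K].
pose toC (xy : R * R) : CC R := xy.1 +i* xy.2.
pose q (xy : R * R) : R :=
  (xy.1 - Re p) * (xy.1 - Re p) + (xy.2 - Im p) * (xy.2 - Im p).
have qE xy : modulus (toC xy - p) ^+ 2 = q xy.
  by rewrite modulus_sq Re_sub Im_sub !expr2.
pose K := [set xy | a <= q xy <= b].
have cq : continuous q.
  by move=> xy; apply: cvgD; apply: cvgM; apply: cvgB;
    (exact: cvg_cst || exact: cvg_fst || exact: cvg_snd).
have K0 : K !=set0.
  by exists (Re z0, Im z0); rewrite /K/= -qE; have -> : toC (Re z0, Im z0) = z0 by case: (z0).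
have cK : compact K.
  apply: (@subclosed_compact _ _ (`[Re p - r, Re p + r] `*` `[Im p - r, Im p + r])).
  - have -> : K = q @^-1` `[a, b] by apply/seteqP; split => xy; rewrite /K/= in_itv.
    by apply: closed_comp => //; exact: interval_closed.
  - by apply: compact_setX; exact: segment_compact.
  - move=> xy; rewrite /K/= -qE => /Kr h; rewrite !in_itv/=.
    have := le_trans (Re_le_modulus _) h; have := le_trans (Im_le_modulus _) h.
    rewrite Re_sub Im_sub !ler_norml /= => /andP[h1 h2] /andP[h3 h4].
    by split; apply/andP; split; lra.
have cv : {within K, continuous (v \o toC)}.
  apply: continuous_in_subspaceT => xy; rewrite inE /K/= -qE => /vK H.
  apply/cvgrPdist_lt => e /H[d d0 hd].
  have d20 : 0 < d / 2 by rewrite divr_gt0.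
  exists (ball xy.1 (d / 2), ball xy.2 (d / 2)); first by split; exact: nbhsx_ballx.
  move=> [x' y'] [/= h1 h2].
  rewrite distrC; apply: hd; apply: le_lt_trans (modulus_le_ReIm _) _.
  rewrite Re_sub Im_sub [ltRHS]splitr; apply: ltrD => /=; first by rewrite distrC.
  by rewrite distrC.
have [xy /set_mem xyK minv] := compact_EVT_min K0 cK cv.
exists (toC xy); first by rewrite qE.
move=> z zK; have -> : z = toC (Re z, Im z) by case: (z).
by apply: minv; rewrite inE /K/= -qE; have -> : toC (Re z, Im z) = z by case: (z).
Qed.

(* Hopf's boundary point lemma, by comparison with the subharmonic barrier
   [(r^2 - q) * (3/2 r^2 - q)], [q = |z - p|^2], on [3/4 r^2 <= q < r^2]. *)
Lemma hopf_boundary_point (p : CC R) (r m : R) (v : CC R -> R) :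
  0 < r -> 0 < m ->
  (forall z, modulus (z - p) < r -> 0 < v z) ->
  (forall z, modulus (z - p) < r -> forall e, 0 < e ->
     exists2 d, 0 < d & forall w, modulus (w - z) < d -> `|v w - v z| < e) ->
  (forall c, modulus (c - p) < r -> exists C : R, exists2 e0, 0 < e0 & forall e,
     0 < e < e0 -> v (c + e%:C) + v (c + 'i * e%:C) + v (c - e%:C) + v (c - 'i * e%:C)
       - 4 * v c <= C * e ^+ 3) ->
  (forall z, modulus (z - p) ^+ 2 <= 3 / 4 * r ^+ 2 -> m <= v z) ->
  forall z, modulus (z - p) < r ->
    m / (2 * r ^+ 2) * (r ^+ 2 - modulus (z - p) ^+ 2) <= v z.
Proof.
move=> r0 m0 v0 vc v4 vm z zr.
have r20 : 0 < r ^+ 2 by rewrite exprn_gt0.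
pose q (z : CC R) := modulus (z - p) ^+ 2.
pose h x := m / (r ^+ 2) ^+ 2 * (r ^+ 2 - x) * (3 / 2 * r ^+ 2 - x).
have mr0 : 0 < m / (r ^+ 2) ^+ 2 by rewrite divr_gt0// exprn_gt0.
have q_lt w : q w < r ^+ 2 -> modulus (w - p) < r.
  by rewrite /q ltr_pXn2r// nnegrE ?modulus_ge0// ltW.
have lt_q w : modulus (w - p) < r -> q w < r ^+ 2.
  by rewrite /q ltr_pXn2r// nnegrE ?modulus_ge0// ltW.
have h_le x : 3 / 4 * r ^+ 2 <= x -> x <= r ^+ 2 -> h x <= m * (r ^+ 2 - x) / r ^+ 2.
  move=> x1 x2; rewrite /h.
  have -> : m * (r ^+ 2 - x) / r ^+ 2 = m / (r ^+ 2) ^+ 2 * (r ^+ 2 - x) * r ^+ 2.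
    by field; rewrite gt_eqF.
  by apply: ler_wpM2l; [rewrite mulr_ge0 ?(ltW mr0)// subr_ge0|lra].
have le_h x : x <= r ^+ 2 -> m / (2 * r ^+ 2) * (r ^+ 2 - x) <= h x.
  move=> x2; rewrite /h.
  have -> : m / (2 * r ^+ 2) * (r ^+ 2 - x) = m / (r ^+ 2) ^+ 2 * (r ^+ 2 - x) * (r ^+ 2 / 2).
    by field; rewrite gt_eqF.
  by apply: ler_wpM2l; [rewrite mulr_ge0 ?(ltW mr0)// subr_ge0|lra].
have q0 w : 0 <= q w by rewrite sqr_ge0.
have [qz|qz] := leP (q z) (3 / 4 * r ^+ 2).
  apply: le_trans (vm z qz).
  have -> : m / (2 * r ^+ 2) * (r ^+ 2 - modulus (z - p) ^+ 2) =
      m - m / (2 * r ^+ 2) * (r ^+ 2 + q z) by rewrite /q; field; rewrite gt_eqF.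
  rewrite gerBl; apply: mulr_ge0; last by apply: addr_ge0 => //; exact: ltW.
  by rewrite divr_ge0 ?(ltW m0)// mulr_ge0// ltW.
apply: le_trans (le_h _ (ltW (lt_q _ zr))) _.
rewrite -/(q z) leNgt; apply/negP => vz.
pose w y := v y - h (q y).
have wz : w z < 0 by rewrite subr_lt0.
(* The outer circle is taken just inside radius [r], far enough out to enclose [z] and to make the
   barrier smaller than [- w z]. As [v > 0], the minimum of [w] cannot lie on it. *)
pose q2 := Num.max (q z) (r ^+ 2 * (1 + w z / (2 * m))).
have q2r : q2 < r ^+ 2.
  rewrite gt_max lt_q//= gtr_pMr// gtrDl pmulr_llt0// invr_gt0 mulr_gt0//.
have zq2 : q z <= q2 by rewrite le_max lexx.
have hq2 : h q2 < - w z.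
  apply: le_lt_trans (h_le _ (ltW (lt_le_trans qz zq2)) (ltW q2r)) _.
  have : r ^+ 2 * (1 + w z / (2 * m)) <= q2 by rewrite le_max lexx orbT.
  move=> hq; rewrite ltr_pdivrMr//.
  have : m * (r ^+ 2 - q2) <= m * (r ^+ 2 - r ^+ 2 * (1 + w z / (2 * m))).
    by rewrite ler_wpM2l ?(ltW m0)// lerB.
  have -> : m * (r ^+ 2 - r ^+ 2 * (1 + w z / (2 * m))) = - w z * r ^+ 2 / 2.
    by field; rewrite gt_eqF.
  have : 0 < - w z * r ^+ 2 by rewrite mulr_gt0// oppr_gt0.
  by lra.
have Kr y : 3 / 4 * r ^+ 2 <= q y <= q2 -> modulus (y - p) < r.
  by move=> /andP[_ yq]; apply: q_lt; exact: le_lt_trans yq q2r.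
have hqc y e : 0 < e -> exists2 d, 0 < d &
    forall y', modulus (y' - y) < d -> `|h (q y') - h (q y)| < e.
  move=> e0.
  have ch : {for q y, continuous h}.
    apply: cvgM; [apply: cvgM; [exact: cvg_cst|]|];
      (apply: cvgB; [exact: cvg_cst|exact: cvg_id]).
  have /cvgrPdist_lt/(_ e e0)/nbhs_ballP[d1/= d10 hd1] := ch.
  pose N := 2 * modulus (y - p) + 1.
  have N0 : 0 < N by rewrite ltr_wpDl// mulr_ge0 ?modulus_ge0.
  exists (Num.min 1 (d1 / N)); first by rewrite lt_min ltr01 divr_gt0.
  move=> y'; rewrite lt_min => /andP[yy1]; rewrite ltr_pdivlMr// => yyN.
  rewrite distrC; apply: hd1; rewrite /ball/= distrC.
  apply: le_lt_trans yyN; rewrite /q subr_sqr normrM.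
  apply: ler_pM => //.
    rewrite ler_norml; apply/andP; split.
      rewrite lerNl opprB; apply: le_trans (ler_sub_modulus _ _) _.
      by rewrite opprB addrA subrK modulusB.
    apply: le_trans (ler_sub_modulus _ _) _.
    by rewrite opprB addrA subrK.
  rewrite ger0_norm ?addr_ge0 ?modulus_ge0//.
  have : modulus (y' - p) <= modulus (y' - y) + modulus (y - p).
    by apply: le_trans (ler_modulusD _ _); rewrite addrA subrK.
  by rewrite /N; lra.
have [|||c cK minc] := @compact_plane_min w p r (3 / 4 * r ^+ 2) q2.
- by move=> y /Kr/ltW.
- move=> y /Kr yr e e0; have e20 : 0 < e / 2 by rewrite divr_gt0.
  have [d1 d10 hd1] := vc y yr _ e20; have [d2 d20 hd2] := hqc y _ e20.
  exists (Num.min d1 d2); first by rewrite lt_min d10.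
  move=> y'; rewrite lt_min => /andP[/hd1 k1 /hd2 k2].
  have -> : w y' - w y = (v y' - v y) - (h (q y') - h (q y)) by rewrite /w; ring.
  by apply: le_lt_trans (ler_normB _ _) _; rewrite [ltRHS]splitr ltrD.
- by exists z; rewrite -/(q z) zq2 ltW.
rewrite -/(q c) in cK.
have wc : w c <= w z by apply: minc; rewrite -/(q z) zq2 ltW.
have cr := Kr _ cK; have /andP[c1 c2] := cK.
(* On the inner circle [v >= m] while [h <= m / 4], so [w] is positive there, whereas its minimum is
   negative. *)
have {}c1 : 3 / 4 * r ^+ 2 < q c.
  rewrite lt_neqAle c1 andbT; apply/eqP => E.
  have : m <= v c by apply: vm; rewrite -/(q c) -E.
  have : h (q c) <= m / 4.
    apply: le_trans (h_le _ _ _) _; rewrite -?E//; first by lra.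
    rewrite le_eqVlt; apply/orP; left; apply/eqP; field.
    by rewrite gt_eqF.
  by move: wc wz; rewrite /w; lra.
have {}c2 : q c < q2.
  rewrite lt_neqAle c2 andbT; apply/eqP => E.
  have : 0 < v c by exact: v0.
  by move: wc hq2; rewrite /w -E; lra.
have [C [e0 e00 hC]] := v4 c cr.
have [d1 d10 hd1] : exists2 d, 0 < d & forall y, modulus (y - c) < d ->
    3 / 4 * r ^+ 2 <= q y <= q2.
  pose N := 2 * modulus (c - p) + 1.
  have N0 : 0 < N by rewrite ltr_wpDl// mulr_ge0 ?modulus_ge0.
  pose t := Num.min (q c - 3 / 4 * r ^+ 2) (q2 - q c).
  have t0 : 0 < t by rewrite lt_min !subr_gt0 c1.
  exists (Num.min 1 (t / N)); first by rewrite lt_min ltr01 divr_gt0.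
  move=> y; rewrite lt_min => /andP[yy1]; rewrite ltr_pdivlMr// => yyN.
  have : `|q y - q c| <= modulus (y - c) * N.
    rewrite /q subr_sqr normrM; apply: ler_pM => //.
      rewrite ler_norml; apply/andP; split.
        rewrite lerNl opprB; apply: le_trans (ler_sub_modulus _ _) _.
        by rewrite opprB addrA subrK modulusB.
      apply: le_trans (ler_sub_modulus _ _) _.
      by rewrite opprB addrA subrK.
    rewrite ger0_norm ?addr_ge0 ?modulus_ge0//.
    have : modulus (y - p) <= modulus (y - c) + modulus (c - p).
      by apply: le_trans (ler_modulusD _ _); rewrite addrA subrK.
    by rewrite /N; move: yy1; clear; lra.
  move=> /le_lt_trans/(_ yyN); rewrite ltr_norml !lt_min => /andP[].
  rewrite ltrNl lt_min => /andP[k1 k2] /andP[k3 k4].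
  by move: k1 k2 k3 k4; clear => *; apply/andP; split; lra.
have C0 : 0 < `|C| + 1 by rewrite ltr_wpDl.
pose t := Num.min (Num.min e0 d1) (m / (r ^+ 2 * (`|C| + 1))).
have t0 : 0 < t by rewrite !lt_min e00 d10/= divr_gt0// mulr_gt0.
have te0 : t <= e0 by rewrite !ge_min lexx.
have td1 : t <= d1 by rewrite !ge_min lexx orbT.
have tC : t * (r ^+ 2 * (`|C| + 1)) <= m.
  by rewrite -ler_pdivlMr ?mulr_gt0// ge_min lexx orbT.
pose e := t / 2.
have e0' : 0 < e by rewrite divr_gt0.
have et : e < t by rewrite ltr_pdivrMr// ltr_pMr// ltr1n.
have ee0 := lt_le_trans et te0.
have ed1 := lt_le_trans et td1.
have eC : C * e < 2 * m / r ^+ 2.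
  rewrite ltr_pdivlMr//.
  apply: (@le_lt_trans _ _ (t * (r ^+ 2 * (`|C| + 1)))); last by lra.
  rewrite [leLHS](_ : _ = (t * r ^+ 2) * (C / 2)); last by rewrite /e; ring.
  rewrite [leRHS]mulrA; apply: ler_wpM2l; first by rewrite mulr_ge0// ltW.
  by have := ler_norm C; have := normr_ge0 C; clear; lra.
have me : modulus (e%:C : CC R) = e by rewrite modulusR gtr0_norm.
have near_c (om : CC R) : modulus om = 1 -> w c <= w (c + om * e%:C).
  by move=> om1; apply: minc; apply: hd1; rewrite addrAC subrr add0r modulusM om1 me mul1r.
have n1 : w c <= w (c + e%:C) by have := near_c 1 (@modulus1 R); rewrite mul1r.
have n2 := near_c _ modulus_i.
have n3 : w c <= w (c - e%:C).
  by have := near_c (-1) (etrans (modulusN _) (@modulus1 R)); rewrite mulN1r.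
have n4 : w c <= w (c - 'i * e%:C).
  by have := near_c (- 'i) (etrans (modulusN _) modulus_i); rewrite mulNr.
have := hC e; rewrite e0' ee0 => /(_ isT) hv.
(* For [q c > 3/4 r^2] the bracket [4 q c + e^2 - 5/2 r^2] exceeds [r^2 / 2]. The discrete Laplacian
   of [h] is therefore at least [2 m e^2 / r^2], more than the [C e^3] allowed for [v], which
   contradicts minimality of [w] at [c]. *)
have barrier : h (q (c + e%:C)) + h (q (c + 'i * e%:C)) + h (q (c - e%:C)) + h (q (c - 'i * e%:C))
   - 4 * h (q c) = m / (r ^+ 2) ^+ 2 * (4 * e ^+ 2 * (4 * q c + e ^+ 2 - 5 / 2 * r ^+ 2)).
  rewrite /h /q !modulus_sq !Re_sub !Im_sub !(Re_sub, Im_sub, Re_add, Im_add, Re_mul, Im_mul)/=.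
  by field; rewrite gt_eqF.
have : 2 * m / r ^+ 2 * e ^+ 2 <= m / (r ^+ 2) ^+ 2 * (4 * e ^+ 2 * (4 * q c + e ^+ 2 - 5 / 2 * r ^+ 2)).
  have -> : 2 * m / r ^+ 2 * e ^+ 2 = m / (r ^+ 2) ^+ 2 * (4 * e ^+ 2 * (r ^+ 2 / 2)).
    by field; rewrite gt_eqF.
  apply: ler_wpM2l; first exact: ltW.
  apply: ler_wpM2l; first by rewrite mulr_ge0 ?sqr_ge0.
  by have := sqr_ge0 e; move: c1; clear; lra.
rewrite -barrier; move: n1 n2 n3 n4 hv; rewrite /w.
have : C * e ^+ 3 < 2 * m / r ^+ 2 * e ^+ 2.
  by rewrite exprS mulrA ltr_pM2r// exprn_gt0.
by clear; lra.
Qed.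

End boundary_point_lemma.

(** * Trajectories of boundary points *)

Section flow_potential.
Context {R : realType}.
Local Notation Re := complex.Re.
Local Notation Im := complex.Im.
Variables (T al : R) (be ga U : R -> CC R).
Hypothesis T0 : 0 <= T.
Hypothesis al1 : `|al| <= 1.
Hypothesis ga2 : forall u, 0 <= u <= T -> modulus (ga u) <= 2.
Implicit Types (Z : R -> CC R) (V dV : R -> R) (t C : R).
Local Notation flow := (flow T al be ga U).

(** A certificate that the integral of [|Z - U|^-2] over [[0, T]] is at most [C], phrased without
    integrals. In the applications [V] is the logarithm of the height. *)
Definition potential C Z V := exists2 dV : R -> R,
  forall u, 0 <= u <= T -> is_derive u (1 : R) V (dV u) /\
    dV u <= - (modulus (Z u - U u) ^+ 2)^-1 &
  V 0 - V T <= C.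

Lemma potential_drop C Z V s t : potential C Z V -> 0 <= s -> s <= t -> t <= T ->
  0 <= V s - V t /\ V s - V t <= C.
Proof.
move=> [dV dVE VC] s0 st tT.
have mono x y : 0 <= x -> x <= y -> y <= T -> V y <= V x.
  move=> x0 xy yT; apply: (is_derive_le0_nonincr (df := dV) xy) => u /andP[xu uy].
    by have [|+ _] := dVE u; rewrite ?(le_trans x0 xu) ?(le_trans uy yT).
  have [|_ h] := dVE u; first by rewrite (le_trans x0 xu) (le_trans uy yT).
  by apply: le_trans h _; rewrite oppr_le0 invr_ge0 sqr_ge0.
split; first by rewrite subr_ge0 mono.
by have := mono 0 s (lexx 0) s0 (le_trans st tT);
   have := mono t T (le_trans s0 st) tT (lexx T); lra.
Qed.

(* By AM-GM the logarithmic derivative of the distance between two trajectories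
   is dominated by that of the potentials. *)
Lemma flow_potential_dist C Z Z' V V' t : flow Z -> flow Z' ->
  potential C Z V -> potential C Z' V' -> 0 <= t <= T ->
  modulus (Z t - Z' t) <= expR (T + 2 * C) * modulus (Z 0 - Z' 0) /\
  modulus (Z 0 - Z' 0) <= expR (T + 2 * C) * modulus (Z t - Z' t).
Proof.
move=> fZ fZ' pV pV' /andP[t0 tT].
have [dV dVE _] := pV; have [dV' dVE' _] := pV'.
pose la u : CC R := al%:C - ga u / ((Z u - U u) * (Z' u - U u)).
(* The rate [- dp] dominates [2 |Re la|], the logarithmic rate of [n2]; the term [- 2 * u] pays for
   [|al| <= 1]. The total drop of [p] is at most [2 (T + 2 C)], and the square root halves it. *)
pose p u := 2 * V u + 2 * V' u - 2 * u.
pose dp u := 2 * dV u + 2 * dV' u - 2.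
pose n2 u := modulus (Z u - Z' u) ^+ 2.
have dn2 u : 0 <= u <= t -> is_derive u (1 : R) n2 (2 * Re (la u) * n2 u).
  move=> /andP[u0 ut].
  have uT : 0 <= u <= T by rewrite u0 (le_trans ut tT).
  apply: is_derive_fun_eq (is_derive_modulus_sq (flow_diff fZ fZ' uT)) _.
  by rewrite Re_dot_mul mulrA.
have dpE u : 0 <= u <= t -> is_derive u (1 : R) p (dp u).
  move=> /andP[u0 ut].
  have uT : 0 <= u <= T by rewrite u0 (le_trans ut tT).
  have [h1 _] := dVE u uT; have [h2 _] := dVE' u uT.
  apply: is_derive_fun_eq (is_derive_funB (is_derive_funD (is_derive_fun_cmul 2 h1)
    (is_derive_fun_cmul 2 h2)) (is_derive_fun_cmul 2 (is_derive_fun_id u))) _.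
  by rewrite /dp mulr1.
have la_dp u : 0 <= u <= t -> 2 * `|Re (la u)| <= - dp u.
  move=> /andP[u0 ut].
  have uT : 0 <= u <= T by rewrite u0 (le_trans ut tT).
  have [_ h1] := dVE u uT; have [_ h2] := dVE' u uT.
  have : `|Re (la u)| <= 1 + 2 * ((modulus (Z u - U u))^-1 * (modulus (Z' u - U u))^-1).
    apply: le_trans (Re_le_modulus _) _; apply: le_trans (ler_modulusB _ _) _.
    rewrite modulusR modulusM modulusV modulusM invfM; apply: lerD => //.
    by apply: ler_wpM2r; [rewrite mulr_ge0 ?invr_ge0 ?modulus_ge0|exact: ga2].
  move: h1 h2; rewrite /dp -!exprVn.
  set x := (modulus (Z u - U u))^-1; set y := (modulus (Z' u - U u))^-1.
  have : 2 * (x * y) <= x ^+ 2 + y ^+ 2.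
    by rewrite -subr_ge0 (_ : _ - _ = (x - y) ^+ 2) ?sqr_ge0//; ring.
  by lra.
have n20 u : 0 <= n2 u by exact: sqr_ge0.
have dF s u : 0 <= u <= t -> is_derive u (1 : R) (fun x => n2 x * expR (s * p x))
    (n2 u * expR (s * p u) * (2 * Re (la u) + s * dp u)).
  move=> ut; apply: is_derive_fun_eq (is_derive_funM (dn2 u ut)
    (is_derive_fun_expR (is_derive_fun_cmul s (dpE u ut)))) _.
  by ring.
have F0 s u : 0 <= n2 u * expR (s * p u).
  by apply: mulr_ge0; [exact: n20|exact: expR_ge0].
have up : n2 t * expR (1 * p t) <= n2 0 * expR (1 * p 0).
  apply: (is_derive_le0_nonincr t0 (dF 1)) => u ut.
  apply: mulr_ge0_le0; first exact: F0.
  by have := la_dp u ut; have := ler_norm (Re (la u)); lra.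
have lo : n2 0 * expR (- 1 * p 0) <= n2 t * expR (- 1 * p t).
  apply: (is_derive_ge0_nondecr t0 (dF (- 1))) => u ut.
  apply: mulr_ge0; first exact: F0.
  by have := la_dp u ut; have := ler_norm (- Re (la u)); rewrite normrN; lra.
have p0t : p 0 - p t <= 2 * (T + 2 * C).
  have [_ h1] := potential_drop pV (lexx 0) t0 tT.
  have [_ h2] := potential_drop pV' (lexx 0) t0 tT.
  by rewrite /p; lra.
have sq a b : 0 <= a -> 0 <= b -> a ^+ 2 <= b ^+ 2 * expR (2 * (T + 2 * C)) ->
    a <= expR (T + 2 * C) * b.
  move=> a0 b0 h; rewrite -(ler_pXn2r (_ : 0 < 2)%N) ?nnegrE ?mulr_ge0 ?expR_ge0//.
  by apply: le_trans h _; rewrite exprMn -expRM_natl mulrC.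
split; apply: sq; rewrite ?modulus_ge0// -/(n2 0) -/(n2 t).
- apply: (@le_trans _ _ (n2 0 * expR (p 0 - p t))).
    by rewrite expRB mulrA ler_pdivlMr ?expR_gt0//; move: up; rewrite !mul1r.
  by rewrite ler_wpM2l// ler_expR.
- apply: (@le_trans _ _ (n2 t * expR (p 0 - p t))).
    have -> : p 0 - p t = - p t - - p 0 by ring.
    by rewrite expRB mulrA ler_pdivlMr ?expR_gt0//; move: lo; rewrite !mulN1r.
  by rewrite ler_wpM2l// ler_expR.
Qed.

End flow_potential.

Section continuous_itv.
Context {R : realType}.
Implicit Types (a b s t x y : R) (f : R -> R).

Definition continuous_itv a b f := forall t, a <= t <= b -> forall e, 0 < e ->
  exists2 d, 0 < d & forall s, a <= s <= b -> `|s - t| < d -> `|f s - f t| < e.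

Lemma continuous_itvP a b f : {within `[a, b], continuous f} -> continuous_itv a b f.
Proof.
move=> /subspace_continuousP cf t tab e e0.
have /cvgrPdist_lt/(_ e e0)/nbhs_ballP[d/= d0 hd] := cf t tab.
exists d => // s sab st; rewrite distrC; apply: hd => //.
by rewrite /ball/= distrC.
Qed.

Lemma continuous_clamp a b f : a <= b -> continuous_itv a b f ->
  continuous (f \o clamp a b).
Proof.
move=> ab cf t; have tab : a <= clamp a b t <= b by rewrite clamp_ge clamp_le.
apply/cvgrPdist_lt => e /(cf _ tab)[d d0 hd].
apply/nbhs_ballP; exists d => //= s; rewrite /ball/= distrC => st.
rewrite distrC; apply: hd; first by rewrite clamp_ge clamp_le.
exact: le_lt_trans (clamp_dist _ _ ab) st.
Qed.

Lemma continuous_itv_within a b f : a <= b -> continuous_itv a b f ->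
  {within `[a, b], continuous f}.
Proof.
move=> ab /(continuous_clamp ab)/(@continuous_subspaceT _ _ `[a, b]%classic).
apply: subspace_eq_continuous => t; rewrite inE/= in_itv/= => /andP[at_ tb].
by rewrite /= /from_subspace/= clampE.
Qed.

Lemma continuous_itv_ivt a b f v : a <= b -> continuous_itv a b f ->
  Num.min (f a) (f b) <= v <= Num.max (f a) (f b) ->
  exists2 c, a <= c <= b & f c = v.
Proof.
move=> ab cf vab; have := @IVT R (f \o clamp a b) a b v ab.
rewrite /= !clampE// => /(_ _ vab)[|c cab fc].
  by apply: continuous_subspaceT; exact: continuous_clamp.
by exists (clamp a b c) => //; rewrite clamp_ge clamp_le.
Qed.

Lemma continuous_itv_min a b f : a <= b -> continuous_itv a b f ->
  exists2 c, a <= c <= b & forall t, a <= t <= b -> f c <= f t.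
Proof.
move=> ab cf; have [|c cab minc] := @EVT_min R (f \o clamp a b) a b ab.
  by apply: continuous_subspaceT; exact: continuous_clamp.
exists (clamp a b c); first by rewrite clamp_ge clamp_le.
move=> t /andP[at_ tb]; have := minc t; rewrite in_itv/= at_ tb => /(_ isT).
by rewrite (clampE at_ tb).
Qed.

(* Right derivatives of continuous functions on [[a, b]] extend the endpoints:
   the primitive below has a two-sided derivative at [a] and [b] too. *)
Lemma continuous_itv_primitive a b f : a <= b -> continuous_itv a b f ->
  exists F : R -> R, forall t, a <= t <= b -> is_derive t (1 : R) F (f t).
Proof.
move=> ab cf; pose g := f \o clamp a b.
have cg : continuous g by exact: continuous_clamp.
exists (fun x => \int[lebesgue_measure]_(t in [set` `[a - 1, x]]) g t)%R.
move=> t /andP[at_ tb].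
have [||||dF FE] := @continuous_FTC1 R g (BLeft (a - 1)) t (b + 1).
- by rewrite ltr_pwDr.
- apply: continuous_compact_integrable; first exact: segment_compact.
  exact: continuous_subspaceT.
- by rewrite lte_fin ltrBlDr ltr_pwDr.
- exact: cg.
split; first exact: dF.
by rewrite -derive1E FE /g/= clampE.
Qed.

Lemma clip_lt T t d : 0 < T -> 0 <= t <= T -> 0 < d ->
  Num.max 0 (t - d / 2) < Num.min T (t + d / 2).
Proof.
move=> T0 /andP[t0 tT] d0; rewrite gt_max !lt_min T0.
by apply/andP; split; apply/andP; split; lra.
Qed.

Lemma clip_dist T s t d : 0 < d ->
  Num.max 0 (t - d / 2) <= s -> s <= Num.min T (t + d / 2) -> `|s - t| < d.
Proof.
move=> d0; rewrite ge_max le_min => /andP[_ h1] /andP[_ h2].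
by rewrite ltr_norml; apply/andP; split; lra.
Qed.

End continuous_itv.

Lemma is_derive_fun_sum {R : realType} n (h : nat -> R -> R) (dh : nat -> R) (u : R) :
  (forall k, (k < n)%N -> is_derive u (1 : R) (h k) (dh k)) ->
  is_derive u (1 : R) (fun s => \sum_(k < n) h k s) (\sum_(k < n) dh k).
Proof.
elim: n => [|n IH] dhE.
  under eq_fun do rewrite big_ord0.
  by rewrite big_ord0; exact: is_derive_fun_cst.
under eq_fun do rewrite big_ord_recr/=.
rewrite big_ord_recr/=; apply: is_derive_funD; last exact: dhE.
by apply: IH => k kn; apply: dhE; exact: ltnW.
Qed.

(** * The driving point does not meet a boundary trajectory *)

Section boundary_trajectories.
Context {R : realType}.
Local Notation Re := complex.Re.
Local Notation Im := complex.Im.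
Variables (T al : R) (be ga U : R -> CC R).
Hypothesis T0 : 0 <= T.
Hypothesis al1 : `|al| <= 1.
Hypothesis ga2 : forall u, 0 <= u <= T -> modulus (ga u) <= 2.
Hypothesis cU : forall t, 0 <= t <= T -> forall e, 0 < e -> exists2 d : R, 0 < d &
  forall s, 0 <= s <= T -> `|s - t| < d -> modulus (U s - U t) < e.
Local Notation flow := (flow T al be ga U).
Local Notation potential := (potential T U).

(* [Z x e] is the trajectory of the point at distance [e] from the boundary point
   with parameter [x], [X x] is the trajectory of the boundary point itself. *)
Variables (x0 rho e0 C : R) (Z : R -> R -> R -> CC R) (V : R -> R -> R -> R)
  (X : R -> R -> CC R).
Hypothesis rho0 : 0 < rho.
Hypothesis e00 : 0 < e0.
Hypothesis flowZ : forall x e, `|x - x0| <= rho -> 0 < e < e0 -> flow (Z x e).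
Hypothesis potentialZ : forall x e, `|x - x0| <= rho -> 0 < e < e0 ->
  potential C (Z x e) (V x e).
Hypothesis Z0e : forall x e e', `|x - x0| <= rho -> 0 < e < e0 -> 0 < e' < e0 ->
  modulus (Z x e 0 - Z x e' 0) <= `|e - e'|.
Hypothesis Z0x : forall x x' e, `|x - x0| <= rho -> `|x' - x0| <= rho -> 0 < e < e0 ->
  modulus (Z x e 0 - Z x' e 0) <= `|x - x'|.
Hypothesis X0 : forall x x', `|x - x0| <= rho -> `|x' - x0| <= rho ->
  X x 0 = X x' 0 -> x = x'.
Hypothesis ZX : forall x t, `|x - x0| <= rho -> 0 <= t <= T -> forall e, 0 < e ->
  exists2 d, 0 < d & forall e', 0 < e' < d -> e' < e0 -> modulus (Z x e' t - X x t) < e.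

Let E := expR (T + 2 * C).

Let E0 : 0 < E. Proof. exact: expR_gt0. Qed.

Let small (n1 n2 : R) : 0 < n1 -> 0 < n2 -> exists2 e, 0 < e < e0 & e < n1 /\ e < n2.
Proof.
move=> n10 n20; pose m := Num.min e0 (Num.min n1 n2).
have m0 : 0 < m by rewrite !lt_min e00 n10.
have m2 : m / 2 < m by rewrite ltr_pdivrMr// mulr_natr mulr2n ltrDl.
exists (m / 2).
  by rewrite divr_gt0//= (lt_le_trans m2)// ge_min lexx.
by split; apply: (lt_le_trans m2); rewrite !ge_min lexx ?orbT.
Qed.

(** Two interior trajectories over the same [x] are compared and the lower one is sent to the
    boundary; the bound is uniform in [t]. *)
Lemma boundary_dist_inner x t e : `|x - x0| <= rho -> 0 <= t <= T -> 0 < e < e0 ->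
  modulus (Z x e t - X x t) <= E * e.
Proof.
move=> xI tT ee0; apply/ler_addgt0Pr => n n0.
have [d d0 hd] := ZX xI tT n0.
have [e' ee' [e'd e'e]] := small d0 (proj1 (andP ee0)).
have /andP[e'0 e'e0] := ee'.
have := hd e'; rewrite e'0 e'd => /(_ isT e'e0) h.
have [h1 _] := flow_potential_dist al1 ga2 (flowZ xI ee0) (flowZ xI ee')
  (potentialZ xI ee0) (potentialZ xI ee') tT.
have -> : Z x e t - X x t = (Z x e t - Z x e' t) + (Z x e' t - X x t).
  by rewrite addrA subrK.
apply: le_trans (ler_modulusD _ _) _; apply: lerD; last exact: ltW.
apply: le_trans h1 _; apply: ler_wpM2l; first exact: ltW.
apply: le_trans (Z0e xI ee0 ee') _.
by rewrite ger0_norm ?subr_ge0 ?ltW// gtrBl.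
Qed.

Lemma boundary_dist x x' t : `|x - x0| <= rho -> `|x' - x0| <= rho -> 0 <= t <= T ->
  modulus (X x t - X x' t) <= E * `|x - x'|.
Proof.
move=> xI xI' tT; apply/ler_addgt0Pr => n n0.
have n20 : 0 < n / 2 by rewrite divr_gt0.
have [d d0 hd] := ZX xI tT n20; have [d' d'0 hd'] := ZX xI' tT n20.
have [e ee0 [ed ed']] := small d0 d'0; have /andP[eg0 ele0] := ee0.
have := hd e; rewrite eg0 ed => /(_ isT ele0) k1.
have := hd' e; rewrite eg0 ed' => /(_ isT ele0) k2.
have [h1 _] := flow_potential_dist al1 ga2 (flowZ xI ee0) (flowZ xI' ee0)
  (potentialZ xI ee0) (potentialZ xI' ee0) tT.
have -> : X x t - X x' t = (X x t - Z x e t) + (Z x e t - Z x' e t) + (Z x' e t - X x' t).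
  by ring.
have h2 : E * modulus (Z x e 0 - Z x' e 0) <= E * `|x - x'|.
  by apply: ler_wpM2l; [exact: ltW|exact: Z0x].
rewrite modulusB in k1.
have j1 := ler_modulusD ((X x t - Z x e t) + (Z x e t - Z x' e t)) (Z x' e t - X x' t).
have j2 := ler_modulusD (X x t - Z x e t) (Z x e t - Z x' e t).
rewrite -/E in h1; lra.
Qed.

(** The backward half of [flow_potential_dist] survives the limit: trajectories that meet at time
    [t] already coincide at time [0]. *)
Lemma boundary_inj x x' t : `|x - x0| <= rho -> `|x' - x0| <= rho -> 0 <= t <= T ->
  X x t = X x' t -> x = x'.
Proof.
move=> xI xI' tT XX; apply: X0 => //; apply/eqP.
rewrite -subr_eq0 -modulus_eq0 eq_le modulus_ge0 andbT.
have OT : 0 <= (0 : R) <= T by rewrite lexx T0.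
apply/ler_addgt0Pr => n n0; rewrite add0r.
(* Two approximation errors at time [0], and two at time [t] that are magnified by [E]. *)
pose n' := n / (2 + 2 * E).
have n'0 : 0 < n' by rewrite divr_gt0// addr_gt0// mulr_gt0.
have [d1 d10 hd1] := ZX xI tT n'0; have [d2 d20 hd2] := ZX xI' tT n'0.
have [d3 d30 hd3] := ZX xI OT n'0; have [d4 d40 hd4] := ZX xI' OT n'0.
have d120 : 0 < Num.min d1 d2 by rewrite lt_min d10.
have d340 : 0 < Num.min d3 d4 by rewrite lt_min d30.
have [e ee0 []] := small d120 d340; have /andP[eg0 ele0] := ee0.
rewrite !lt_min => /andP[ed1 ed2] /andP[ed3 ed4].
have := hd1 e; rewrite eg0 ed1 => /(_ isT ele0) k1.
have := hd2 e; rewrite eg0 ed2 => /(_ isT ele0) k2.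
have := hd3 e; rewrite eg0 ed3 => /(_ isT ele0) k3.
have := hd4 e; rewrite eg0 ed4 => /(_ isT ele0) k4.
have [_ h1] := flow_potential_dist al1 ga2 (flowZ xI ee0) (flowZ xI' ee0)
  (potentialZ xI ee0) (potentialZ xI' ee0) tT.
have hZ : modulus (Z x e t - Z x' e t) <= 2 * n'.
  have -> : Z x e t - Z x' e t = (Z x e t - X x t) - (Z x' e t - X x' t).
    by rewrite XX; ring.
  by apply: le_trans (ler_modulusB _ _) _; lra.
have hE : E * modulus (Z x e t - Z x' e t) <= E * (2 * n').
  by rewrite ler_wpM2l// ltW.
have -> : X x 0 - X x' 0 = (Z x e 0 - Z x' e 0) - (Z x e 0 - X x 0) + (Z x' e 0 - X x' 0).
  by ring.
have j1 := ler_modulusD ((Z x e 0 - Z x' e 0) - (Z x e 0 - X x 0)) (Z x' e 0 - X x' 0).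
have j2 := ler_modulusB (Z x e 0 - Z x' e 0) (Z x e 0 - X x 0).
have nE : n = 2 * n' + E * (2 * n').
  rewrite /n'; field; rewrite gt_eqF// addr_gt0// mulr_gt0//.
rewrite -/E in h1; lra.
Qed.

Lemma boundary_continuous x t : `|x - x0| <= rho -> 0 <= t <= T -> forall e, 0 < e ->
  exists2 d : R, 0 < d &
    forall s, 0 <= s <= T -> `|s - t| < d -> modulus (X x s - X x t) < e.
Proof.
move=> xI tT e eg0; have e30 : 0 < e / 3 by rewrite divr_gt0.
have nE : 0 < e / 3 / E by rewrite divr_gt0.
have [n nn0 [nE' _]] := small nE nE.
have [_ [dr di]] := flowZ xI nn0 tT.
have cr := is_derive_continuous dr; have ci := is_derive_continuous di.
have e60 : 0 < e / 6 by rewrite divr_gt0.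
move/cvgrPdist_lt : cr => /(_ _ e60)/nbhs_ballP[d1/= d10 hd1].
move/cvgrPdist_lt : ci => /(_ _ e60)/nbhs_ballP[d2/= d20 hd2].
exists (Num.min d1 d2); first by rewrite lt_min d10.
move=> s sT; rewrite lt_min => /andP[st1 st2].
have := hd1 s; rewrite /ball/= distrC => /(_ st1) k1.
have := hd2 s; rewrite /ball/= distrC => /(_ st2) k2.
have k3 : modulus (Z x n s - Z x n t) < e / 3.
  apply: le_lt_trans (modulus_le_ReIm _) _; rewrite Re_sub Im_sub distrC.
  by rewrite [`|Im _ - _|]distrC; lra.
have h1 := boundary_dist_inner xI sT nn0; have h2 := boundary_dist_inner xI tT nn0.
have En : E * n < e / 3 by rewrite mulrC -ltr_pdivlMr.
have -> : X x s - X x t = (Z x n s - Z x n t) - (Z x n s - X x s) + (Z x n t - X x t).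
  by ring.
have j1 := ler_modulusD ((Z x n s - Z x n t) - (Z x n s - X x s)) (Z x n t - X x t).
have j2 := ler_modulusB (Z x n s - Z x n t) (Z x n s - X x s).
lra.
Qed.

(** The [N] potentials on a grid of mesh [2 eta / N] drop by at most [N C] in total. At each time
    some grid trajectory is within [kappa / N] of [U], which forces a rate of at least
    [(N / kappa)^2]; a large [N] gives a contradiction. *)
Lemma no_swallowing_interval t1 t2 eta : 0 <= t1 -> t1 < t2 -> t2 <= T ->
  0 < eta -> eta <= rho ->
  ~ (forall t, t1 <= t <= t2 -> exists2 x, `|x - x0| <= eta & X x t = U t).
Proof.
move=> t10 t12 t2T eta0 etarho hit.
(* The term [2 * eta] is [N] times the mesh and [1] accounts for the height [e < 1 / N]; both errors
   are magnified by [E]. *)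
pose kappa := E * (2 * eta + 1).
have kappa0 : 0 < kappa by rewrite mulr_gt0// addr_gt0// mulr_gt0.
pose N := (Num.bound (`|C| * kappa ^+ 2 / (t2 - t1))).+1.
have t21 : 0 < t2 - t1 by rewrite subr_gt0.
have N0 : 0 < N%:R :> R by [].
have NC : `|C| * kappa ^+ 2 / (t2 - t1) < N%:R.
  apply: lt_trans (archi_boundP _) _; last by rewrite ltr_nat.
  by rewrite divr_ge0 ?(ltW t21)// mulr_ge0// sqr_ge0.
have Ni0 : 0 < N%:R^-1 :> R by rewrite invr_gt0.
have [e ee0 [eN _]] := small Ni0 Ni0.
pose x (k : nat) := x0 - eta + k%:R * (2 * eta / N%:R).
have xI k : (k < N)%N -> `|x k - x0| <= rho.
  move=> kN; apply: le_trans etarho; rewrite ler_norml.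
  have k0 : 0 <= k%:R * (2 * eta / N%:R) by rewrite mulr_ge0// divr_ge0// mulr_ge0// ltW.
  have k1 : k%:R * (2 * eta / N%:R) <= 2 * eta.
    rewrite mulrCA ger_pMr ?mulr_gt0// ler_pdivrMr// mul1r ler_nat ltnW//.
  by rewrite /x; apply/andP; split; lra.
have fC k : (k < N)%N -> V (x k) e t1 - V (x k) e t2 <= C.
  move=> kN; have [_ h] := potential_drop (potentialZ (xI k kN) ee0) t10 (ltW t12) t2T.
  exact: h.
have [dV dVE] : {dV : nat -> R -> R & forall k, (k < N)%N -> forall u, 0 <= u <= T ->
    is_derive u (1 : R) (V (x k) e) (dV k u) /\
    dV k u <= - (modulus (Z (x k) e u - U u) ^+ 2)^-1}.
  apply: (@choice _ _ (fun k dv => (k < N)%N -> forall u, 0 <= u <= T ->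
    is_derive u (1 : R) (V (x k) e) (dv u) /\
    dv u <= - (modulus (Z (x k) e u - U u) ^+ 2)^-1)) => k.
  have [kN|] := boolP (k < N)%N; last by exists (fun=> 0).
  by have [dv h _] := potentialZ (xI k kN) ee0; exists dv.
pose F u := \sum_(k < N) V (x k) e u.
pose dF u := \sum_(k < N) dV k u.
have inT u : t1 <= u <= t2 -> 0 <= u <= T.
  by move=> /andP[h1 h2]; rewrite (le_trans t10 h1) (le_trans h2 t2T).
have dFE u : t1 <= u <= t2 -> is_derive u (1 : R) F (dF u).
  move=> ut; apply: (@is_derive_fun_sum R N (fun k => V (x k) e) (fun k => dV k u)) => k kN.
  by have [] := dVE k kN u (inT u ut).
(* Since the lower bound on the rate holds at every time, the single time given by the mean value
   theorem suffices. *)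
have [u ut FE] := is_derive_mean (ltW t12) dFE.
have Fdrop : F t1 - F t2 <= N%:R * C.
  rewrite /F -sumrB.
  apply: (@le_trans _ _ (\sum_(k < N) C)); first by apply: ler_sum => k _; exact: fC.
  by rewrite sumr_const card_ord mulr_natl.
have [y yI Xy] := hit u ut.
(* The grid omits its right end [x0 + eta]; for that value of [y] the quotient equals [N], and the
   last index [N.-1] is at distance exactly one mesh. *)
have [k kN yk] : exists2 k, (k < N)%N & `|y - x k| <= 2 * eta / N%:R.
  have dN0 : 0 < 2 * eta / N%:R by rewrite divr_gt0// mulr_gt0.
  have [m mN my] : exists2 m, (m < N)%N &
      0 <= (y - (x0 - eta)) / (2 * eta / N%:R) - m%:R <= 1.
    set r := _ / _.
    have r0 : 0 <= r.
      by apply: divr_ge0; [move: yI; rewrite ler_norml => /andP[]; lra|exact: ltW].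
    have rN : r <= N%:R.
      rewrite ler_pdivrMr// mulrC divfK ?gt_eqF//.
      by move: yI; rewrite ler_norml => /andP[]; lra.
    have [rlt|rge] := ltP r N%:R.
      have /andP[h1 h2] := truncn_itv r0.
      exists (Num.truncn r); first by rewrite -(ltr_nat R); exact: le_lt_trans rlt.
      by move: h2; rewrite -natr1; lra.
    exists N.-1 => //.
    have : N%:R = N.-1%:R + 1 :> R by rewrite natr1.
    lra.
  exists m => //.
  have -> : y - x m = ((y - (x0 - eta)) / (2 * eta / N%:R) - m%:R) * (2 * eta / N%:R).
    by rewrite mulrBl divfK ?gt_eqF// /x; ring.
  move: my => /andP[my0 my1]; rewrite normrM (ger0_norm my0) (gtr0_norm dN0).
  by rewrite ger_pMl.
have Zk : modulus (Z (x k) e u - U u) <= kappa / N%:R.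
  have h1 := boundary_dist_inner (xI k kN) (inT u ut) ee0.
  have h2 := boundary_dist (xI k kN) (le_trans yI etarho) (inT u ut).
  have -> : Z (x k) e u - U u = (Z (x k) e u - X (x k) u) + (X (x k) u - X y u).
    by rewrite Xy; ring.
  apply: le_trans (ler_modulusD _ _) _.
  have -> : kappa / N%:R = E * N%:R^-1 + E * (2 * eta / N%:R).
    by rewrite /kappa; ring.
  apply: lerD; first by apply: le_trans h1 _; rewrite ler_wpM2l ?(ltW E0) ?(ltW eN).
  by apply: le_trans h2 _; rewrite distrC ler_wpM2l ?(ltW E0).
have dFle : dF u <= - (N%:R / kappa) ^+ 2.
  rewrite /dF (bigD1 (Ordinal kN))//=.
  rewrite -[leRHS]addr0; apply: lerD.
    have [_ h] := dVE k kN u (inT u ut); apply: le_trans h _; rewrite lerN2.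
    have A0 : 0 < modulus (Z (x k) e u - U u).
      by rewrite modulus_gt0 subr_eq0; have [] := flowZ (xI k kN) ee0 (inT u ut).
    rewrite -exprVn ler_pXn2r// ?nnegrE ?invr_ge0 ?(ltW A0)//; last first.
      by rewrite divr_ge0// ltW.
    by rewrite -invf_div lef_pV2// posrE divr_gt0.
  apply: sumr_le0 => j _; have [_ h] := dVE j (ltn_ord j) u (inT u ut).
  by apply: le_trans h _; rewrite oppr_le0 invr_ge0 sqr_ge0.
have : (N%:R / kappa) ^+ 2 * (t2 - t1) <= N%:R * C.
  apply: le_trans Fdrop; rewrite -[F t1 - F t2]opprB FE -mulNr.
  by apply: ler_wpM2r; [exact: ltW|rewrite lerNr].
apply/negP; rewrite -ltNge.
apply: (@le_lt_trans _ _ (N%:R * `|C|)); first by rewrite ler_wpM2l ?ler_norm// ltW.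
move: NC; rewrite ltr_pdivrMr// => NC.
have -> : (N%:R / kappa) ^+ 2 * (t2 - t1) = N%:R * (N%:R * (t2 - t1) / kappa ^+ 2).
  by field; rewrite gt_eqF.
by rewrite ltr_pM2l// ltr_pdivlMr// exprn_gt0.
Qed.

(** The function [sg] is a signed coordinate along the boundary, centred at its second argument. If
    [U] met the trajectory of [x0] at [t1], it would lie strictly between the trajectories of
    [x0 - eta] and [x0 + eta], and by continuity it would do so during a time interval. By the
    intermediate value theorem it would sit on some trajectory [X x] at each of these times. *)
Lemma boundary_avoids (Bd : set (CC R)) (sg : CC R -> CC R -> R) (k : R) : 0 < T ->
  (forall x t, `|x - x0| <= rho -> 0 <= t <= T -> Bd (X x t)) ->
  (forall t, 0 <= t <= T -> Bd (U t)) ->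
  (forall u, Bd u -> sg u u = 0) ->
  (forall z u z' u', Bd z -> Bd u -> Bd z' -> Bd u' ->
     `|sg z u - sg z' u'| <= k * (modulus (z - z') + modulus (u - u'))) ->
  (forall z z' u, Bd z -> Bd z' -> Bd u -> modulus (z - u) <= 1 ->
     modulus (z' - u) <= 1 -> sg z u = sg z' u -> z = z') ->
  forall t, 0 <= t <= T -> X x0 t != U t.
Proof.
move=> Tpos BX BU sg0 sgk sginj t1 t1T; apply/eqP => hit.
(* All trajectories of the arc stay within [1/4] of that of [x0]. With [1/4] for the motion of
   [X x0] and [1/4] for that of [U], they remain within distance [1] of [U], where [sg] is
   injective. *)
pose eta := Num.min rho (4^-1 / E).
have eta0 : 0 < eta by rewrite lt_min rho0 divr_gt0.
have etarho : eta <= rho by rewrite ge_min lexx.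
have Eeta : E * eta <= 1 / 4.
  by rewrite mulrC -ler_pdivlMr// ge_min div1r lexx orbT.
have itvE x : x0 - eta <= x <= x0 + eta <-> `|x - x0| <= eta.
  by rewrite ler_distl; split.
have xI x : `|x - x0| <= eta -> `|x - x0| <= rho by move=> h; exact: le_trans h etarho.
have x00 : `|x0 - x0| <= rho by rewrite subrr normr0 ltW.
have near_X x t : `|x - x0| <= eta -> 0 <= t <= T -> modulus (X x t - X x0 t) <= 1 / 4.
  move=> xe tT; apply: le_trans (boundary_dist (xI _ xe) x00 tT) _.
  by apply: le_trans Eeta; rewrite ler_wpM2l// ltW.
have BXe x t : `|x - x0| <= eta -> 0 <= t <= T -> Bd (X x t).
  by move=> xe; apply: BX; exact: xI.
pose f t x := sg (X x t) (U t).
pose M := (`|k| + 1) * E.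
have M0 : 0 < M by rewrite mulr_gt0// ltr_wpDl.
have fk t x y : `|x - x0| <= eta -> `|y - x0| <= eta -> 0 <= t <= T ->
    `|f t x - f t y| <= M * `|x - y|.
  move=> xe ye tT; have xI' := xI _ xe; have yI' := xI _ ye.
  apply: le_trans (sgk _ _ _ _ (BX _ _ xI' tT) (BU _ tT) (BX _ _ yI' tT) (BU _ tT)) _.
  rewrite subrr modulus0 addr0 /M -mulrA; apply: (@le_trans _ _ ((`|k| + 1) * modulus (X x t - X y t))).
    by rewrite ler_wpM2r ?modulus_ge0// (le_trans (ler_norm _))// lerDl.
  by rewrite ler_wpM2l ?boundary_dist// addr_ge0.
have cf t : 0 <= t <= T -> continuous_itv (x0 - eta) (x0 + eta) (f t).
  move=> tT x /itvE xe e eg0; exists (e / M); first by rewrite divr_gt0.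
  move=> s /itvE se; rewrite ltr_pdivlMr// => h; apply: le_lt_trans (fk _ _ _ se xe tT) _.
  by rewrite mulrC.
have et : `|x0 - eta - x0| <= eta by rewrite addrAC subrr add0r normrN gtr0_norm.
have et' : `|x0 + eta - x0| <= eta by rewrite addrAC subrr add0r gtr0_norm.
have e00' : `|x0 - x0| <= eta by rewrite subrr normr0 ltW.
have finj x y : `|x - x0| <= eta -> `|y - x0| <= eta -> f t1 x = f t1 y -> x = y.
  move=> xe ye fxy; apply: (boundary_inj (xI _ xe) (xI _ ye) t1T).
  apply: (sginj _ _ (U t1)); [exact: BXe|exact: BXe|exact: BU| | |exact: fxy];
    rewrite -hit.
  - by apply: le_trans (near_X _ _ xe t1T) _; lra.
  - by apply: le_trans (near_X _ _ ye t1T) _; lra.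
have f0 : f t1 x0 = 0 by rewrite /f hit sg0//; exact: BU.
(* If the end values had the same sign, the one closer to [0] would be taken again on the other side
   of [x0], against injectivity. *)
have opp : f t1 (x0 - eta) * f t1 (x0 + eta) < 0.
  have fn0 x : `|x - x0| <= eta -> x != x0 -> f t1 x != 0.
    by move=> xe; apply: contra_neq => fx0; apply: finj => //; rewrite fx0 f0.
  have nl : f t1 (x0 - eta) != 0.
    by apply: fn0 => //; rewrite -subr_eq0 addrAC subrr add0r oppr_eq0 gt_eqF.
  have nr : f t1 (x0 + eta) != 0.
    by apply: fn0 => //; rewrite -subr_eq0 addrAC subrr add0r gt_eqF.
  rewrite ltNge; apply/negP => h.
  have le1 : x0 - eta <= x0 by rewrite gerBl ltW.
  have le2 : x0 <= x0 + eta by rewrite lerDl ltW.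
  have cl : continuous_itv (x0 - eta) x0 (f t1).
    move=> x /andP[h1 h2] e /(cf _ t1T x)[]; first by rewrite h1 (le_trans h2 le2).
    move=> d d0 hd; exists d => // s /andP[h3 h4]; apply: hd.
    by rewrite h3 (le_trans h4 le2).
  have cr : continuous_itv x0 (x0 + eta) (f t1).
    move=> x /andP[h1 h2] e /(cf _ t1T x)[]; first by rewrite h2 (le_trans le1 h1).
    move=> d d0 hd; exists d => // s /andP[h3 h4]; apply: hd.
    by rewrite h4 (le_trans le1 h3).
  have [|nbtw] := pselect (Num.min (f t1 (x0 - eta)) (f t1 x0) <= f t1 (x0 + eta)
      <= Num.max (f t1 (x0 - eta)) (f t1 x0)).
    move=> /(continuous_itv_ivt le1 cl)[c /andP[c1 c2] fc].
    have : c = x0 + eta.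
      by apply: finj => //; apply/itvE; rewrite c1 (le_trans c2 le2).
    by move: c2 eta0 => + + E'; rewrite E'; lra.
  have [|nbtw'] := pselect (Num.min (f t1 x0) (f t1 (x0 + eta)) <= f t1 (x0 - eta)
      <= Num.max (f t1 x0) (f t1 (x0 + eta))).
    move=> /(continuous_itv_ivt le2 cr)[c /andP[c1 c2] fc].
    have : c = x0 - eta.
      by apply: finj => //; apply/itvE; rewrite c2 (le_trans le1 c1).
    by move: c1 eta0 => + + E'; rewrite E'; lra.
  move: nbtw nbtw'; rewrite f0.
  set p := f t1 (x0 - eta) in nl h *; set q := f t1 (x0 + eta) in nr h *.
  have [p0|p0|p0] := ltgtP p 0; last by rewrite p0 eqxx in nl.
    have q0 : q < 0.
      by rewrite lt_neqAle nr -(nmulr_rge0 _ p0).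
    rewrite (min_r (ltW q0)) (max_l (ltW q0)).
    have [pq|/ltW qp] := leP p q; first by case; rewrite ?pq/= ltW.
    by move=> _; case; rewrite ?qp/= ltW.
  have q0 : 0 < q.
    by rewrite lt_neqAle eq_sym nr -(pmulr_rge0 _ p0).
  rewrite (min_l (ltW q0)) (max_r (ltW q0)).
  have [pq|/ltW qp] := leP p q; last by case; rewrite ?qp ?andbT ltW.
  by move=> _; case; rewrite ?pq ?andbT ltW.
have sgt x : `|x - x0| <= eta -> forall e, 0 < e -> exists2 d, 0 < d & forall s,
    0 <= s <= T -> `|s - t1| < d -> `|f s x - f t1 x| < e.
  move=> xe e eg0; have k1 : 0 < `|k| + 1 by rewrite ltr_wpDl.
  have e20 : 0 < e / (`|k| + 1) / 2 by rewrite !divr_gt0.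
  have [d1 d10 hd1] := boundary_continuous (xI _ xe) t1T e20.
  have [d2 d20 hd2] := cU t1T e20.
  exists (Num.min d1 d2); first by rewrite lt_min d10.
  move=> s sT; rewrite lt_min => /andP[/(hd1 _ sT) h1 /(hd2 _ sT) h2].
  apply: le_lt_trans (sgk _ _ _ _ (BX _ _ (xI _ xe) sT) (BU _ sT) (BX _ _ (xI _ xe) t1T) (BU _ t1T)) _.
  apply: (@le_lt_trans _ _ ((`|k| + 1) * (modulus (X x s - X x t1) + modulus (U s - U t1)))).
    by rewrite ler_wpM2r ?addr_ge0 ?modulus_ge0// (le_trans (ler_norm _))// lerDl.
  by rewrite mulrC -ltr_pdivlMr// [ltRHS]splitr ltrD.
pose p := f t1 (x0 - eta); pose q := f t1 (x0 + eta).
rewrite -/p -/q in opp.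
have p0 : 0 < `|p| by rewrite normr_gt0; apply: contraTneq opp => ->; rewrite mul0r ltxx.
have q0 : 0 < `|q| by rewrite normr_gt0; apply: contraTneq opp => ->; rewrite mulr0 ltxx.
have [d1 d10 hd1] := sgt _ et _ p0; have [d2 d20 hd2] := sgt _ et' _ q0.
have q40 : 0 < 1 / 4 :> R by [].
have [d3 d30 hd3] := boundary_continuous x00 t1T q40.
have [d4 d40 hd4] := cU t1T q40.
pose d := Num.min (Num.min d1 d2) (Num.min d3 d4).
have d0 : 0 < d by rewrite !lt_min d10 d20 d30.
have sweep t : 0 <= t <= T -> `|t - t1| < d -> exists2 x, `|x - x0| <= eta & X x t = U t.
  move=> tT; rewrite !lt_min => /andP[/andP[/(hd1 _ tT) h1 /(hd2 _ tT) h2]].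
  move=> /andP[/(hd3 _ tT) h3 /(hd4 _ tT) h4].
  have le12 : x0 - eta <= x0 + eta by rewrite lerD2l ge0_cp ?ltW.
  have [|x /itvE xe fx0] := continuous_itv_ivt (v := 0) le12 (cf _ tT).
    rewrite -/p in h1; rewrite -/q in h2;
    have [pn|pp|pe] := ltgtP p 0; last by rewrite pe normr0 ltxx in p0.
      have qp : 0 < q by move: opp; rewrite nmulr_rlt0.
      move: h1 h2; rewrite (ltr0_norm pn) (gtr0_norm qp) !ltr_norml => /andP[_ h1] /andP[h2 _].
      have fp : f t (x0 - eta) < 0 by move: h1; rewrite ltrBlDr addNr.
      have fq : 0 < f t (x0 + eta) by move: h2; rewrite ltrBrDr addNr.
      by rewrite ge_min le_max (ltW fp) (ltW fq) orbT.
    have qn : q < 0 by move: opp; rewrite pmulr_rlt0.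
    move: h1 h2; rewrite (gtr0_norm pp) (ltr0_norm qn) !ltr_norml => /andP[h1 _] /andP[_ h2].
    have fp : 0 < f t (x0 - eta) by move: h1; rewrite ltrBrDr addNr.
    have fq : f t (x0 + eta) < 0 by move: h2; rewrite ltrBlDr addNr.
    by rewrite ge_min le_max (ltW fp) (ltW fq) orbT.
  exists x => //; apply: (sginj _ _ (U t));
    [exact: BXe|exact: BU|exact: BU| | |by rewrite sg0 ?fx0//; exact: BU].
  - have -> : X x t - U t = (X x t - X x0 t) + (X x0 t - X x0 t1) - (U t - U t1).
      by rewrite hit; ring.
    have j1 := ler_modulusB ((X x t - X x0 t) + (X x0 t - X x0 t1)) (U t - U t1).
    have j2 := ler_modulusD (X x t - X x0 t) (X x0 t - X x0 t1).
    have j3 := near_X _ _ xe tT.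
    by lra.
  - by rewrite subrr modulus0.
have /andP[t10 t1T'] := t1T.
pose s1 := Num.max 0 (t1 - d / 2); pose s2 := Num.min T (t1 + d / 2).
have s10 : 0 <= s1 by rewrite le_max lexx.
have s2T : s2 <= T by rewrite ge_min lexx.
have s12 : s1 < s2 by exact: clip_lt.
apply: (@no_swallowing_interval s1 s2 eta) => // t /andP[st ts].
apply: sweep; first by rewrite (le_trans s10 st) (le_trans ts s2T).
exact: clip_dist st ts.
Qed.

End boundary_trajectories.

(** * Continuity calculus for complex functions on [[0, T]] *)

Section continuous_trajectories.
Context {R : realType}.
Local Notation Re := complex.Re.
Local Notation Im := complex.Im.
Variable T : R.
Hypothesis T0 : 0 <= T.
Implicit Types (Z Y : R -> CC R) (f : R -> R) (t u : R).

(** Composing with [clamp] expresses continuity on [[0, T]] as continuity on the line, so the rules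
    for limits of sums, products and inverses apply directly. *)
Definition ccontinuous Z := continuous (fun t => Re (Z (clamp 0 T t))) /\
  continuous (fun t => Im (Z (clamp 0 T t))).

Let clampT t : 0 <= clamp 0 T t <= T. Proof. by rewrite clamp_ge clamp_le. Qed.

Lemma ccontinuousP Z : (forall t, 0 <= t <= T -> forall e, 0 < e ->
    exists2 d, 0 < d & forall s, 0 <= s <= T -> `|s - t| < d -> modulus (Z s - Z t) < e) <->
  ccontinuous Z.
Proof.
split=> [H|[cr ci] t tT e e0].
  split.
    apply: (continuous_clamp (f := fun t => Re (Z t)) T0) => t tT e /(H t tT)[d d0 hd].
    exists d => // s sT /(hd s sT); apply: le_lt_trans.
    by rewrite -Re_sub; exact: Re_le_modulus.
  apply: (continuous_clamp (f := fun t => Im (Z t)) T0) => t tT e /(H t tT)[d d0 hd].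
  exists d => // s sT /(hd s sT); apply: le_lt_trans.
  by rewrite -Im_sub; exact: Im_le_modulus.
have e20 : 0 < e / 2 by rewrite divr_gt0.
have /cvgrPdist_lt/(_ _ e20)/nbhs_ballP[d1/= d10 hd1] := cr t.
have /cvgrPdist_lt/(_ _ e20)/nbhs_ballP[d2/= d20 hd2] := ci t.
exists (Num.min d1 d2); first by rewrite lt_min d10.
move=> s /andP[s0 sT]; rewrite lt_min => /andP[st1 st2].
have /andP[t0 tT'] := tT.
have := hd1 s; rewrite /ball/= distrC => /(_ st1); rewrite !clampE// => k1.
have := hd2 s; rewrite /ball/= distrC => /(_ st2); rewrite !clampE// => k2.
apply: le_lt_trans (modulus_le_ReIm _) _; rewrite Re_sub Im_sub [ltRHS]splitr.
by apply: ltrD; rewrite distrC.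
Qed.

Lemma ccontinuousD Z Y : ccontinuous Z -> ccontinuous Y ->
  ccontinuous (fun t => Z t + Y t).
Proof.
move=> [zr zi] [yr yi]; split => t.
- under eq_fun do rewrite Re_add.
  by apply: cvgD; [exact: zr|exact: yr].
- under eq_fun do rewrite Im_add.
  by apply: cvgD; [exact: zi|exact: yi].
Qed.

Lemma ccontinuousN Z : ccontinuous Z -> ccontinuous (fun t => - Z t).
Proof.
move=> [zr zi]; split => t.
- under eq_fun do rewrite Re_opp.
  by apply: cvgN; exact: zr.
- under eq_fun do rewrite Im_opp.
  by apply: cvgN; exact: zi.
Qed.

Lemma ccontinuousM Z Y : ccontinuous Z -> ccontinuous Y ->
  ccontinuous (fun t => Z t * Y t).
Proof.
move=> [zr zi] [yr yi]; split => t.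
- under eq_fun do rewrite Re_mul.
  apply: cvgB; apply: cvgM;
    [exact: zr|exact: yr|exact: zi|exact: yi].
- under eq_fun do rewrite Im_mul.
  apply: cvgD; apply: cvgM;
    [exact: zr|exact: yi|exact: zi|exact: yr].
Qed.

Lemma ccontinuousV Z : (forall t, 0 <= t <= T -> Z t != 0) -> ccontinuous Z ->
  ccontinuous (fun t => (Z t)^-1).
Proof.
move=> Zn0 [zr zi].
pose m t := Re (Z (clamp 0 T t)) * Re (Z (clamp 0 T t)) +
  Im (Z (clamp 0 T t)) * Im (Z (clamp 0 T t)).
have mE t : Re (Z (clamp 0 T t)) ^+ 2 + Im (Z (clamp 0 T t)) ^+ 2 = m t.
  by rewrite /m !expr2.
have m0 t : m t != 0.
  by rewrite -mE -modulus_sq expf_neq0// modulus_eq0 Zn0.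
have cm : continuous m.
  by move=> t; apply: cvgD; apply: cvgM; (exact: zr || exact: zi).
split => t.
- under eq_fun do rewrite Re_inv mE.
  by apply: cvgM; [exact: zr|apply: cvgV => //; exact: cm].
- under eq_fun do rewrite Im_inv mE.
  apply: cvgM; last by apply: cvgV => //; exact: cm.
  by apply: cvgN; exact: zi.
Qed.

Lemma ccontinuous_cst c : ccontinuous (fun=> c).
Proof. by split => t; exact: cvg_cst. Qed.

Lemma ccontinuous_real f : continuous_itv 0 T f -> ccontinuous (fun t => (f t)%:C).
Proof.
move=> cf; split; first exact: (continuous_clamp T0 cf).
by move=> t; exact: cvg_cst.
Qed.

Lemma ccontinuous_Re Z : ccontinuous Z -> continuous_itv 0 T (fun t => Re (Z t)).
Proof.
move=> /ccontinuousP H t tT e /(H t tT)[d d0 hd]; exists d => // s sT /(hd s sT).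
by apply: le_lt_trans; rewrite -Re_sub; exact: Re_le_modulus.
Qed.

Lemma ccontinuous_Im Z : ccontinuous Z -> continuous_itv 0 T (fun t => Im (Z t)).
Proof.
move=> /ccontinuousP H t tT e /(H t tT)[d d0 hd]; exists d => // s sT /(hd s sT).
by apply: le_lt_trans; rewrite -Im_sub; exact: Im_le_modulus.
Qed.

Lemma cderive_ccontinuous Z (l : R -> CC R) :
  (forall u, 0 <= u <= T -> cderive Z u (l u)) -> ccontinuous Z.
Proof.
move=> dZ; apply/ccontinuousP => t tT e e0.
have e20 : 0 < e / 2 by rewrite divr_gt0.
have [/is_derive_continuous cr /is_derive_continuous ci] := dZ t tT.
have /cvgrPdist_lt/(_ _ e20)/nbhs_ballP[d1/= d10 hd1] := cr.
have /cvgrPdist_lt/(_ _ e20)/nbhs_ballP[d2/= d20 hd2] := ci.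
exists (Num.min d1 d2); first by rewrite lt_min d10.
move=> s _; rewrite lt_min => /andP[st1 st2].
have := hd1 s; rewrite /ball/= distrC => /(_ st1) k1.
have := hd2 s; rewrite /ball/= distrC => /(_ st2) k2.
apply: le_lt_trans (modulus_le_ReIm _) _; rewrite Re_sub Im_sub [ltRHS]splitr.
by apply: ltrD; rewrite distrC.
Qed.

Lemma ccontinuous_primitive Z : ccontinuous Z ->
  exists Y, forall u, 0 <= u <= T -> cderive Y u (Z u).
Proof.
move=> cZ.
have [Fr hr] := continuous_itv_primitive T0 (ccontinuous_Re cZ).
have [Fi hi] := continuous_itv_primitive T0 (ccontinuous_Im cZ).
by exists (fun t => Fr t +i* Fi t) => u uT; split => /=; [exact: hr|exact: hi].
Qed.

Lemma ccontinuous_modulus_min Z : ccontinuous Z -> (forall t, 0 <= t <= T -> Z t != 0) ->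
  exists2 d, 0 < d & forall t, 0 <= t <= T -> d <= modulus (Z t).
Proof.
move=> /ccontinuousP cZ Zn0.
have [|c cT minc] := @continuous_itv_min R 0 T (fun t => modulus (Z t)) T0.
  move=> t tT e /(cZ t tT)[d d0 hd]; exists d => // s sT /(hd s sT).
  apply: le_lt_trans; rewrite ler_norml; apply/andP; split.
    by rewrite lerNl opprB modulusB; exact: ler_sub_modulus.
  exact: ler_sub_modulus.
by exists (modulus (Z c)) => //; rewrite modulus_gt0 Zn0.
Qed.

End continuous_trajectories.

(** * Limits of flows and derivatives in the initial point *)

Section limit_of_flows.
Context {R : realType}.
Local Notation Re := complex.Re.
Local Notation Im := complex.Im.
Variables (T al : R) (be ga U : R -> CC R).
Hypothesis T0 : 0 <= T.
Hypothesis al1 : `|al| <= 1.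
Hypothesis ga2 : forall u, 0 <= u <= T -> modulus (ga u) <= 2.
Local Notation flow := (flow T al be ga U).
Local Notation separated_flow := (separated_flow T al be ga U).

(** Let [Y] be a primitive of the field along [x]. The velocities of [Zs e] and [Y] differ by
    [O(e)], so [x - Y] is constant. The witness is a translate of [Y] rather than [x], because it
    has two-sided derivatives at [0] and [T]. *)
Lemma limit_flow (x : R -> CC R) (Zs : R -> R -> CC R) (d e0 E : R) :
  ccontinuous T be -> ccontinuous T ga -> ccontinuous T U -> ccontinuous T x ->
  0 < d -> (forall t, 0 <= t <= T -> d <= modulus (x t - U t)) ->
  0 < e0 -> 0 <= E ->
  (forall e, 0 < e < e0 -> separated_flow d (Zs e)) ->
  (forall e t, 0 < e < e0 -> 0 <= t <= T -> modulus (Zs e t - x t) <= E * e) ->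
  exists2 Y, separated_flow d Y & forall t, 0 <= t <= T -> Y t = x t.
Proof.
move=> cbe cga cU cx d0 xd e00 E0 sZ Zx.
have xU t : 0 <= t <= T -> x t - U t != 0.
  by move=> tT; rewrite -modulus_gt0 (lt_le_trans d0) ?xd.
pose rhs t := al%:C * x t + be t + ga t / (x t - U t).
have crhs : ccontinuous T rhs.
  apply: ccontinuousD; first apply: ccontinuousD => //.
    by apply: ccontinuousM => //; exact: ccontinuous_cst.
  apply: ccontinuousM => //; apply: ccontinuousV => //.
  by apply: ccontinuousD => //; exact: ccontinuousN.
have [Y dY] := ccontinuous_primitive T0 crhs.
(* The Lipschitz constant of the field at distance [d] from [U], times the rate of convergence. *)
pose K := (1 + 2 / d ^+ 2) * E.
have K0 : 0 <= K by rewrite mulr_ge0// addr_ge0// divr_ge0// sqr_ge0.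
have close e t : 0 < e < e0 -> 0 <= t <= T ->
    modulus ((Zs e t - Y t) - (Zs e 0 - Y 0)) <= 2 * (K * e * t).
  move=> ee0 tT; have /andP[eg0 _] := ee0; have /andP[t0 tT'] := tT.
  have [fZ dZ] := sZ e ee0.
  pose l u := al%:C * (Zs e u - x u) - ga u * ((Zs e u - x u) / ((Zs e u - U u) * (x u - U u))).
  have uT u : 0 <= u <= t -> 0 <= u <= T.
    by move=> /andP[-> ut]; exact: le_trans ut tT'.
  have dl u : 0 <= u <= t -> cderive (fun s => Zs e s - Y s) u (l u).
    move=> /uT uT'; have [Zu dZu] := fZ u uT'.
    have -> : l u = al%:C * Zs e u + be u + ga u / (Zs e u - U u) - rhs u.
      rewrite /l /rhs; field.
      by rewrite xU// subr_eq0 Zu.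
    by apply: cderiveB => //; exact: dY.
  have ml u : 0 <= u <= t -> modulus (l u) <= K * e.
    move=> /uT uT'; apply: le_trans (ler_modulusB _ _) _.
    have hx := Zx e u ee0 uT'.
    have -> : K * e = E * e + 2 * (E * e / d ^+ 2) by rewrite /K; ring.
    apply: lerD; rewrite modulusM.
      rewrite modulusR -[leRHS]mul1r; apply: ler_pM; rewrite ?modulus_ge0//.
    apply: ler_pM; rewrite ?modulus_ge0 ?ga2// modulusM.
    apply: ler_pM; rewrite ?modulus_ge0// modulusV modulusM.
    have A0 := lt_le_trans d0 (xd _ uT'); have A0' := lt_le_trans d0 (dZ _ uT').
    rewrite lef_pV2 ?posrE ?exprn_gt0 ?mulr_gt0// expr2.
    by apply: ler_pM; rewrite ?(ltW d0) ?dZ ?xd.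
  apply: le_trans (modulus_le_ReIm _) _; rewrite !Re_sub !Im_sub.
  have := @is_derive_bounded R (fun s => Re (Zs e s - Y s)) (fun s => Re (l s)) 0 t (K * e) t0.
  rewrite !Re_sub subr0 => /(_ _ _)-H1.
  have {}H1 := H1 (fun u ut => (dl u ut).1)
    (fun u ut => le_trans (Re_le_modulus _) (ml u ut)).
  have := @is_derive_bounded R (fun s => Im (Zs e s - Y s)) (fun s => Im (l s)) 0 t (K * e) t0.
  rewrite !Im_sub subr0 => H2.
  have {}H2 := H2 (fun u ut => (dl u ut).2)
    (fun u ut => le_trans (Im_le_modulus _) (ml u ut)).
  by rewrite mulr_natl mulr2n; apply: lerD.
have xY t : 0 <= t <= T -> x t - Y t = x 0 - Y 0.
  move=> tT; apply/eqP; rewrite -subr_eq0 -modulus_eq0 eq_le modulus_ge0 andbT.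
  have /andP[t0 _] := tT; have OT : 0 <= (0 : R) <= T by rewrite lexx T0.
  apply/ler_addgt0Pr => n n0; rewrite add0r.
  pose B := 2 * (K * t) + 2 * E + 1.
  have B0 : 0 < B by rewrite ltr_wpDl// addr_ge0// mulr_ge0// mulr_ge0.
  pose m := Num.min e0 (n / B).
  have m0 : 0 < m by rewrite lt_min e00 divr_gt0.
  have me0 : m <= e0 by rewrite ge_min lexx.
  have mB : m * B <= n by rewrite -ler_pdivlMr// ge_min lexx orbT.
  pose e := m / 2.
  have ee0 : 0 < e < e0 by rewrite /e; apply/andP; split; lra.
  have h1 := close e t ee0 tT; have h2 := Zx e t ee0 tT; have h3 := Zx e 0 ee0 OT.
  have -> : x t - Y t - (x 0 - Y 0) = ((Zs e t - Y t) - (Zs e 0 - Y 0)) -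
      (Zs e t - x t) + (Zs e 0 - x 0) by ring.
  have j1 := ler_modulusD (((Zs e t - Y t) - (Zs e 0 - Y 0)) - (Zs e t - x t)) (Zs e 0 - x 0).
  have j2 := ler_modulusB ((Zs e t - Y t) - (Zs e 0 - Y 0)) (Zs e t - x t).
  apply: le_trans j1 _; apply: le_trans (lerD j2 h3) _.
  apply: le_trans (lerD (lerD h1 h2) (lexx _)) _.
  apply: le_trans mB.
  have -> : 2 * (K * e * t) + E * e + E * e = m * (K * t + E) by rewrite /e; field.
  rewrite ler_pM2l// /B; have := mulr_ge0 K0 t0; lra.
exists (fun t => Y t + (x 0 - Y 0)).
  have YE t : 0 <= t <= T -> Y t + (x 0 - Y 0) = x t.
    by move=> tT; rewrite -(xY t tT) addrC subrK.
  split=> [u uT|u uT]; rewrite YE//; last exact: xd.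
  split; first by rewrite -subr_eq0 xU.
  have := cderiveD (dY u uT) (_ : cderive (fun=> x 0 - Y 0) u 0).
  rewrite addr0; apply.
  by split; exact: is_derive_fun_cst.
by move=> t tT; rewrite -(xY t tT) addrC subrK.
Qed.

(** The integrand is the real part of the [z]-derivative of the field along [Y], hence the growth
    rate of the logarithm of the modulus of the linearised flow. *)
Lemma flow_log_derivative Y : ccontinuous T ga -> ccontinuous T U -> flow Y ->
  exists Lam, forall u, 0 <= u <= T ->
    is_derive u (1 : R) Lam (Re (al%:C - ga u / (Y u - U u) ^+ 2)).
Proof.
move=> cga cU fY.
have cY : ccontinuous T Y by apply: (cderive_ccontinuous T0) => u uT; exact: (fY u uT).2.
have Yn t : 0 <= t <= T -> Y t - U t != 0 by move=> tT; rewrite subr_eq0; exact: (fY t tT).1.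
have cq : ccontinuous T (fun u => al%:C - ga u / (Y u - U u) ^+ 2).
  apply: ccontinuousD; first exact: ccontinuous_cst.
  apply: ccontinuousN; apply: ccontinuousM => //; apply: ccontinuousV => //.
    by move=> t tT; rewrite expf_neq0 ?Yn.
  rewrite (_ : (fun t => _) = (fun t => (Y t - U t) * (Y t - U t))); last first.
    by apply/funext => t; rewrite expr2.
  by apply: ccontinuousM; apply: ccontinuousD => //; exact: ccontinuousN.
have [F dF] := ccontinuous_primitive T0 cq.
by exists (fun s => Re (F s)) => u uT; have [] := dF u uT.
Qed.

(** The distance between two trajectories has logarithmic rate [Re la], which is within [K e] of the
    rate of [Lam]. As [f] is complex differentiable, displacements in the single direction [om]
    determine the modulus of its derivative. *)
Lemma flow_derivative (X : R -> CC R) (Zs : R -> R -> CC R) (Lam : R -> R)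
    (f : CC R -> CC R) (z0 om : CC R) (d e0 : R) :
  0 < d -> 0 < e0 -> separated_flow d X ->
  (forall e, 0 < e < e0 -> separated_flow d (Zs e)) ->
  (forall u, 0 <= u <= T ->
     is_derive u (1 : R) Lam (Re (al%:C - ga u / (X u - U u) ^+ 2))) ->
  modulus om = 1 ->
  (forall e, 0 < e < e0 -> Zs e 0 = X 0 + om * e%:C) ->
  (forall e, 0 < e < e0 -> f (z0 + om * e%:C) = Zs e T) -> f z0 = X T ->
  derivable f z0 1 ->
  modulus (derive1 f z0) = expR (Lam T - Lam 0).
Proof.
move=> d0 e00 sX sZ dLam om1 Zs0 fZ fX df.
pose M := expR ((2 * (1 + 2 / d ^+ 2) + 1) * T).
pose K := 2 * (M / d ^+ 3).
have M0 : 0 < M by exact: expR_gt0.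
have K0 : 0 <= K by rewrite mulr_ge0// divr_ge0 ?(ltW M0)// exprn_ge0// ltW.
have TT : 0 <= T <= T by rewrite T0 lexx.
(* The squared distance times [exp(-2 Lam)] is nonincreasing after multiplication by [exp(-2 K e u)]
   and nondecreasing after multiplication by [exp(2 K e u)]. *)
have est e : 0 < e < e0 ->
    e * expR (Lam T - Lam 0 - K * e * T) <= modulus (Zs e T - X T) /\
    modulus (Zs e T - X T) <= e * expR (Lam T - Lam 0 + K * e * T).
  move=> ee0; have /andP[eg0 _] := ee0; have sZe := sZ e ee0.
  pose la u : CC R := al%:C - ga u / ((Zs e u - U u) * (X u - U u)).
  pose la0 u : CC R := al%:C - ga u / (X u - U u) ^+ 2.
  have D0 : modulus (Zs e 0 - X 0) = e.
    by rewrite Zs0// addrAC subrr add0r modulusM om1 mul1r modulusR gtr0_norm.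
  have hla u : 0 <= u <= T -> `|Re (la u) - Re (la0 u)| <= K * e.
    move=> uT; rewrite -Re_sub; apply: le_trans (Re_le_modulus _) _.
    have [fXf dX] := sX; have [fZf dZ] := sZe.
    have Xn : X u - U u != 0 by rewrite subr_eq0; have [] := fXf u uT.
    have Zn : Zs e u - U u != 0 by rewrite subr_eq0; have [] := fZf u uT.
    have -> : la u - la0 u = ga u * ((Zs e u - X u) / ((X u - U u) ^+ 2 * (Zs e u - U u))).
      by rewrite /la /la0; field; rewrite Xn Zn.
    rewrite modulusM /K -mulrA; apply: ler_pM; rewrite ?modulus_ge0 ?ga2//.
    have -> : M / d ^+ 3 * e = (e * M) / d ^+ 3 by ring.
    rewrite modulusM; apply: ler_pM; rewrite ?modulus_ge0//.
      by have := flow_dist T0 al1 ga2 d0 sZe sX uT; rewrite D0.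
    have A0 := lt_le_trans d0 (dX _ uT); have A0' := lt_le_trans d0 (dZ _ uT).
    rewrite modulusV modulusM modulusX lef_pV2 ?posrE ?mulr_gt0 ?exprn_gt0//.
    rewrite exprSr; apply: ler_pM; rewrite ?exprn_ge0 ?(ltW d0) ?dZ//.
    by rewrite ler_pXn2r ?nnegrE ?(ltW d0) ?modulus_ge0 ?dX.
  pose n2 u := modulus (Zs e u - X u) ^+ 2.
  have dn2 u : 0 <= u <= T -> is_derive u (1 : R) n2 (2 * Re (la u) * n2 u).
    move=> uT.
    apply: is_derive_fun_eq (is_derive_modulus_sq (flow_diff sZe.1 sX.1 uT)) _.
    by rewrite Re_dot_mul mulrA.
  pose p s u := - (2 * Lam u) + s * (2 * (K * e) * u).
  have dF s u : 0 <= u <= T -> is_derive u (1 : R) (fun x => n2 x * expR (p s x))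
      (n2 u * expR (p s u) * (2 * (Re (la u) - Re (la0 u) + s * (K * e)))).
    move=> uT; apply: is_derive_fun_eq (is_derive_funM (dn2 u uT) (is_derive_fun_expR
      (is_derive_funD (is_derive_funN (is_derive_fun_cmul 2 (dLam u uT)))
        (is_derive_fun_cmul s (is_derive_fun_cmul (2 * (K * e)) (is_derive_fun_id u)))))) _.
    by rewrite -/(p s u) -/(la0 u); ring.
  have F0 s u : 0 <= n2 u * expR (p s u) by rewrite mulr_ge0 ?expR_ge0 ?sqr_ge0.
  have n20 : n2 0 = e ^+ 2 by rewrite /n2 D0.
  have up : n2 T * expR (p (-1) T) <= n2 0 * expR (p (-1) 0).
    apply: (is_derive_le0_nonincr T0 (dF (-1))) => u uT.
    apply: mulr_ge0_le0; first exact: F0.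
    by have := hla u uT; rewrite ler_norml => /andP[_]; lra.
  have lo : n2 0 * expR (p 1 0) <= n2 T * expR (p 1 T).
    apply: (is_derive_ge0_nondecr T0 (dF 1)) => u uT.
    apply: mulr_ge0; first exact: F0.
    by have := hla u uT; rewrite ler_norml => /andP[+ _]; lra.
  have sq2 (a b : R) : 0 <= a -> 0 <= b -> a ^+ 2 <= b ^+ 2 -> a <= b.
    by move=> a0 b0; rewrite ler_pXn2r.
  split; apply: sq2; rewrite ?modulus_ge0 ?mulr_ge0 ?expR_ge0 ?(ltW eg0)//;
    rewrite exprMn -expRM_natl -/(n2 T) -n20.
  - have -> : 2%:R * (Lam T - Lam 0 - K * e * T) = p 1 0 - p 1 T by rewrite /p; ring.
    by rewrite expRB mulrA ler_pdivrMr ?expR_gt0.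
  - have -> : 2%:R * (Lam T - Lam 0 + K * e * T) = p (-1) 0 - p (-1) T by rewrite /p; ring.
    by rewrite expRB mulrA ler_pdivlMr ?expR_gt0.
apply/eqP; rewrite eq_le.
set m := modulus (derive1 f z0); set L := Lam T - Lam 0.
have der n : 0 < n -> exists2 e, 0 < e < e0 &
    [/\ `|modulus (Zs e T - X T) / e - m| <= n,
        expR (L - n) <= modulus (Zs e T - X T) / e &
        modulus (Zs e T - X T) / e <= expR (L + n)].
  move=> n0; have [d1 d10 hd1] := derivable_modulusP df n0.
  have B0 : 0 < K * T + 1 by rewrite ltr_wpDl// mulr_ge0.
  pose t := Num.min e0 (Num.min d1 (n / (K * T + 1))).
  have t0 : 0 < t by rewrite !lt_min e00 d10 divr_gt0.
  pose e := t / 2.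
  have eg0 : 0 < e by rewrite divr_gt0.
  have et : e < t by rewrite ltr_pdivrMr// mulr_natr mulr2n ltrDl.
  have := et; rewrite !lt_min => /and3P[ee0 ed1]; rewrite ltr_pdivlMr// => eK.
  have ee0' : 0 < e < e0 by rewrite eg0.
  have eKT : K * e * T <= n.
    apply: le_trans (ltW eK).
    have -> : e * (K * T + 1) = K * e * T + e by ring.
    by rewrite lerDl ltW.
  exists e => //; have [h1 h2] := est e ee0'; split.
  - have me : modulus (om * e%:C) = e by rewrite modulusM om1 mul1r modulusR gtr0_norm.
    have := hd1 (om * e%:C); rewrite me => /(_ ed1); rewrite fZ// fX => h.
    have -> : modulus (Zs e T - X T) / e - m = (modulus (Zs e T - X T) - m * e) / e.
      by field; rewrite gt_eqF.
    rewrite normrM normfV (gtr0_norm eg0) ler_pdivrMr//.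
    have mE : m * e = modulus (derive1 f z0 * (om * e%:C)).
      by rewrite modulusM me.
    apply: le_trans h; rewrite mE ler_norml; apply/andP; split.
      by rewrite lerNl opprB (modulusB (Zs e T - X T)); exact: ler_sub_modulus.
    exact: ler_sub_modulus.
  - rewrite ler_pdivlMr// mulrC; apply: le_trans h1.
    by rewrite ler_pM2l// ler_expR lerD2l lerN2.
  - rewrite ler_pdivrMr// mulrC; apply: le_trans h2 _.
    by rewrite ler_pM2l// ler_expR lerD2l.
have ce n : 0 < n -> exists2 d, 0 < d & expR (L + d) <= expR L + n /\ expR L - n <= expR (L - d).
  move=> n0; have /cvgrPdist_le/(_ n n0)/nbhs_ballP[d1/= d10 hd1] := @continuous_expR R L.
  exists (d1 / 2); first by rewrite divr_gt0.
  have := hd1 (L + d1 / 2); rewrite /ball/= opprD addrA subrr sub0r normrN gtr0_norm ?divr_gt0//.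
  have d12 : d1 / 2 < d1 by rewrite ltr_pdivrMr// mulr_natr mulr2n ltrDl.
  move=> /(_ d12) h1.
  have := hd1 (L - d1 / 2); rewrite /ball/= opprD addrA subrr sub0r opprK gtr0_norm ?divr_gt0//.
  move=> /(_ d12) h2; move: h1 h2; rewrite !ler_norml => /andP[h1 h2] /andP[h3 h4].
  by split; lra.
apply/andP; split; apply/ler_addgt0Pr => n n0.
- have n20 : 0 < n / 2 by rewrite divr_gt0.
  have [d1 d10 [h1 _]] := ce _ n20.
  have m0 : 0 < Num.min d1 (n / 2) by rewrite lt_min d10.
  have [e _ [h2 _ h3]] := der _ m0.
  have k1 : expR (L + Num.min d1 (n / 2)) <= expR (L + d1) by rewrite ler_expR lerD2l ge_min lexx.
  have k2 : Num.min d1 (n / 2) <= n / 2 by rewrite ge_min lexx orbT.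
  by move: h2; rewrite ler_norml => /andP[h2 _]; lra.
- have n20 : 0 < n / 2 by rewrite divr_gt0.
  have [d1 d10 [_ h1]] := ce _ n20.
  have m0 : 0 < Num.min d1 (n / 2) by rewrite lt_min d10.
  have [e _ [h2 h3 _]] := der _ m0.
  have k1 : expR (L - d1) <= expR (L - Num.min d1 (n / 2)) by rewrite ler_expR lerD2l lerN2 ge_min lexx.
  have k2 : Num.min d1 (n / 2) <= n / 2 by rewrite ge_min lexx orbT.
  by move: h2; rewrite ler_norml => /andP[_ h2]; lra.
Qed.

End limit_of_flows.

(** * The argument common to both geometries, for a height that decreases along the flow *)

Section monotone_height.
Context {R : realType}.
Local Notation Re := complex.Re.
Local Notation Im := complex.Im.
Variables (T al : R) (be ga U : R -> CC R).
Hypothesis T0 : 0 <= T.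
Hypothesis al1 : `|al| <= 1.
Hypothesis ga2 : forall u, 0 <= u <= T -> modulus (ga u) <= 2.
Local Notation flow := (flow T al be ga U).
Local Notation separated_flow := (separated_flow T al be ga U).
Local Notation potential := (potential T U).
(* The domain is [0 < ht z]: [ht z] is [Im z] for the half-plane and
   [1 - |z|^2] for the disk. *)
Variable ht : CC R -> R.
Hypothesis ht_dist : forall z u, 0 <= u <= T -> 0 < ht z -> ht z / 2 <= modulus (z - U u).
Hypothesis ht_lipschitz : forall z w, 0 < ht z -> 0 < ht w ->
  `|ht z - ht w| <= 2 * modulus (z - w).
Hypothesis ht_superharmonic : forall z z1 z2 z3 z4, 0 < ht z ->
  ht z1 + ht z2 + ht z3 + ht z4 - 4 * ht z <= 2 * modulus (z1 + z2 + z3 + z4 - 4%:R * z).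
Hypothesis ht_derive : forall Z u, 0 <= u <= T -> flow Z -> 0 < ht (Z u) ->
  exists2 dh, is_derive u (1 : R) (fun s => ht (Z s)) dh & dh <= 0 /\
    (ht (Z u) <= 2^-1 -> dh <= - (ht (Z u) / modulus (Z u - U u) ^+ 2)).

Let ht_derivatives Z : flow Z -> (forall u, 0 <= u <= T -> 0 < ht (Z u)) ->
  exists dh : R -> R, forall u, 0 <= u <= T ->
    is_derive u (1 : R) (fun s => ht (Z s)) (dh u) /\ dh u <= 0 /\
    (ht (Z u) <= 2^-1 -> dh u <= - (ht (Z u) / modulus (Z u - U u) ^+ 2)).
Proof.
move=> fZ Z0; suff /choice[dh hdh] : forall u, exists dh, 0 <= u <= T ->
    is_derive u (1 : R) (fun s => ht (Z s)) dh /\ dh <= 0 /\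
    (ht (Z u) <= 2^-1 -> dh <= - (ht (Z u) / modulus (Z u - U u) ^+ 2)).
  by exists dh.
move=> u; have [uT|uT] := boolP (0 <= u <= T); last by exists 0.
by have [dh ? ?] := ht_derive uT fZ (Z0 u uT); exists dh.
Qed.

Lemma ht_nonincr Z s t : flow Z -> (forall u, 0 <= u <= T -> 0 < ht (Z u)) ->
  0 <= s -> s <= t -> t <= T -> ht (Z t) <= ht (Z s).
Proof.
move=> fZ Z0 s0 st tT; have [dh hdh] := ht_derivatives fZ Z0.
have st' u : s <= u <= t -> 0 <= u <= T.
  by move=> /andP[su ut]; rewrite (le_trans s0) ?(le_trans ut).
apply: (@is_derive_le0_nonincr _ (fun s => ht (Z s)) dh s t st) => u ut.
  by case: (hdh u (st' u ut)).
by case: (hdh u (st' u ut)) => _ [].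
Qed.

(** The height bounds the distance to [U] from below and is smallest at the final time. *)
Lemma ht_separated Z d : flow Z -> (forall u, 0 <= u <= T -> 0 < ht (Z u)) ->
  d <= ht (Z T) / 2 -> separated_flow d Z.
Proof.
move=> fZ Z0 dT; split => // u uT; have /andP[u0 u1] := uT.
apply: le_trans dT _; apply: le_trans (ht_dist uT (Z0 u uT)).
by rewrite ler_pM2r ?invr_gt0// ht_nonincr.
Qed.

(** Starting at height at most [1/2], the trajectory stays in the range where [ht_derive] gives the
    sharp rate, and dividing by the height turns it into [- |Z - U|^-2]. *)
Lemma ht_potential Z C : flow Z -> (forall u, 0 <= u <= T -> 0 < ht (Z u)) ->
  ht (Z 0) <= 2^-1 -> ln (ht (Z 0)) - ln (ht (Z T)) <= C ->
  potential C Z (fun u => ln (ht (Z u))).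
Proof.
move=> fZ Z0 h0 hC; have [dh hdh] := ht_derivatives fZ Z0.
exists (fun u => dh u / ht (Z u)) => // u uT; have [h1 [_ h2]] := hdh u uT.
split; first by apply: is_derive_fun_ln => //; exact: Z0.
rewrite ler_pdivrMr ?Z0// mulNr mulrC; apply: h2.
by have /andP[u0 u1] := uT; apply: le_trans h0; exact: ht_nonincr.
Qed.

Variables (N : set (CC R)) (g : R -> CC R -> CC R).
Hypothesis trajectory : forall z, 0 < ht z -> N z -> exists2 Z, flow Z & Z 0 = z /\
  forall u, 0 <= u <= T -> 0 < ht (Z u) /\ Z u = g u z.
Hypothesis dgT : forall z, 0 < ht z -> N z -> derivable (g T) z 1.

Let TT : 0 <= T <= T. Proof. by rewrite T0 lexx. Qed.

Lemma ht_gT_gt0 z : 0 < ht z -> N z -> 0 < ht (g T z).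
Proof. by move=> z0 /(trajectory z0)[Z _ [_ /(_ T TT)[h1 h2]]]; rewrite -h2. Qed.

Lemma ht_gT_continuous c r z : (forall w, modulus (w - c) < r -> 0 < ht w /\ N w) ->
  modulus (z - c) < r -> forall e, 0 < e -> exists2 d, 0 < d & forall w,
    modulus (w - z) < d -> `|ht (g T w) - ht (g T z)| < e.
Proof.
move=> Dom zr e e0; have [z0 Nz] := Dom z zr.
have e20 : 0 < e / 2 by rewrite divr_gt0.
have [d d0 hd] := derivable_modulus_continuous (dgT z0 Nz) e20.
exists (Num.min d (r - modulus (z - c))); first by rewrite lt_min d0 subr_gt0.
move=> w; rewrite lt_min => /andP[wd wr].
have [w0 Nw] : 0 < ht w /\ N w.
  apply: Dom; apply: le_lt_trans (_ : modulus (w - z) + modulus (z - c) < r); last by lra.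
  by apply: le_trans (ler_modulusD _ _); rewrite addrA subrK.
apply: le_lt_trans (ht_lipschitz (ht_gT_gt0 w0 Nw) (ht_gT_gt0 z0 Nz)) _.
by have := hd w wd; lra.
Qed.

(** Continuity of [ht \o g T] makes one separation constant valid for all starting points near [p],
    as the comparison of neighbouring flows requires. *)
Lemma nearby_separated c r p : (forall w, modulus (w - c) < r -> 0 < ht w /\ N w) ->
  modulus (p - c) < r -> exists d r1, [/\ 0 < d, 0 < r1 & forall w, modulus (w - p) < r1 ->
    exists2 Z, separated_flow d Z & Z 0 = w /\ forall u, 0 <= u <= T -> Z u = g u w].
Proof.
move=> Dom pr; have [p0 Np] := Dom p pr; have gp0 := ht_gT_gt0 p0 Np.
pose d := ht (g T p) / 4.
have d0 : 0 < d by rewrite divr_gt0.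
have [d1 d10 hd1] := ht_gT_continuous Dom pr d0.
exists d, (Num.min d1 (r - modulus (p - c))); split => //.
  by rewrite lt_min d10 subr_gt0.
move=> w; rewrite lt_min => /andP[wd wr]; have [w0 Nw] : 0 < ht w /\ N w.
  apply: Dom; apply: le_lt_trans (_ : modulus (w - p) + modulus (p - c) < r); last by lra.
  by apply: le_trans (ler_modulusD _ _); rewrite addrA subrK.
have [Z fZ [Z0 ZE]] := trajectory w0 Nw; exists Z; last first.
  by split => // u /ZE[].
apply: (ht_separated fZ) => [u /ZE[]//|].
have [_ ->] := ZE T TT; have := hd1 w wd; rewrite ltr_norml /d => /andP[h1 _].
by lra.
Qed.

(** The images of the four neighbours average to the image of [p] up to [O(e^3)] by
    [flow_four_points], and [ht_superharmonic] transfers this to heights. *)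
Lemma ht_gT_superharmonic c r p : (forall w, modulus (w - c) < r -> 0 < ht w /\ N w) ->
  modulus (p - c) < r -> exists C, exists2 e0, 0 < e0 & forall e, 0 < e < e0 ->
    ht (g T (p + e%:C)) + ht (g T (p + 'i * e%:C)) + ht (g T (p - e%:C)) +
      ht (g T (p - 'i * e%:C)) - 4 * ht (g T p) <= C * e ^+ 3.
Proof.
move=> Dom pr; have [p0 Np] := Dom p pr; have gp0 := ht_gT_gt0 p0 Np.
have [d [r1 [d0 r10 sep]]] := nearby_separated Dom pr.
have [|Z sZ [Z0 /(_ T TT) ZT]] := sep p; first by rewrite subrr modulus0.
have [C C0 hC] := flow_four_points T0 al1 ga2 d0 sZ.
exists (2 * C); exists r1 => // e /andP[eg0 er].
have me (om : CC R) : modulus om = 1 -> exists2 Z', separated_flow d Z' &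
    Z' 0 = p + om * e%:C /\ Z' T = g T (p + om * e%:C).
  move=> om1; have [|Z' sZ' [Z'0 /(_ T TT) Z'T]] := sep (p + om * e%:C).
    by rewrite addrAC subrr add0r modulusM om1 mul1r modulusR gtr0_norm.
  by exists Z'.
have [Z1 s1 [+ +]] := me 1 modulus1; rewrite mul1r => h1 e1.
have [Z2 s2 [h2 e2]] := me 'i modulus_i.
have [|Z3 s3 [+ +]] := me (-1); first by rewrite modulusN modulus1.
rewrite mulN1r => h3 e3.
have [|Z4 s4 [+ +]] := me (- 'i); first by rewrite modulusN modulus_i.
rewrite mulNr => h4 e4.
have := hC e Z1 Z2 Z3 Z4 (ltW eg0) s1 s2 s3 s4; rewrite Z0 ZT e1 e2 e3 e4.
move=> /(_ h1 h2 h3 h4) h; apply: le_trans (ht_superharmonic _ _ _ _ gp0) _.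
by rewrite -mulrA ler_pM2l.
Qed.

Lemma interior_flow c r : 0 < r -> (forall w, modulus (w - c) < r -> 0 < ht w /\ N w) ->
  ccontinuous T ga -> ccontinuous T U -> exists d Y Lam, [/\ 0 < d, separated_flow d Y,
  forall t, 0 <= t <= T -> Y t = g t c,
  forall u, 0 <= u <= T -> is_derive u (1 : R) Lam (Re (al%:C - ga u / (Y u - U u) ^+ 2)) &
  Y 0 = c /\ modulus (derive1 (g T) c) = expR (Lam T - Lam 0)].
Proof.
move=> r0 Dom cga cU.
have cr : modulus (c - c) < r by rewrite subrr modulus0.
have [d [r1 [d0 r10 sep]]] := nearby_separated Dom cr.
have /choice[Zs hZs] : forall e, exists Z, 0 < e < r1 -> separated_flow d Z /\
    Z 0 = c + 1 * e%:C /\ forall u, 0 <= u <= T -> Z u = g u (c + 1 * e%:C).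
  move=> e; have [/andP[e0 er]|_] := boolP (0 < e < r1); last by exists (fun=> 0).
  have [|Z sZ HZ] := sep (c + 1 * e%:C); last by exists Z.
  by rewrite addrAC subrr add0r modulusM modulus1 mul1r modulusR gtr0_norm.
have [|Y sY [Y0 YE]] := sep c; first by rewrite subrr modulus0.
have [Lam dLam] := flow_log_derivative T0 cga cU sY.1.
exists d, Y, Lam; split => //; split => //.
have sZ e : 0 < e < r1 -> separated_flow d (Zs e) by move=> er; have [] := hZs e er.
apply: (flow_derivative T0 al1 ga2 d0 r10 sY sZ dLam modulus1).
- by move=> e er; rewrite Y0; have [_ []] := hZs e er.
- by move=> e er; have [_ [_ /(_ T TT)]] := hZs e er.
- by rewrite YE.
- by have [c0 Nc] := Dom c cr; exact: dgT.
Qed.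

Variables (x0 r : R) (bp nu : R -> CC R).
Hypothesis r0 : 0 < r.
Hypothesis r4 : r <= 4^-1.
(** The boundary point [bp x] pushed inwards by [e] along the unit normal [nu x]; the disk of radius
    [r] about [pt x r] touches the boundary at [bp x]. *)
Let pt x e := bp x + nu x * e%:C.
Let rho := r / 16.
Hypothesis nu1 : forall x, modulus (nu x) = 1.
Hypothesis bp_inj : forall x x', `|x - x0| <= r / 16 -> `|x' - x0| <= r / 16 ->
  bp x = bp x' -> x = x'.
Hypothesis pt_lipschitz : forall x x' e, 0 <= e <= r ->
  modulus (bp x + nu x * e%:C - (bp x' + nu x' * e%:C)) <= `|x - x'|.
Hypothesis tangent_disk : forall x e z, 0 < e <= r ->
  modulus (z - (bp x + nu x * e%:C)) < e ->
  e - modulus (z - (bp x + nu x * e%:C)) <= ht z.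
Hypothesis ht_pt : forall x e, 0 < e <= r -> ht (bp x + nu x * e%:C) <= 2 * e.
Hypothesis nearN : forall z, modulus (z - bp x0) < 4 * r -> N z.

Let rho0 : 0 < rho. Proof. by rewrite divr_gt0. Qed.

Let modulus_pt x e e' : modulus (pt x e - pt x e') = `|e - e'|.
Proof.
have -> : pt x e - pt x e' = nu x * (e - e')%:C.
  by rewrite /pt rmorphB/=; ring.
by rewrite modulusM nu1 mul1r modulusR.
Qed.

Let disk_bp x e z : `|x - x0| <= rho -> 0 <= e -> modulus (z - pt x e) < r ->
  modulus (z - bp x0) < r + e + rho.
Proof.
move=> xr e0 zr.
have h1 : modulus (bp x - bp x0) <= rho.
  have := @pt_lipschitz x x0 0; rewrite lexx ltW// !mulr0 !addr0 => /(_ isT).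
  by move=> /le_trans; apply.
have h2 : modulus (pt x e - bp x) = e.
  by rewrite /pt addrAC subrr add0r modulusM nu1 mul1r modulusR ger0_norm.
have -> : z - bp x0 = (z - pt x e) + (pt x e - bp x) + (bp x - bp x0) by ring.
have := ler_modulusD (z - pt x e + (pt x e - bp x)) (bp x - bp x0).
have := ler_modulusD (z - pt x e) (pt x e - bp x).
lra.
Qed.

Let disk_dom x z : `|x - x0| <= rho -> modulus (z - pt x r) < r -> 0 < ht z /\ N z.
Proof.
move=> xr zr; split.
  by apply: lt_le_trans (tangent_disk _ zr); rewrite ?subr_gt0// r0 lexx.
apply: nearN; apply: lt_le_trans (disk_bp xr (ltW r0) zr) _; rewrite /rho.
by move: r0; lra.
Qed.

Let pt_dom x e : `|x - x0| <= rho -> 0 < e <= r -> 0 < ht (pt x e) /\ N (pt x e).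
Proof.
move=> xr er; have /andP[e0 er'] := er; apply: (disk_dom xr).
by rewrite modulus_pt distrC ger0_norm ?subr_ge0// ltrBlDr ltrDl.
Qed.

(** Hopf's lemma in the disk tangent at [bp x]. One compact disk about [pt x0 r] provides a lower
    bound [m] that is uniform in [x]. *)
Lemma ht_gT_boundary : exists2 c, 0 < c & forall x e, `|x - x0| <= r / 16 -> 0 < e <= r ->
  c * e <= ht (g T (bp x + nu x * e%:C)).
Proof.
have x00 : `|x0 - x0| <= rho by rewrite subrr normr0 ltW.
(* The inner disk about [pt x r] has radius [sqrt(3/4) r <= 7/8 r], and the centres differ by at
   most [r / 16]. *)
pose s := 15 / 16 * r.
have s0 : 0 <= s by rewrite mulr_ge0 ?divr_ge0// ltW.
have sr : s < r by rewrite /s; move: r0; lra.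
have inS z : 0 <= modulus (z - pt x0 r) ^+ 2 <= s ^+ 2 -> modulus (z - pt x0 r) <= s.
  by rewrite sqr_ge0/= ler_pXn2r ?nnegrE ?modulus_ge0.
have [|||zm /inS zmS mzm] := @compact_plane_min _ (fun z => ht (g T z)) (pt x0 r) s 0 (s ^+ 2).
- exact: inS.
- move=> z /inS zS e e0; apply: (ht_gT_continuous (fun w => @disk_dom x0 w x00)) => //.
  exact: le_lt_trans sr.
- by exists (pt x0 r); rewrite subrr modulus0 expr0n/= lexx sqr_ge0.
set m := ht (g T zm) in mzm.
have m0 : 0 < m.
  have [|h1 h2] := disk_dom x00 (_ : modulus (zm - pt x0 r) < r); first exact: le_lt_trans sr.
  exact: ht_gT_gt0.
exists (m / (2 * r)); first by rewrite divr_gt0// mulr_gt0.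
move=> x e xr er; have /andP[e0 er'] := er; rewrite -/(pt x e).
have mv z : modulus (z - pt x r) ^+ 2 <= 3 / 4 * r ^+ 2 -> m <= ht (g T z).
  move=> h; apply: mzm; rewrite sqr_ge0/= ler_pXn2r ?nnegrE ?modulus_ge0//.
  have h1 : modulus (z - pt x r) <= 7 / 8 * r.
    rewrite -(@ler_pXn2r _ 2) ?nnegrE ?modulus_ge0//; last first.
      by rewrite mulr_ge0 ?divr_ge0// ltW.
    by apply: le_trans h _; rewrite exprMn ler_pM2r ?exprn_gt0//; lra.
  have h2 : modulus (pt x r - pt x0 r) <= rho.
    by apply: le_trans xr; apply: pt_lipschitz; rewrite ltW//=.
  have -> : z - pt x0 r = (z - pt x r) + (pt x r - pt x0 r) by ring.
  by have := ler_modulusD (z - pt x r) (pt x r - pt x0 r); rewrite /s /rho in h2 *; lra.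
have Dom w := @disk_dom x w xr.
have pos z : modulus (z - pt x r) < r -> 0 < ht (g T z).
  by move=> /Dom[]; apply: ht_gT_gt0.
have per : modulus (pt x e - pt x r) < r.
  by rewrite modulus_pt distrC ger0_norm ?subr_ge0// ltrBlDr ltrDl.
have := hopf_boundary_point r0 m0 pos (@ht_gT_continuous _ _ ^~ Dom)
  (@ht_gT_superharmonic _ _ ^~ Dom) mv per.
apply: le_trans.
rewrite modulus_pt real_normK ?num_real//.
have -> : m / (2 * r ^+ 2) * (r ^+ 2 - (e - r) ^+ 2) = m / (2 * r) * (e * (2 - e / r)).
  by field; rewrite gt_eqF.
rewrite ler_pM2l ?divr_gt0 ?mulr_gt0// -[leLHS]mulr1 ler_pM2l//.
have : e / r <= 1 by rewrite ler_pdivrMr// mul1r.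
by lra.
Qed.

Variables (G : R -> CC R -> CC R) (Bd : set (CC R)) (sg : CC R -> CC R -> R) (k : R).
Hypothesis cbe : ccontinuous T be.
Hypothesis cga : ccontinuous T ga.
Hypothesis cU : ccontinuous T U.
Hypothesis G_ext : forall t z, 0 <= t <= T -> 0 < ht z -> N z -> G t z = g t z.
Hypothesis dG : forall x t, `|x - x0| <= r / 16 -> 0 <= t <= T -> derivable (G t) (bp x) 1.
Hypothesis BdU : forall t, 0 <= t <= T -> Bd (U t).
Hypothesis sg0 : forall u, Bd u -> sg u u = 0.
Hypothesis sg_lipschitz : forall z u z' u', Bd z -> Bd u -> Bd z' -> Bd u' ->
  `|sg z u - sg z' u'| <= k * (modulus (z - z') + modulus (u - u')).
Hypothesis sg_inj : forall z z' u, Bd z -> Bd z' -> Bd u -> modulus (z - u) <= 1 ->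
  modulus (z' - u) <= 1 -> sg z u = sg z' u -> z = z'.
Hypothesis Bd_limit : forall z,
  (forall e, 0 < e -> exists2 w, modulus (w - z) < e & 0 < ht w <= e) -> Bd z.
Hypothesis bp_U : bp x0 != U 0.

(** Avoidance and compactness of [[0, T]] keep the marked trajectory at some distance [d] from [U].
    The interior trajectories over [x0] are then separated too, and both the Loewner equation and
    the formula for the derivative pass to the limit. *)
Lemma boundary_flow : exists d Y Lam, [/\ 0 < d, separated_flow d Y,
  forall t, 0 <= t <= T -> Y t = G t (bp x0) /\ Bd (Y t),
  forall u, 0 <= u <= T -> is_derive u (1 : R) Lam (Re (al%:C - ga u / (Y u - U u) ^+ 2)) &
  Y 0 = bp x0 /\ modulus (derive1 (G T) (bp x0)) = expR (Lam T - Lam 0)].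
Proof.
have [c c0 hc] := ht_gT_boundary.
have /choice[Zf hZ] : forall z, exists Z, 0 < ht z -> N z -> flow Z /\ Z 0 = z /\
    forall u, 0 <= u <= T -> 0 < ht (Z u) /\ Z u = g u z.
  move=> z; have [z0|] := boolP (0 < ht z); last by exists (fun=> 0).
  have [Nz|] := pselect (N z); last by exists (fun=> 0).
  by have [Z ? [? ?]] := trajectory z0 Nz; exists Z.
pose Z x e := Zf (pt x e).
pose V x e u := ln (ht (Z x e u)).
(* The height falls from at most [2 * e] to at least [c * e]; the quotient does not involve [e]. *)
pose C := ln (2 / c).
have le_r e : 0 < e < r -> 0 < e <= r by move=> /andP[-> /ltW].
have ZP x e : `|x - x0| <= rho -> 0 < e < r -> [/\ flow (Z x e), Z x e 0 = pt x e &
    forall u, 0 <= u <= T -> 0 < ht (Z x e u) /\ Z x e u = g u (pt x e)].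
  move=> xr /le_r er; have [h1 h2] := pt_dom xr er.
  by have [? [? ?]] := hZ _ h1 h2.
have flowZ x e : `|x - x0| <= rho -> 0 < e < r -> flow (Z x e) by move=> xr er; have [] := ZP x e xr er.
have Zpos x e u : `|x - x0| <= rho -> 0 < e < r -> 0 <= u <= T -> 0 < ht (Z x e u).
  by move=> xr er uT; have [_ _ /(_ u uT)[]] := ZP x e xr er.
have Z0 x e : `|x - x0| <= rho -> 0 < e < r -> Z x e 0 = pt x e.
  by move=> xr er; have [] := ZP x e xr er.
have ht0 x e : `|x - x0| <= rho -> 0 < e < r -> ht (Z x e 0) <= 2 * e.
  by move=> xr er; rewrite Z0//; apply: ht_pt; exact: le_r.
have potentialZ x e : `|x - x0| <= rho -> 0 < e < r -> potential C (Z x e) (V x e).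
  move=> xr er; have /andP[e0 er'] := er; apply: ht_potential; first exact: flowZ.
  - by move=> u; exact: Zpos.
  - apply: le_trans (ht0 _ _ xr er) _; have := lt_le_trans er' r4; lra.
  - have T00 : 0 <= (0 : R) <= T by rewrite lexx.
    have [_ _ /(_ T TT)[hT0 ZT]] := ZP x e xr er.
    have hp := Zpos _ _ _ xr er T00.
    rewrite -ln_div ?posrE// ler_ln ?posrE ?divr_gt0// ler_pdivrMr//.
    apply: le_trans (ht0 _ _ xr er) _.
    rewrite mulrAC -mulrA ler_pM2l// ler_pdivlMr// mulrC ZT.
    by apply: hc => //; exact: le_r.
have Z0e x e e' : `|x - x0| <= rho -> 0 < e < r -> 0 < e' < r ->
    modulus (Z x e 0 - Z x e' 0) <= `|e - e'|.
  by move=> xr er er'; rewrite !Z0// modulus_pt.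
have Z0x x x' e : `|x - x0| <= rho -> `|x' - x0| <= rho -> 0 < e < r ->
    modulus (Z x e 0 - Z x' e 0) <= `|x - x'|.
  by move=> xr xr' er; rewrite !Z0//; apply: pt_lipschitz; have /andP[/ltW-> /ltW] := er.
pose X x t := G t (bp x).
have GZ x e t : `|x - x0| <= rho -> 0 < e < r -> 0 <= t <= T -> G t (pt x e) = Z x e t.
  move=> xr er tT; have [_ _ /(_ t tT)[_ ->]] := ZP x e xr er.
  by have [h1 h2] := pt_dom xr (le_r _ er); exact: G_ext.
have ZX x t : `|x - x0| <= rho -> 0 <= t <= T -> forall e, 0 < e ->
    exists2 d, 0 < d & forall e', 0 < e' < d -> e' < r -> modulus (Z x e' t - X x t) < e.
  move=> xr tT e e0; have [d d0 hd] := derivable_modulus_continuous (dG xr tT) e0.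
  exists d => // e' /andP[e'0 e'd] e'r.
  rewrite -GZ ?e'0//; apply: hd.
  by rewrite /pt addrAC subrr add0r modulusM nu1 mul1r modulusR gtr0_norm.
(* At time [0] the map is known to be the identity only inside the domain; the value on the boundary
   is a limit from within. *)
have X0 x : `|x - x0| <= rho -> X x 0 = bp x.
  move=> xr; apply/eqP; rewrite -subr_eq0 -modulus_eq0 eq_le modulus_ge0 andbT.
  apply/ler_addgt0Pr => e e0; rewrite add0r.
  have e20 : 0 < e / 2 by rewrite divr_gt0.
  have [|d d0 hd] := ZX x 0 xr _ _ e20; first by rewrite lexx.
  pose e1 := Num.min (Num.min d r) (e / 2) / 2.
  have m0 : 0 < Num.min (Num.min d r) (e / 2) by rewrite !lt_min d0 r0.
  have e10 : 0 < e1 by rewrite divr_gt0.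
  have : e1 < Num.min (Num.min d r) (e / 2) by rewrite /e1 ltr_pdivrMr// ltr_pMr// ltr1n.
  rewrite !lt_min => /andP[/andP[e1d e1r] e1e].
  have := hd e1; rewrite e10 => /(_ e1d e1r); rewrite Z0 ?e10// => h.
  have -> : X x 0 - bp x = pt x e1 - bp x - (pt x e1 - X x 0) by ring.
  apply: le_trans (ler_modulusB _ _) _.
  rewrite {1}/pt addrAC subrr add0r modulusM nu1 mul1r modulusR gtr0_norm//.
  by rewrite [leRHS]splitr lerD// ltW.
have X0inj x x' : `|x - x0| <= rho -> `|x' - x0| <= rho -> X x 0 = X x' 0 -> x = x'.
  by move=> xr xr'; rewrite !X0//; exact: bp_inj.
(* Heights only decrease in time, so the approximating points at time [t] still have height at most
   [2 * e1]. *)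
have BdX x t : `|x - x0| <= rho -> 0 <= t <= T -> Bd (X x t).
  move=> xr tT; apply: Bd_limit => e e0; have [d d0 hd] := ZX x t xr tT e e0.
  pose e1 := Num.min (Num.min d r) e / 2.
  have m0 : 0 < Num.min (Num.min d r) e by rewrite !lt_min d0 r0.
  have e10 : 0 < e1 by rewrite divr_gt0.
  have : e1 < Num.min (Num.min d r) e by rewrite /e1 ltr_pdivrMr// ltr_pMr// ltr1n.
  rewrite !lt_min => /andP[/andP[e1d e1r] e1e].
  have e1r' : 0 < e1 < r by rewrite e10.
  exists (Z x e1 t); first by apply: hd; rewrite ?e10.
  rewrite Zpos//=; have /andP[t0 tT'] := tT.
  apply: le_trans (ht_nonincr (flowZ _ _ xr e1r') (fun u => @Zpos x e1 u xr e1r') (lexx 0) t0 tT') _.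
  apply: le_trans (ht0 _ _ xr e1r') _; rewrite /e1 mulrC divfK//.
  by rewrite ge_min lexx orbT.
have cU' t : 0 <= t <= T -> forall e, 0 < e -> exists2 d, 0 < d & forall s, 0 <= s <= T ->
    `|s - t| < d -> modulus (U s - U t) < e.
  by move: t; apply/ccontinuousP.
have x00 : `|x0 - x0| <= rho by rewrite subrr normr0 ltW.
have avoid t : 0 <= t <= T -> X x0 t - U t != 0.
  move=> tT; rewrite subr_eq0.
  move: T0; rewrite le_eqVlt => /orP[/eqP T00|Tpos].
    move: tT; rewrite -T00 -eq_le => /eqP <-.
    by rewrite X0.
  exact: (@boundary_avoids R T al be ga U T0 al1 ga2 cU' x0 rho r C Z V X rho0 r0
    flowZ potentialZ Z0e Z0x X0inj ZX Bd sg k Tpos).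
have cX : ccontinuous T (X x0).
  apply/ccontinuousP => // t tT e e0.
  exact: (boundary_continuous al1 ga2 r0 flowZ potentialZ Z0e ZX x00 tT e0).
have [d d0 hd] := ccontinuous_modulus_min T0 (ccontinuousD cX (ccontinuousN cU)) avoid.
pose E := expR (T + 2 * C).
have ZXE e t : 0 < e < r -> 0 <= t <= T -> modulus (Z x0 e t - X x0 t) <= E * e.
  by move=> er tT; exact: (boundary_dist_inner al1 ga2 r0 flowZ potentialZ Z0e ZX x00 tT er).
have E0 : 0 < E by exact: expR_gt0.
(* Below this [e] the interior trajectory is within [d / 2] of the marked one, hence [d / 2] away
   from [U]. *)
pose e0 := Num.min r (d / 2 / E).
have d20 : 0 < d / 2 by rewrite divr_gt0.
have e00 : 0 < e0 by rewrite lt_min r0 divr_gt0.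
have e0r e : 0 < e < e0 -> 0 < e < r.
  by move=> /andP[->]; rewrite lt_min => /andP[].
have sZ e : 0 < e < e0 -> separated_flow (d / 2) (Z x0 e).
  move=> ee; have er := e0r _ ee; split; first exact: flowZ.
  move=> u uT; have /andP[eg0] := ee; rewrite lt_min => /andP[_].
  rewrite ltr_pdivlMr// mulrC => eE.
  have h1 := ZXE e u er uT; have h2 := hd u uT.
  have h3 := ler_sub_modulus (X x0 u - U u) (X x0 u - Z x0 e u).
  have h4 : X x0 u - U u - (X x0 u - Z x0 e u) = Z x0 e u - U u by ring.
  by rewrite h4 (modulusB (X x0 u) (Z x0 e u)) in h3; lra.
have hd2 t : 0 <= t <= T -> d / 2 <= modulus (X x0 t - U t).
  move=> tT; apply: le_trans (hd t tT).
  by rewrite ler_pdivrMr// ler_pMr// ler1n.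
have [|Y sY YX] := limit_flow T0 al1 ga2 cbe cga cU cX d20 hd2 e00 (ltW E0) sZ.
  by move=> e t /e0r; exact: ZXE.
have [Lam dLam] := flow_log_derivative T0 cga cU sY.1.
have T00 : 0 <= (0 : R) <= T by rewrite lexx.
exists (d / 2), Y, Lam; split => //.
  by move=> t tT; rewrite YX//; split => //; exact: BdX.
split; first by rewrite YX// X0.
apply: (flow_derivative T0 al1 ga2 d20 e00 sY sZ dLam (nu1 x0)).
- by move=> e /e0r er; rewrite Z0// YX// X0.
- by move=> e /e0r er; rewrite -GZ.
- by rewrite YX.
- exact: dG.
Qed.

End monotone_height.

(** * Chordal and radial flows *)

Lemma compact_avoids_ball {R : realType} (K : set (CC R)) (z : CC R) : compact K -> ~ K z ->
  exists2 r : R, 0 < r & forall w, modulus (w - z) < r -> ~ K w.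
Proof.
move=> cK Kz; have : nbhs z (~` K) by apply: open_nbhs_nbhs; split => //; apply: closed_openC; apply: compact_closed cK; exact: norm_hausdorff.
by move=> /nbhs_modulusP.
Qed.

(** * The half-plane, with height [Im] *)

Section chordal_flow.
Context {R : realType}.
Local Notation Re := complex.Re.
Local Notation Im := complex.Im.
Variables (T : R) (K : R -> set (CC R)) (g : R -> CC R -> CC R) (W : R -> R).
Hypothesis T0 : 0 <= T.
Hypothesis family : chordal_family T K g W.
Let U u : CC R := (W u)%:C.
Local Notation flow := (flow T 0 (fun=> 0) (fun=> 2%:R) U).

Let in0T u : 0 <= u <= T -> u \in `[0, T]. Proof. by rewrite in_itv. Qed.

Let ga2 u : 0 <= u <= T -> modulus (2%:R : CC R) <= 2.
Proof. by rewrite modulus_nat. Qed.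

Let al1 : `|0 : R| <= 1. Proof. by rewrite normr0. Qed.

Let ImU z u : Im (z - U u) = Im z. Proof. by rewrite Im_sub subr0. Qed.

Lemma chordal_conformal t z : 0 <= t <= T -> 0 < Im z -> ~ K T z ->
  0 < Im (g t z) /\ derivable (g t) z 1.
Proof.
move=> tT z0 Kz; have Ktz : ~ K t z.
  by have /andP[t0 t1] := tT; move=> h; apply: Kz; exact: (chordal_growing family t0 t1).
have [[hol [gmap _ _]] _] := chordal_capacity family (in0T tT).
split; last exact: hol.
by have := gmap z (conj z0 Ktz).
Qed.

Lemma chordal_trajectory z : 0 < Im z -> ~ K T z -> exists2 Z, flow Z &
  Z 0 = z /\ forall u, 0 <= u <= T -> 0 < Im (Z u) /\ Z u = g u z.
Proof.
move=> z0 Kz; have T01 : 0 <= T <= T by rewrite T0 lexx.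
have [|Z hZ] := @extend_trajectory R T (fun u => g u z) (fun u => 2 / (g u z - (W u)%:C)) T0.
  by move=> u uT; exact: (chordal_loewner family (in0T T01) (conj z0 Kz) (in0T uT)).
have gpos u : 0 <= u <= T -> 0 < Im (g u z) by move=> uT; have [] := chordal_conformal uT z0 Kz.
exists Z; last split.
- move=> u uT; have [E dZ] := hZ u uT; split.
    by apply/eqP => ZU; have := gpos u uT; rewrite -E ZU /= ltxx.
  by rewrite rmorph0 mul0r !add0r E.
- have T00 : 0 <= (0 : R) <= T by rewrite lexx.
  by have [-> _] := hZ 0 T00; exact: (chordal_start family).
- by move=> u uT; have [E _] := hZ u uT; rewrite E; split => //; exact: gpos.
Qed.

Lemma chordal_Im_dist z u : 0 <= u <= T -> 0 < Im z -> Im z / 2 <= modulus (z - U u).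
Proof.
move=> _ z0; apply: le_trans (Im_le_modulus _); rewrite ImU ger0_norm ?ltW//; lra.
Qed.

Lemma Im_lipschitz (z w : CC R) : 0 < Im z -> 0 < Im w -> `|Im z - Im w| <= 2 * modulus (z - w).
Proof.
move=> _ _; rewrite -Im_sub; apply: le_trans (Im_le_modulus _) _.
by rewrite ler_peMl ?modulus_ge0// ler1n.
Qed.

Lemma Im_superharmonic (z z1 z2 z3 z4 : CC R) : 0 < Im z ->
  Im z1 + Im z2 + Im z3 + Im z4 - 4 * Im z <= 2 * modulus (z1 + z2 + z3 + z4 - 4%:R * z).
Proof.
move=> _; have -> : Im z1 + Im z2 + Im z3 + Im z4 - 4 * Im z = Im (z1 + z2 + z3 + z4 - 4%:R * z).
  have h : 4%:R * z = z + z + z + z by ring.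
  by rewrite h !(Im_sub, Im_add); ring.
apply: le_trans (le_trans (ler_norm _) (Im_le_modulus _)) _.
by rewrite ler_peMl ?modulus_ge0// ler1n.
Qed.

Lemma chordal_Im_derive Z u : 0 <= u <= T -> flow Z -> 0 < Im (Z u) ->
  exists2 dh, is_derive u (1 : R) (fun s => Im (Z s)) dh & dh <= 0 /\
    (Im (Z u) <= 2^-1 -> dh <= - (Im (Z u) / modulus (Z u - U u) ^+ 2)).
Proof.
move=> uT fZ h0; have [ZU [_ dI]] := fZ u uT.
exists (- (2 * Im (Z u) / modulus (Z u - U u) ^+ 2)).
  apply: is_derive_fun_eq dI _.
  have R2 : Re (2%:R : CC R) = 2 by rewrite mulr2n Re_add.
  have I2 : Im (2%:R : CC R) = 0 by rewrite mulr2n Im_add /= addr0.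
  rewrite rmorph0 mul0r !add0r Im_mul Im_inv Re_inv -!modulus_sq ImU R2 I2.
  by rewrite mul0r addr0 mulNr mulrN mulrA.
have q0 : 0 < modulus (Z u - U u) ^+ 2 by rewrite exprn_gt0// modulus_gt0 subr_eq0.
split=> [|_]; first by rewrite oppr_le0 (divr_ge0 _ (ltW q0))// mulr_ge0// ltW.
rewrite lerN2 ler_pM2r ?invr_gt0//; lra.
Qed.

Let cU : ccontinuous T U.
Proof. by apply: ccontinuous_real => //; apply: continuous_itvP; exact: (chordal_driving family). Qed.

Let dgT z : 0 < Im z -> ~ K T z -> derivable (g T) z 1.
Proof.
move=> z0 Kz; have T01 : 0 <= T <= T by rewrite T0 lexx.
exact: (chordal_conformal T01 z0 Kz).2.
Qed.

Lemma chordal_interior_flow z0 : 0 < Im z0 -> ~ K T z0 -> exists d Y Lam, [/\ 0 < d,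
  separated_flow T 0 (fun=> 0) (fun=> 2%:R) U d Y, forall t, 0 <= t <= T -> Y t = g t z0,
  forall u, 0 <= u <= T -> is_derive u (1 : R) Lam (Re (0%:C - 2%:R / (Y u - U u) ^+ 2)) &
  Y 0 = z0 /\ modulus (derive1 (g T) z0) = expR (Lam T - Lam 0)].
Proof.
move=> z0_gt0 Kz0.
have T01 : 0 <= T <= T by rewrite T0 lexx.
have [r r0 hr] := compact_avoids_ball (half_plane_hull_compact (chordal_hull family (in0T T01))) Kz0.
have m0 : 0 < Num.min r (Im z0) by rewrite lt_min r0.
apply: (interior_flow T0 al1 ga2 chordal_Im_dist Im_lipschitz chordal_Im_derive
  chordal_trajectory dgT m0) => //; last exact: ccontinuous_cst.
move=> w; rewrite lt_min => /andP[/hr Kw wz]; split => //.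
have := le_lt_trans (Im_le_modulus _) wz; rewrite Im_sub ltr_norml => /andP[+ _].
lra.
Qed.

Lemma chordal_boundary_flow G x0 : (forall t, t \in `[0, T] -> half_plane_reflection (K t) (g t) (G t)) ->
  ~ K T x0%:C -> x0 != W 0 -> exists d Y Lam, [/\ 0 < d,
  separated_flow T 0 (fun=> 0) (fun=> 2%:R) U d Y,
  forall t, 0 <= t <= T -> Y t = G t x0%:C /\ Im (Y t) = 0,
  forall u, 0 <= u <= T -> is_derive u (1 : R) Lam (Re (0%:C - 2%:R / (Y u - U u) ^+ 2)) &
  Y 0 = x0%:C /\ modulus (derive1 (G T) x0%:C) = expR (Lam T - Lam 0)].
Proof.
move=> reflG Kx0 x0W.
have T01 : 0 <= T <= T by rewrite T0 lexx.
have [s s0 hs] := compact_avoids_ball (half_plane_hull_compact (chordal_hull family (in0T T01))) Kx0.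
(* The ball of radius [4 * r] avoids [K T], and [r <= 1/4] keeps the starting heights, at most
   [2 * e], below [1/2]. *)
pose r := Num.min 4^-1 (s / 4).
have r0 : 0 < r by rewrite lt_min invr_gt0 divr_gt0// ltr0n.
have r4 : r <= 4^-1 by rewrite ge_min lexx.
have rs : 4 * r <= s by rewrite mulrC -ler_pdivlMr// ge_min lexx orbT.
pose bp (x : R) : CC R := x%:C; pose nu (x : R) : CC R := 'i.
have nu1 x : modulus (nu x) = 1 by exact: modulus_i.
have ImPt x e : Im (bp x + nu x * e%:C) = e by rewrite Im_add Im_mul /= mul0r mul1r !add0r.
have KT t x : `|x - x0| <= r / 16 -> 0 <= t <= T -> ~ K t (bp x) /\ ~ K t (bp x)^*%C.
  move=> xr tT; have -> : (bp x)^*%C = bp x by rewrite /bp /= oppr0.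
  have /andP[t0 t1] := tT.
  suff : ~ K T (bp x) by move=> h; split => /(chordal_growing family t0 t1 (lexx T)).
  by apply: hs; rewrite /bp -rmorphB/= modulusR; lra.
have bp_inj x x' : `|x - x0| <= r / 16 -> `|x' - x0| <= r / 16 -> bp x = bp x' -> x = x'.
  by move=> _ _ [].
have pt_lip x x' e : 0 <= e <= r ->
    modulus (bp x + nu x * e%:C - (bp x' + nu x' * e%:C)) <= `|x - x'|.
  move=> _; have -> : bp x + nu x * e%:C - (bp x' + nu x' * e%:C) = (x - x')%:C.
    by rewrite /bp /nu rmorphB/=; ring.
  by rewrite modulusR.
have tangent x e z : 0 < e <= r -> modulus (z - (bp x + nu x * e%:C)) < e ->
    e - modulus (z - (bp x + nu x * e%:C)) <= Im z.
  move=> _ _; have := Im_le_modulus (z - (bp x + nu x * e%:C)).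
  by rewrite Im_sub ImPt ler_norml => /andP[+ _]; lra.
have htpt x e : 0 < e <= r -> Im (bp x + nu x * e%:C) <= 2 * e.
  by rewrite ImPt => /andP[e0 _]; lra.
have nearN z : modulus (z - bp x0) < 4 * r -> (~` K T) z.
  by move=> zr; apply: hs; exact: lt_le_trans zr rs.
have Gg t z : 0 <= t <= T -> 0 < Im z -> (~` K T) z -> G t z = g t z.
  move=> tT z0 Kz; apply: (half_plane_reflection_ext (reflG t (in0T tT))); split => //.
  by have /andP[t0 t1] := tT; move=> /(chordal_growing family t0 t1 (lexx T)).
have dG t x : `|x - x0| <= r / 16 -> 0 <= t <= T -> derivable (G t) (bp x) 1.
  by move=> xr tT; apply: (half_plane_reflection_holo (reflG t (in0T tT))); exact: KT.
have sgl (z u z' u' : CC R) : Im z = 0 -> Im u = 0 -> Im z' = 0 -> Im u' = 0 ->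
    `|Re z - Re u - (Re z' - Re u')| <= 1 * (modulus (z - z') + modulus (u - u')).
  move=> _ _ _ _; rewrite mul1r.
  have -> : Re z - Re u - (Re z' - Re u') = Re (z - z') - Re (u - u') by rewrite !Re_sub; ring.
  by apply: le_trans (ler_normB _ _) _; rewrite lerD ?Re_le_modulus.
have sgi (z z' u : CC R) : Im z = 0 -> Im z' = 0 -> Im u = 0 -> modulus (z - u) <= 1 ->
    modulus (z' - u) <= 1 -> Re z - Re u = Re z' - Re u -> z = z'.
  by move=> z0 z'0 _ _ _ /addIr h; apply: eq_ReIm => //; rewrite z0 z'0.
have Bdl (z : CC R) : (forall e, 0 < e -> exists2 w, modulus (w - z) < e & 0 < Im w <= e) -> Im z = 0.
  move=> H; apply/eqP; rewrite -normr_le0; apply/ler_addgt0Pr => e e0; rewrite add0r.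
  have e20 : 0 < e / 2 by rewrite divr_gt0.
  have [w wz /andP[w0 we]] := H _ e20.
  have := le_lt_trans (Im_le_modulus _) wz; rewrite Im_sub ltr_norml ler_norml => /andP[h1 h2].
  by apply/andP; split; lra.
have bpU : bp x0 != U 0.
  by apply: contra_neq x0W => -[].
have [d [Y [Lam [d0 sY YE dLam E0]]]] := @boundary_flow R T 0 (fun=> 0) (fun=> 2%:R) U
  T0 al1 ga2 (@complex.Im R) chordal_Im_dist Im_lipschitz
  Im_superharmonic chordal_Im_derive (~` K T) g chordal_trajectory dgT x0 r bp nu r0 r4 nu1
  bp_inj pt_lip tangent htpt nearN G [set z | Im z = 0] (fun z u => Re z - Re u) 1
  (ccontinuous_cst T 0) (ccontinuous_cst T 2%:R) cU Gg (fun x t => dG t x)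
  (fun _ _ => erefl) (fun u _ => subrr (Re u)) sgl sgi Bdl bpU.
by exists d, Y, Lam; split.
Qed.

End chordal_flow.

(** * Geometry of the unit circle and the height [1 - |z|^2] *)

Section unit_circle.
Context {R : realType}.
Local Notation Re := complex.Re.
Local Notation Im := complex.Im.
Implicit Types (a b x : R) (z u w : CC R).

Lemma norm_sin_le x : `|sin x| <= `|x|.
Proof.
have pos (y : R) : 0 <= y -> `|sin y| <= y.
  move=> y0.
  have := @is_derive_bounded R (@sin R) (@cos R) 0 y 1 y0 (fun t _ => is_derive_sin t).
  by rewrite sin0 !subr0 mul1r; apply => t _; exact: cos_max.
have [x0|x0] := leP 0 x; first by rewrite (ger0_norm x0) pos.
by rewrite (ltr0_norm x0) -normrN -sinN pos// oppr_ge0 ltW.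
Qed.

Lemma modulus_expiB a b : modulus (expi a - expi b) = 2 * `|sin ((a - b) / 2)|.
Proof.
apply/eqP; rewrite -(@eqrXn2 _ 2) ?modulus_ge0 ?mulr_ge0//.
rewrite modulus_sq exprMn real_normK ?num_real// Re_sub Im_sub /=.
have h : cos (a - b) = 1 - 2 * sin ((a - b) / 2) ^+ 2.
  rewrite -{1}[a - b](divfK (_ : 2 != 0))//.
  by rewrite mulr_natr cos_mulr2n cos2sin2; ring.
have := cosB a b; rewrite h => h2; have ha := cos2Dsin2 a; have hb := cos2Dsin2 b.
by apply/eqP; lra.
Qed.

Lemma expi_lipschitz a b : modulus (expi a - expi b) <= `|a - b|.
Proof.
rewrite modulus_expiB; apply: le_trans (ler_wpM2l _ (norm_sin_le _)) _ => //.
by rewrite normrM normfV (ger0_norm (_ : 0 <= 2))// mulrCA divff ?mulr1.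
Qed.

Lemma expi_neq a b : 0 < a - b < 2 * pi -> expi a != expi b.
Proof.
move=> /andP[h1 h2]; rewrite -subr_eq0 -modulus_eq0 modulus_expiB mulf_neq0// normr_eq0.
by rewrite gt_eqF// sin_gt0_pi// divr_gt0//= ltr_pdivrMr// mulrC.
Qed.

Lemma expi_inj a b : `|a - b| <= 1 -> expi a = expi b -> a = b.
Proof.
move=> ab E; have pi1 := pi_ge2 R; have [h|h|//] := ltgtP a b.
  suff /eqP[] : expi b != expi a by [].
  by apply: expi_neq; move: ab; rewrite ltr0_norm ?subr_lt0//; lra.
suff /eqP[] : expi a != expi b by [].
by apply: expi_neq; move: ab; rewrite gtr0_norm ?subr_gt0//; lra.
Qed.

(* [sine z u] is [Im (z * conj u)], the sine of the angle from [u] to [z]. *)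
Definition sine z u := Im z * Re u - Re z * Im u.

Lemma sine_le z u : `|sine z u| <= modulus z * modulus u.
Proof.
rewrite -(@ler_pXn2r _ 2) ?nnegrE ?mulr_ge0 ?modulus_ge0//.
rewrite exprMn !modulus_sq real_normK ?num_real// /sine.
by have := sqr_ge0 (Re z * Re u + Im z * Im u); nra.
Qed.

Lemma sine_lipschitz z u z' u' : modulus z = 1 -> modulus u = 1 -> modulus z' = 1 ->
  modulus u' = 1 -> `|sine z u - sine z' u'| <= 1 * (modulus (z - z') + modulus (u - u')).
Proof.
move=> z1 u1 z'1 u'1; rewrite mul1r.
have -> : sine z u - sine z' u' = sine (z - z') u + sine z' (u - u').
  by rewrite /sine !(Re_sub, Im_sub); ring.
apply: le_trans (ler_normD _ _) _.
have := sine_le (z - z') u; have := sine_le z' (u - u').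
by rewrite u1 z'1 mulr1 mul1r => h1 h2; exact: lerD.
Qed.

(** Within distance [1] of [u] the cosine [p] of the angle is positive, so it is determined by the
    sine. *)
Lemma sine_inj z z' u : modulus z = 1 -> modulus z' = 1 -> modulus u = 1 ->
  modulus (z - u) <= 1 -> modulus (z' - u) <= 1 -> sine z u = sine z' u -> z = z'.
Proof.
move=> z1 z'1 u1 zu z'u E.
pose p w := Re w * Re u + Im w * Im u.
have u2 : Re u ^+ 2 + Im u ^+ 2 = 1 by rewrite -modulus_sq u1 expr1n.
have ps w : modulus w = 1 -> p w ^+ 2 + sine w u ^+ 2 = 1.
  move=> w1; have w2 : Re w ^+ 2 + Im w ^+ 2 = 1 by rewrite -modulus_sq w1 expr1n.
  have -> : p w ^+ 2 + sine w u ^+ 2 = (Re w ^+ 2 + Im w ^+ 2) * (Re u ^+ 2 + Im u ^+ 2).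
    by rewrite /p /sine; ring.
  by rewrite w2 u2 mulr1.
have pp w : modulus w = 1 -> modulus (w - u) <= 1 -> 0 < p w.
  move=> w1 wu; have w2 : Re w ^+ 2 + Im w ^+ 2 = 1 by rewrite -modulus_sq w1 expr1n.
  have : modulus (w - u) ^+ 2 <= 1 by rewrite expr_le1 ?modulus_ge0.
  by rewrite modulus_sq Re_sub Im_sub /p; lra.
have pE : p z = p z'.
  apply/eqP; rewrite -(@eqrXn2 _ 2) ?(ltW (pp _ _ _))//.
  by have := ps _ z1; have := ps _ z'1; rewrite E => h1 h2; apply/eqP; lra.
have rE w : Re w = p w * Re u - sine w u * Im u.
  transitivity (Re w * (Re u ^+ 2 + Im u ^+ 2)); first by rewrite u2 mulr1.
  by rewrite /p /sine; ring.
have iE w : Im w = p w * Im u + sine w u * Re u.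
  transitivity (Im w * (Re u ^+ 2 + Im u ^+ 2)); first by rewrite u2 mulr1.
  by rewrite /p /sine; ring.
by apply: eq_ReIm; rewrite ?(rE z) ?(rE z') ?(iE z) ?(iE z') pE E.
Qed.

Lemma disk_height_lipschitz z w : 0 < 1 - modulus z ^+ 2 -> 0 < 1 - modulus w ^+ 2 ->
  `|1 - modulus z ^+ 2 - (1 - modulus w ^+ 2)| <= 2 * modulus (z - w).
Proof.
have lt1 y : 0 < 1 - modulus y ^+ 2 -> modulus y <= 1.
  by rewrite subr_gt0 => h; rewrite -(@expr_le1 _ 2) ?modulus_ge0// ltW.
move=> /lt1 z1 /lt1 w1.
have -> : 1 - modulus z ^+ 2 - (1 - modulus w ^+ 2) =
    (modulus z + modulus w) * (modulus w - modulus z) by ring.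
rewrite normrM; apply: ler_pM => //.
  by rewrite ger0_norm ?addr_ge0 ?modulus_ge0//; lra.
rewrite ler_norml; apply/andP; split.
  by rewrite lerNl opprB; exact: ler_sub_modulus.
by rewrite modulusB; exact: ler_sub_modulus.
Qed.

(** The convex function [|w|^2] lies above its tangent plane at [z]; what remains is linear in the
    sum of displacements, with slope [2 |z| <= 2]. *)
Lemma disk_height_superharmonic z z1 z2 z3 z4 : 0 < 1 - modulus z ^+ 2 ->
  1 - modulus z1 ^+ 2 + (1 - modulus z2 ^+ 2) + (1 - modulus z3 ^+ 2) +
    (1 - modulus z4 ^+ 2) - 4 * (1 - modulus z ^+ 2)
  <= 2 * modulus (z1 + z2 + z3 + z4 - 4%:R * z).
Proof.
rewrite subr_gt0 => h; have zle1 : modulus z <= 1 by rewrite -(@expr_le1 _ 2) ?modulus_ge0// ltW.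
have low w : modulus z ^+ 2 + 2 * (Re z * (Re w - Re z) + Im z * (Im w - Im z)) <= modulus w ^+ 2.
  rewrite !modulus_sq -subr_ge0.
  have -> : Re w ^+ 2 + Im w ^+ 2 - (Re z ^+ 2 + Im z ^+ 2 + 2 * (Re z * (Re w - Re z) +
      Im z * (Im w - Im z))) = (Re w - Re z) ^+ 2 + (Im w - Im z) ^+ 2 by ring.
  by rewrite addr_ge0 ?sqr_ge0.
set S := z1 + z2 + z3 + z4 - 4%:R * z.
have := dot_le_modulus z (- S); rewrite modulusN => hS.
have hS' : modulus z * modulus S <= modulus S by rewrite ler_piMl ?modulus_ge0.
have h4 : 4%:R * z = z + z + z + z by ring.
have RS : Re (- S) = 4 * Re z - (Re z1 + Re z2 + Re z3 + Re z4).
  by rewrite Re_opp /S h4 !(Re_sub, Re_add); ring.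
have IS : Im (- S) = 4 * Im z - (Im z1 + Im z2 + Im z3 + Im z4).
  by rewrite Im_opp /S h4 !(Im_sub, Im_add); ring.
rewrite RS IS in hS.
have := low z1; have := low z2; have := low z3; have := low z4.
move: (modulus z ^+ 2) (modulus z1 ^+ 2) (modulus z2 ^+ 2) (modulus z3 ^+ 2) (modulus z4 ^+ 2)
  hS hS'.
move: (modulus S) (modulus z * modulus S) => mS mzS q q1 q2 q3 q4; clear.
lra.
Qed.

End unit_circle.

(** * The disk, with height [1 - |z|^2] *)

Section radial_flow.
Context {R : realType}.
Local Notation Re := complex.Re.
Local Notation Im := complex.Im.
Variables (T : R) (K : R -> set (CC R)) (g : R -> CC R -> CC R) (w : R -> R).
Hypothesis T0 : 0 <= T.
Hypothesis family : radial_family T K g w.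
Let U u : CC R := expi (w u).
Let be u : CC R := - (2%:R * U u).
Let ga u : CC R := - (2%:R * U u ^+ 2).
Let ht (z : CC R) : R := 1 - modulus z ^+ 2.
Local Notation flow := (flow T (-1) be ga U).

Let in0T u : 0 <= u <= T -> u \in `[0, T]. Proof. by rewrite in_itv. Qed.

Let T01 : 0 <= T <= T. Proof. by rewrite T0 lexx. Qed.

Let modulusU u : modulus (U u) = 1. Proof. exact: modulus_expi. Qed.

Let ga2 u : 0 <= u <= T -> modulus (ga u) <= 2.
Proof. by rewrite modulusN modulusM modulusX modulusU expr1n mulr1 modulus_nat. Qed.

Let al1 : `|- 1 : R| <= 1. Proof. by rewrite normrN1. Qed.

Let ht_disk z : (0 < ht z) = (modulus z < 1).
Proof. by rewrite subr_gt0 expr_lt1 ?modulus_ge0. Qed.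

(** Polynomial division of [z (u + z)] by [u - z]; this is the origin of the coefficients [al], [be]
    and [ga] in the radial case. *)
Lemma radial_field (z u : CC R) : z != u ->
  (-1)%:C * z + - (2%:R * u) + - (2%:R * u ^+ 2) / (z - u) = (u + z) / (u - z) * z.
Proof.
move=> zu; have h : z - u != 0 by rewrite subr_eq0.
have h' : u - z != 0 by rewrite subr_eq0 eq_sym.
by rewrite rmorphN1; field; rewrite h h'.
Qed.

Lemma radial_conformal t z : 0 <= t <= T -> 0 < ht z -> ~ K T z ->
  0 < ht (g t z) /\ derivable (g t) z 1.
Proof.
move=> tT; rewrite !ht_disk => z1 Kz; have Ktz : ~ K t z.
  by have /andP[t0 t1] := tT; move=> h; apply: Kz; exact: (radial_growing family t0 t1).
have [[hol [gmap _ _]] _ _ _] := radial_conformal_radius family (in0T tT).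
split; last exact: hol.
by have := gmap z (conj z1 Ktz).
Qed.

Lemma radial_trajectory z : 0 < ht z -> ~ K T z -> exists2 Z, flow Z &
  Z 0 = z /\ forall u, 0 <= u <= T -> 0 < ht (Z u) /\ Z u = g u z.
Proof.
move=> z0 Kz; have z1 := z0; rewrite ht_disk in z1.
have [|Z hZ] := @extend_trajectory R T (fun u => g u z)
    (fun u => g u z * ((expi (w u) + g u z) / (expi (w u) - g u z))) T0.
  by move=> u uT; exact: (radial_loewner family (in0T T01) (conj z1 Kz) (in0T uT)).
have gpos u : 0 <= u <= T -> 0 < ht (g u z) by move=> uT; have [] := radial_conformal uT z0 Kz.
exists Z; last split.
- move=> u uT; have [E dZ] := hZ u uT.
  have ZU : Z u != U u.
    by apply/eqP => ZU; have := gpos u uT; rewrite -E ZU /ht modulusU expr1n subrr ltxx.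
  by split => //; rewrite radial_field// mulrC E.
- have T00 : 0 <= (0 : R) <= T by rewrite lexx.
  by have [-> _] := hZ 0 T00; exact: (radial_start family).
- by move=> u uT; have [E _] := hZ u uT; rewrite E; split => //; exact: gpos.
Qed.

Lemma disk_height_dist z u : 0 <= u <= T -> 0 < ht z -> ht z / 2 <= modulus (z - U u).
Proof.
move=> _; rewrite ht_disk /ht => z1.
have := ler_sub_modulus (U u) z; rewrite modulusU modulusB; apply: le_trans.
have := modulus_ge0 z; set m := modulus z in z1 *; move: m z1 => m z1 m0; nra.
Qed.

(** The real part of [(U + Z) / (U - Z)] is the Poisson kernel [(1 - |Z|^2) / |Z - U|^2]. The height
    decreases at [2 |Z|^2] times this rate, and [2 |Z|^2 >= 1] once the height is at most [1/2]. *)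
Lemma radial_height_derive Z u : 0 <= u <= T -> flow Z -> 0 < ht (Z u) ->
  exists2 dh, is_derive u (1 : R) (fun s => ht (Z s)) dh & dh <= 0 /\
    (ht (Z u) <= 2^-1 -> dh <= - (ht (Z u) / modulus (Z u - U u) ^+ 2)).
Proof.
move=> uT fZ h0; have [ZU dZ] := fZ u uT.
have q0 : 0 < modulus (Z u - U u) ^+ 2 by rewrite exprn_gt0// modulus_gt0 subr_eq0.
have h : Re ((U u + Z u) / (U u - Z u)) = ht (Z u) / modulus (Z u - U u) ^+ 2.
  rewrite [modulus (Z u - U u)]modulusB Re_mul Re_inv Im_inv -modulus_sq /ht.
  have <- : modulus (U u) ^+ 2 = 1 by rewrite modulusU expr1n.
  by rewrite !modulus_sq !(Re_sub, Im_sub, Re_add, Im_add, Re_opp, Im_opp); ring.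
exists (- (2 * (ht (Z u) / modulus (Z u - U u) ^+ 2 * modulus (Z u) ^+ 2))).
  apply: is_derive_fun_eq (is_derive_funB (is_derive_fun_cst 1 u) (is_derive_modulus_sq dZ)) _.
  by rewrite radial_field// Re_dot_mul h sub0r.
have p0 : 0 < ht (Z u) / modulus (Z u - U u) ^+ 2 by rewrite divr_gt0.
split; first by rewrite oppr_le0 pmulr_rge0// pmulr_rge0// sqr_ge0.
move=> hle; rewrite lerN2; have : 1 <= 2 * modulus (Z u) ^+ 2 by move: hle; rewrite /ht; lra.
by move=> h1; rewrite [leRHS]mulrCA; exact: ler_peMr (ltW p0) h1.
Qed.

Let cU : ccontinuous T U.
Proof.
apply/ccontinuousP => // t tT e e0.
have [d d0 hd] := continuous_itvP (radial_driving family) tT e0.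
exists d => // s sT st; apply: le_lt_trans (hd s sT st).
exact: expi_lipschitz.
Qed.

Let cbe : ccontinuous T be.
Proof. by apply: ccontinuousN; apply: ccontinuousM => //; exact: ccontinuous_cst. Qed.

Let cga : ccontinuous T ga.
Proof.
apply: ccontinuousN; apply: ccontinuousM; first exact: ccontinuous_cst.
rewrite (_ : (fun t => _) = (fun t => U t * U t)); first exact: ccontinuousM.
by apply/funext => t; rewrite expr2.
Qed.

Let dgT z : 0 < ht z -> ~ K T z -> derivable (g T) z 1.
Proof. by move=> z0 Kz; exact: (radial_conformal T01 z0 Kz).2. Qed.

Lemma radial_boundary_flow G v0 :
  (forall t, t \in `[0, T] -> disk_reflection (K t) (g t) (G t)) ->
  ~ K T (expi v0) -> expi v0 != expi (w 0) -> exists d Y Lam, [/\ 0 < d,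
  separated_flow T (-1) be ga U d Y,
  forall t, 0 <= t <= T -> Y t = G t (expi v0) /\ modulus (Y t) = 1,
  forall u, 0 <= u <= T -> is_derive u (1 : R) Lam (Re ((-1)%:C - ga u / (Y u - U u) ^+ 2)) &
  Y 0 = expi v0 /\ modulus (derive1 (G T) (expi v0)) = expR (Lam T - Lam 0)].
Proof.
move=> reflG Kx0 bpU.
have [s s0 hs] := compact_avoids_ball (disk_hull_compact (radial_hull family (in0T T01))) Kx0.
pose r := Num.min 4^-1 (s / 4).
have r0 : 0 < r by rewrite lt_min invr_gt0 divr_gt0// ltr0n.
have r4 : r <= 4^-1 by rewrite ge_min lexx.
have rs : 4 * r <= s by rewrite mulrC -ler_pdivlMr// ge_min lexx orbT.
pose bp (x : R) : CC R := expi x; pose nu (x : R) : CC R := - expi x.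
have nu1 x : modulus (nu x) = 1 by rewrite modulusN modulus_expi.
have ptE x (e : R) : bp x + nu x * e%:C = expi x * (1 - e)%:C.
  by rewrite /bp /nu rmorphB/= rmorph1; ring.
have mpt x e : 0 < e <= r -> modulus (bp x + nu x * e%:C) = 1 - e.
  move=> /andP[e0 er]; rewrite ptE modulusM modulus_expi mul1r modulusR ger0_norm//.
  by have := le_trans er r4; lra.
have expiV x : ((expi x : CC R)^*%C)^-1 = expi x.
  have h : expi x * (expi x : CC R)^*%C = 1.
    apply: eq_ReIm; rewrite ?Re_mul ?Im_mul/=; last by ring.
    by rewrite mulrN opprK -!expr2 cos2Dsin2.
  have c0 : (expi x : CC R)^*%C != 0.
    by apply/eqP => c0; move: h; rewrite c0 mulr0 => /esym/eqP; rewrite oner_eq0.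
  by apply: (mulIf c0); rewrite mulVf.
have KT t x : `|x - v0| <= r / 16 -> 0 <= t <= T -> ~ K t (bp x) /\ ~ K t ((bp x)^*%C)^-1.
  move=> xr tT; rewrite /bp expiV; have /andP[t0 t1] := tT.
  suff : ~ K T (bp x) by move=> h; split => /(radial_growing family t0 t1 (lexx T)).
  by apply: hs; apply: le_lt_trans (expi_lipschitz _ _) _; lra.
have bp_inj x x' : `|x - v0| <= r / 16 -> `|x' - v0| <= r / 16 -> bp x = bp x' -> x = x'.
  move=> xr xr'; apply: expi_inj; have -> : x - x' = (x - v0) - (x' - v0) by ring.
  by apply: le_trans (ler_normB _ _) _; lra.
have pt_lip x x' e : 0 <= e <= r ->
    modulus (bp x + nu x * e%:C - (bp x' + nu x' * e%:C)) <= `|x - x'|.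
  move=> /andP[e0 er]; rewrite !ptE -mulrBl modulusM modulusR.
  have e1 := le_trans er r4.
  rewrite ger0_norm; last by lra.
  have := expi_lipschitz x x'; apply: le_trans.
  by rewrite ler_piMr ?modulus_ge0//; lra.
have tangent x e z : 0 < e <= r -> modulus (z - (bp x + nu x * e%:C)) < e ->
    e - modulus (z - (bp x + nu x * e%:C)) <= ht z.
  move=> er; have := ler_sub_modulus z (bp x + nu x * e%:C); rewrite (mpt _ _ er) /ht.
  have := modulus_ge0 z; move: (modulus (z - _)) (modulus z) => q m m0 h1 h2.
  have m1 : m <= 1 by lra.
  by have : m ^+ 2 <= m by [rewrite expr2 ler_piMl]; lra.
have htpt x e : 0 < e <= r -> ht (bp x + nu x * e%:C) <= 2 * e.
  by move=> er; rewrite /ht mpt//; have := sqr_ge0 e; lra.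
have nearN z : modulus (z - bp v0) < 4 * r -> (~` K T) z.
  by move=> zr; apply: hs; exact: lt_le_trans zr rs.
have Gg t z : 0 <= t <= T -> 0 < ht z -> (~` K T) z -> G t z = g t z.
  move=> tT; rewrite ht_disk => z0 Kz.
  apply: (disk_reflection_ext (reflG t (in0T tT))); split => //.
  by have /andP[t0 t1] := tT; move=> /(radial_growing family t0 t1 (lexx T)).
have dG t x : `|x - v0| <= r / 16 -> 0 <= t <= T -> derivable (G t) (bp x) 1.
  by move=> xr tT; apply: (disk_reflection_holo (reflG t (in0T tT))); exact: KT.
have Bdl (z : CC R) : (forall e, 0 < e -> exists2 w, modulus (w - z) < e & 0 < ht w <= e) ->
    modulus z = 1.
  move=> H; apply/eqP; rewrite -subr_eq0 -normr_le0; apply/ler_addgt0Pr => e e0; rewrite add0r.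
  have e20 : 0 < e / 2 by rewrite divr_gt0.
  have [y yz /andP[y0 ye]] := H _ e20.
  have y1 : modulus y < 1 by rewrite -ht_disk.
  have y2 : modulus y ^+ 2 <= modulus y by rewrite expr2 ler_piMl ?modulus_ge0// ltW.
  have h1 := ler_sub_modulus y z; have h2 := ler_sub_modulus z y.
  move: ye yz h1 h2; rewrite (modulusB z y) /ht => ye yz h1 h2.
  rewrite ler_norml; move: (modulus y) (modulus z) (modulus (y - z)) (modulus y ^+ 2) y1 y2 ye yz h1 h2.
  move=> a b c q ? ? ? ? ? ?.
  by apply/andP; split; lra.
have sine0 (u : CC R) : modulus u = 1 -> sine u u = 0 by rewrite /sine mulrC subrr.
have [d [Y [Lam [d0 sY YE dLam E0]]]] := @boundary_flow R T (-1) be ga U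
  T0 al1 ga2 ht disk_height_dist (@disk_height_lipschitz R)
  (@disk_height_superharmonic R) radial_height_derive (~` K T) g radial_trajectory dgT v0 r bp nu
  r0 r4 nu1 bp_inj pt_lip tangent htpt nearN G [set z | modulus z = 1] sine 1
  cbe cga cU Gg (fun x t => dG t x)
  (fun t _ => modulusU t) sine0 (@sine_lipschitz R) (@sine_inj R) Bdl bpU.
by exists d, Y, Lam; split.
Qed.

End radial_flow.

(** * Energies of driving functions *)

Section increments.
Context {R : realType}.
Local Notation Re := complex.Re.
Local Notation Im := complex.Im.
Variables (T : R) (W : R -> R).
Implicit Types (Z U : R -> CC R) (f : R -> R).

Definition dominated f := exists C, forall s t, 0 <= s -> s <= t -> t <= T ->
  `|f t - f s| <= C * (`|W t - W s| + (t - s)).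

Lemma dominatedD f h : dominated f -> dominated h -> dominated (fun t => f t + h t).
Proof.
move=> [C hC] [D hD]; exists (C + D) => s t s0 st tT.
have -> : f t + h t - (f s + h s) = (f t - f s) + (h t - h s) by ring.
by apply: le_trans (ler_normD _ _) _; rewrite mulrDl lerD ?hC ?hD.
Qed.

Lemma dominatedZ c f : dominated f -> dominated (fun t => c * f t).
Proof.
move=> [C hC]; exists (`|c| * C) => s t s0 st tT.
by rewrite -mulrBr normrM -mulrA ler_wpM2l ?hC.
Qed.

Lemma dominated_derive f (df : R -> R) c : (forall u, 0 <= u <= T ->
  is_derive u (1 : R) f (df u) /\ `|df u| <= c) -> dominated f.
Proof.
move=> hf; exists `|c| => s t s0 st tT.
have uT u : s <= u <= t -> 0 <= u <= T.
  by move=> /andP[su ut]; rewrite (le_trans s0)// (le_trans ut).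
apply: (@le_trans _ _ (c * (t - s))).
  apply: (@is_derive_bounded R f df s t c st) => u /uT/hf; by case.
have ts : 0 <= t - s by rewrite subr_ge0.
apply: (@le_trans _ _ (`|c| * (t - s))); first by rewrite ler_wpM2r// ler_norm.
by rewrite ler_wpM2l// lerDr.
Qed.

Lemma ln_lipschitz (d x y : R) : 0 < d -> d <= x -> d <= y -> `|ln x - ln y| <= d^-1 * `|x - y|.
Proof.
have H (a b : R) : 0 < d -> d <= a -> a <= b -> `|ln b - ln a| <= d^-1 * (b - a).
  move=> d0 da ab; apply: (@is_derive_bounded R (@ln R) (fun t => t^-1) a b) => // u /andP[au _].
    by apply: is_derive1_ln; rewrite (lt_le_trans d0)// (le_trans da).
  have u0 : 0 < u by rewrite (lt_le_trans d0)// (le_trans da).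
  by rewrite gtr0_norm ?invr_gt0// lef_pV2 ?posrE// (le_trans da).
move=> d0 dx dy; have [xy|/ltW yx] := leP x y.
  by rewrite distrC [`|x - y|]distrC (ger0_norm (_ : 0 <= y - x)) ?subr_ge0// H.
by rewrite (ger0_norm (_ : 0 <= x - y)) ?subr_ge0// H.
Qed.

(** [Z] is Lipschitz in time, [U] moves no faster than [W], and [ln] is Lipschitz on [[d, +oo)]. *)
Lemma dominated_ln_modulus Z U (l : R -> CC R) d c : 0 < d ->
  (forall u, 0 <= u <= T -> [/\ d <= modulus (Z u - U u), cderive Z u (l u) & modulus (l u) <= c]) ->
  (forall s t, modulus (U t - U s) <= `|W t - W s|) ->
  dominated (fun t => ln (modulus (Z t - U t))).
Proof.
move=> d0 hZ UW; exists (d^-1 * (1 + 2 * `|c|)) => s t s0 st tT.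
have uT u : s <= u <= t -> 0 <= u <= T.
  by move=> /andP[su ut]; rewrite (le_trans s0)// (le_trans ut).
have [dt _ _] := hZ t (uT _ (introT andP (conj st (lexx t)))).
have [ds _ _] := hZ s (uT _ (introT andP (conj (lexx s) st))).
apply: le_trans (ln_lipschitz d0 dt ds) _; rewrite -mulrA ler_pM2l ?invr_gt0//.
have hRe : `|Re (Z t) - Re (Z s)| <= `|c| * (t - s).
  apply: (@is_derive_bounded R (fun u => Re (Z u)) (fun u => Re (l u))) => // u /uT/hZ[_ [dR _] lc] //.
  by apply: le_trans (Re_le_modulus _) (le_trans lc (ler_norm _)).
have hIm : `|Im (Z t) - Im (Z s)| <= `|c| * (t - s).
  apply: (@is_derive_bounded R (fun u => Im (Z u)) (fun u => Im (l u))) => // u /uT/hZ[_ [_ dI] lc] //.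
  by apply: le_trans (Im_le_modulus _) (le_trans lc (ler_norm _)).
have hZs : modulus (Z t - Z s) <= 2 * `|c| * (t - s).
  by apply: le_trans (modulus_le_ReIm _) _; rewrite Re_sub Im_sub; lra.
have h1 : `|modulus (Z t - U t) - modulus (Z s - U s)| <= modulus (Z t - Z s) + modulus (U t - U s).
  have E1 : Z t - U t - (Z s - U s) = (Z t - Z s) - (U t - U s) by ring.
  apply: le_trans (ler_modulusB _ _); rewrite -E1 ler_norml; apply/andP; split.
    by rewrite lerNl opprB [leRHS]modulusB; exact: ler_sub_modulus.
  exact: ler_sub_modulus.
apply: le_trans h1 _; apply: le_trans (lerD hZs (UW s t)) _.
have := mulr_ge0 (normr_ge0 c) (normr_ge0 (W t - W s)); rewrite -subr_ge0 in st.
lra.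
Qed.

Lemma energy_identity_on (h r Phi : R -> R) : 0 <= T -> absolutely_continuous 0 T W ->
  continuous_itv 0 T r -> (forall t, 0 <= t <= T -> h t = r t) -> dominated Phi ->
  (forall t w, 0 < t < T -> is_derive t (1 : R) W w ->
     is_derive t (1 : R) Phi (r t ^+ 2 / 2 - w * r t)) ->
  ((2^-1)%:E * \int[lebesgue_measure]_(t in `[0%R, T]) ((derive1 W t - h t) ^+ 2)%:E =
   (2^-1)%:E * \int[lebesgue_measure]_(t in `[0%R, T]) ((derive1 W t) ^+ 2)%:E
   + (Phi T - Phi 0)%:E)%E.
Proof.
move=> T0 acW cr hr [C hC] dPhi.
have cr' := continuous_itv_within T0 cr.
have dPhi' t w : 0 < t < T -> is_derive t (1 : R) W w ->
    is_derive t (1 : R) Phi ((w - r t) ^+ 2 / 2 - w ^+ 2 / 2).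
  by move=> tT dW; apply: is_derive_fun_eq (dPhi t w tT dW) _; field.
rewrite -(energy_identity T0 acW cr' hC dPhi').
congr (_ * _)%E; apply: eq_integral => t /set_mem/=; rewrite in_itv/= => tT.
by rewrite hr.
Qed.

Lemma is_derive_ln_modulus Z u (l : CC R) : cderive Z u l -> Z u != 0 ->
  is_derive u (1 : R) (fun s => ln (modulus (Z s))) (Re (l / Z u)).
Proof.
move=> dZ Z0; have q0 : 0 < modulus (Z u) ^+ 2 by rewrite exprn_gt0// modulus_gt0.
(* The equality also holds where [Z s = 0], because [ln 0 = 0] by convention. *)
have -> : (fun s => ln (modulus (Z s))) = (fun s => 2^-1 * ln (modulus (Z s) ^+ 2)).
  apply/funext => s; have [->|Zs] := eqVneq (Z s) 0.
    by rewrite modulus0 expr0n/= ln0// mulr0.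
  by rewrite lnXn ?modulus_gt0// mulr2n; field.
have D := is_derive_fun_cmul 2^-1
  (@is_derive_fun_ln R (fun s => modulus (Z s) ^+ 2) u _ q0 (is_derive_modulus_sq dZ)).
apply: is_derive_fun_eq D _.
rewrite Re_mul Re_inv Im_inv -modulus_sq; field.
by rewrite modulus_eq0.
Qed.

End increments.

Section chordal_energy.
Context {R : realType}.
Local Notation Re := complex.Re.
Local Notation Im := complex.Im.

Lemma Re_nat n : Re (n%:R : CC R) = n%:R.
Proof. by elim: n => // n IH; rewrite !mulrS Re_add IH. Qed.

Lemma Im_nat n : Im (n%:R : CC R) = 0.
Proof. by elim: n => // n IH; rewrite !mulrS Im_add IH /= addr0. Qed.

Lemma chordal_velocity (z A : CC R) : 0%:C * z + 0 + 2%:R / A = 2%:R * A^-1.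
Proof. by rewrite rmorph0 mul0r !add0r. Qed.

Lemma Re_chordal_log_derivative (A : CC R) :
  Re (0%:C - 2%:R / A ^+ 2) = - 2 * (Re A^-1 ^+ 2 - Im A^-1 ^+ 2).
Proof.
rewrite -exprVn expr2 Re_sub !(Re_mul, Im_mul) Re_nat Im_nat /=; ring.
Qed.

Lemma modulus_sqV (A : CC R) : Re A^-1 ^+ 2 + Im A^-1 ^+ 2 = (modulus A ^+ 2)^-1.
Proof. by rewrite -modulus_sq modulusV exprVn. Qed.

Variables (T : R) (W : R -> R).
Hypothesis T0 : 0 <= T.
Hypothesis cW : {within `[0, T], continuous W}.
Let U u : CC R := (W u)%:C.
Variables (d : R) (Y : R -> CC R) (Lam : R -> R).
Hypothesis d0 : 0 < d.
Hypothesis sY : separated_flow T 0 (fun=> 0) (fun=> 2%:R) U d Y.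
Hypothesis dLam : forall u, 0 <= u <= T ->
  is_derive u (1 : R) Lam (Re (0%:C - 2%:R / (Y u - U u) ^+ 2)).
Let A u := Y u - U u.
(** With [1 / (Y - W) = p + i s], the logarithmic derivatives of all the quantities in the chordal
    formulas are polynomials in [p], [s] and [W']. *)
Let p u := Re (A u)^-1.
Let s u := Im (A u)^-1.

Let dY u : 0 <= u <= T -> cderive Y u (2%:R * (A u)^-1).
Proof. by move=> uT; have [_] := sY.1 u uT; rewrite chordal_velocity. Qed.

Let A0 u : 0 <= u <= T -> A u != 0.
Proof. by move=> uT; rewrite subr_eq0; have [] := sY.1 u uT. Qed.

Let V2 u : 0 <= u <= T -> (modulus (A u) ^+ 2)^-1 <= (d ^+ 2)^-1.
Proof.
move=> uT; have h := sY.2 u uT; have h0 := lt_le_trans d0 h.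
by rewrite lef_pV2 ?posrE ?exprn_gt0// ler_pXn2r// nnegrE ltW.
Qed.

Lemma chordal_dist_derive t w : 0 <= t <= T -> is_derive t (1 : R) W w ->
  is_derive t (1 : R) (fun u => ln (modulus (A u))) (2 * (p t ^+ 2 - s t ^+ 2) - w * p t).
Proof.
move=> tT dW.
have dA : cderive A t (2%:R * (A t)^-1 - w%:C).
  apply: cderiveB; first exact: dY.
  by split => //=; exact: is_derive_fun_cst.
apply: is_derive_fun_eq (is_derive_ln_modulus dA (A0 tT)) _.
rewrite !(Re_mul, Im_mul, Re_sub, Im_sub) Re_nat Im_nat /= -/(p t) -/(s t); ring.
Qed.

Lemma chordal_Lam_derive t : 0 <= t <= T ->
  is_derive t (1 : R) Lam (- 2 * (p t ^+ 2 - s t ^+ 2)).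
Proof.
by move=> tT; apply: is_derive_fun_eq (dLam tT) _; rewrite Re_chordal_log_derivative.
Qed.

Lemma chordal_dominated_Lam : dominated T W Lam.
Proof.
apply: (@dominated_derive _ T W Lam _ (2 * (d ^+ 2)^-1)) => u uT.
split; first exact: chordal_Lam_derive uT.
have := V2 uT; rewrite -modulus_sqV -/(p u) -/(s u) => h.
have := sqr_ge0 (p u); have := sqr_ge0 (s u); rewrite ler_norml => h1 h2.
by apply/andP; split; lra.
Qed.

Lemma chordal_dominated_dist : dominated T W (fun t => ln (modulus (A t))).
Proof.
apply: (@dominated_ln_modulus _ T W Y U _ d (2 / d) d0) => [u uT|u v].
  split; [exact: sY.2 uT|exact: dY|].
  rewrite modulusM modulus_nat modulusV ler_pM2l// lef_pV2 ?posrE//; first exact: sY.2 uT.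
  exact: lt_le_trans d0 (sY.2 u uT).
by rewrite /U -rmorphB/= modulusR.
Qed.

Lemma chordal_Im_ln_derive u : 0 <= u <= T -> 0 < Im (Y u) ->
  is_derive u (1 : R) (fun t => ln (Im (Y t))) (- 2 * (p u ^+ 2 + s u ^+ 2)).
Proof.
move=> uT y0; apply: is_derive_fun_eq (is_derive_fun_ln y0 (dY uT).2) _.
have yE : Im (A u) = Im (Y u) by rewrite Im_sub subr0.
rewrite Im_mul Re_nat Im_nat mul0r addr0 modulus_sqV Im_inv -modulus_sq yE.
have m0 : modulus (A u) != 0 by rewrite modulus_eq0 A0.
by field; rewrite m0 gt_eqF.
Qed.

Lemma chordal_dominated_Im : (forall u, 0 <= u <= T -> 0 < Im (Y u)) ->
  dominated T W (fun t => ln (Im (Y t))).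
Proof.
move=> y0; apply: (@dominated_derive _ T W _ _ (2 * (d ^+ 2)^-1)) => u uT.
split; first by apply: chordal_Im_ln_derive => //; exact: y0.
have := V2 uT; rewrite -modulus_sqV -/(p u) -/(s u) => h.
have := sqr_ge0 (p u); have := sqr_ge0 (s u); rewrite ler_norml => h1 h2.
by apply/andP; split; lra.
Qed.

Lemma chordal_continuous_field rho : continuous_itv 0 T (fun t => - rho * p t).
Proof.
have cY : ccontinuous T Y by apply: (cderive_ccontinuous T0) => u uT; exact: dY.
have cA : ccontinuous T A.
  apply: ccontinuousD => //; apply: ccontinuousN; apply: ccontinuous_real => //.
  exact: continuous_itvP.
have := ccontinuous_Re T0 (ccontinuousM (ccontinuous_cst T (- rho)%:C) (ccontinuousV T0 A0 cA)).
congr (continuous_itv 0 T _); apply/funext => t.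
by rewrite Re_mul /= mul0r subr0.
Qed.

Lemma chordal_field rho t : rho * Re ((W t)%:C - Y t)^-1 = - rho * p t.
Proof. by rewrite -opprB invrN Re_opp mulrN mulNr. Qed.

(** The sum of [Lam] and [ln Im Y] has derivative [- 4 p^2], and that of [ln Im Y - ln |A|] is
    [- 4 p^2 + p W'], so [s] cancels in both. The coefficient [rho (8 + rho) / 8] is what leaves
    [rho^2 p^2 / 2 + rho p W'], that is [r^2 / 2 - r W'] for the field [r = - rho p]. *)
Lemma chordal_interior_energy rho z : (forall u, 0 <= u <= T -> 0 < Im (Y u)) ->
  (forall t, 0 <= t <= T -> Y t = z t) ->
  chordal_rho_energy rho T W z = (chordal_energy T W +
    (rho * (ln (Im (Y T)) - ln (modulus (A T)) - (ln (Im (Y 0)) - ln (modulus (A 0))))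
     - rho * (8 + rho) / 8 * (Lam T - Lam 0 + ln (Im (Y T)) - ln (Im (Y 0))))%:E)%E.
Proof.
move=> y0 Yz; rewrite /chordal_rho_energy /chordal_energy; case: ifPn => [/asboolP acW|_//].
pose Phi t := rho * (ln (Im (Y t)) + -1 * ln (modulus (A t))) +
  (- (rho * (8 + rho) / 8)) * (Lam t + ln (Im (Y t))).
have dPhi t w : 0 < t < T -> is_derive t (1 : R) W w ->
    is_derive t (1 : R) Phi ((- rho * p t) ^+ 2 / 2 - w * (- rho * p t)).
  move=> /andP[/ltW t0 /ltW tT] dW; have tT' : 0 <= t <= T by rewrite t0.
  have dI := chordal_Im_ln_derive tT' (y0 t tT').
  apply: is_derive_fun_eq (is_derive_funD
    (is_derive_fun_cmul rho (is_derive_funD dI (is_derive_fun_cmul (-1) (chordal_dist_derive tT' dW))))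
    (is_derive_fun_cmul _ (is_derive_funD (chordal_Lam_derive tT') dI))) _.
  by field.
have dom : dominated T W Phi.
  apply: dominatedD; apply: dominatedZ; apply: dominatedD.
  - exact: chordal_dominated_Im.
  - by apply: dominatedZ; exact: chordal_dominated_dist.
  - exact: chordal_dominated_Lam.
  - exact: chordal_dominated_Im.
have field_eq t : 0 <= t <= T -> rho * Re ((W t)%:C - z t)^-1 = - rho * p t.
  by move=> tT; rewrite -Yz// chordal_field.
rewrite (energy_identity_on T0 acW (chordal_continuous_field rho) field_eq dom dPhi).
by congr (_ + _%:E)%E; rewrite /Phi; ring.
Qed.

(** On the real line [s = 0], so [ln |A|] and [Lam] have derivatives [2 p^2 - p W'] and [- 2 p^2];
    the coefficient [rho (4 + rho) / 4] again leaves [rho^2 p^2 / 2 + rho p W']. *)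
Lemma chordal_boundary_energy rho z : (forall u, 0 <= u <= T -> Im (Y u) = 0) ->
  (forall t, 0 <= t <= T -> Y t = z t) ->
  chordal_rho_energy rho T W z = (chordal_energy T W +
    (- (rho * (ln (modulus (A T)) - ln (modulus (A 0)))) -
     rho * (4 + rho) / 4 * (Lam T - Lam 0))%:E)%E.
Proof.
move=> y0 Yz; rewrite /chordal_rho_energy /chordal_energy; case: ifPn => [/asboolP acW|_//].
pose Phi t := - rho * ln (modulus (A t)) + (- (rho * (4 + rho) / 4)) * Lam t.
have dPhi t w : 0 < t < T -> is_derive t (1 : R) W w ->
    is_derive t (1 : R) Phi ((- rho * p t) ^+ 2 / 2 - w * (- rho * p t)).
  move=> /andP[/ltW t0 /ltW tT] dW; have tT' : 0 <= t <= T by rewrite t0.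
  have s0 : s t = 0 by rewrite /s Im_inv Im_sub y0// subr0 oppr0 mul0r.
  apply: is_derive_fun_eq (is_derive_funD
    (is_derive_fun_cmul _ (chordal_dist_derive tT' dW))
    (is_derive_fun_cmul _ (chordal_Lam_derive tT'))) _.
  by rewrite s0; field.
have dom : dominated T W Phi.
  apply: dominatedD; apply: dominatedZ; first exact: chordal_dominated_dist.
  exact: chordal_dominated_Lam.
have field_eq t : 0 <= t <= T -> rho * Re ((W t)%:C - z t)^-1 = - rho * p t.
  by move=> tT; rewrite -Yz// chordal_field.
rewrite (energy_identity_on T0 acW (chordal_continuous_field rho) field_eq dom dPhi).
by congr (_ + _%:E)%E; rewrite /Phi; ring.
Qed.

End chordal_energy.

Section radial_energy.
Context {R : realType}.
Local Notation Re := complex.Re.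
Local Notation Im := complex.Im.

Lemma is_derive_expi (w : R -> R) t a : is_derive t (1 : R) w a ->
  cderive (fun s => expi (w s)) t ('i * a%:C * expi (w t)).
Proof.
move=> dw; split => /=.
  apply: is_derive_fun_eq (is_derive_fun_cos dw) _.
  by ring.
apply: is_derive_fun_eq (is_derive_fun_sin dw) _.
by ring.
Qed.

(** Double-angle formulas: the chord has squared length [4 sin^2], and [sin (w - v)] is twice the
    product of sine and cosine of the half angle. This identifies the field of the energy with
    [rho * tau]. *)
Lemma cot_half_angle (w v : R) : expi v != expi w ->
  2^-1 * cot ((w - v) / 2) = Im (expi w / (expi v - expi w)).
Proof.
move=> vw; have m0 : modulus (expi v - expi w) != 0 by rewrite modulus_eq0 subr_eq0.
have mE : modulus (expi v - expi w) ^+ 2 = 4 * sin ((w - v) / 2) ^+ 2.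
  by rewrite modulusB modulus_expiB exprMn real_normK ?num_real//; ring.
have s0 : sin ((w - v) / 2) != 0.
  have : modulus (expi v - expi w) ^+ 2 != 0 by rewrite expf_neq0.
  by rewrite mE; apply: contra_neq => ->; ring.
rewrite Im_mul Re_inv Im_inv -modulus_sq mE Re_sub Im_sub /=.
have -> : cos w * (- (sin v - sin w) / (4 * sin ((w - v) / 2) ^+ 2)) +
    sin w * ((cos v - cos w) / (4 * sin ((w - v) / 2) ^+ 2)) =
    sin (w - v) / (4 * sin ((w - v) / 2) ^+ 2).
  by rewrite sinB; ring.
have -> : sin (w - v) = 2 * (cos ((w - v) / 2) * sin ((w - v) / 2)).
  rewrite -{1}[w - v](divfK (_ : 2 != 0))//.
  by rewrite mulr_natr sin_mulr2n -mulr_natl.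
by rewrite /cot; field.
Qed.

Variables (T : R) (w : R -> R).
Hypothesis T0 : 0 <= T.
Hypothesis cw : {within `[0, T], continuous w}.
Let U u : CC R := expi (w u).
Variables (d : R) (Y : R -> CC R) (Lam : R -> R).
Hypothesis d0 : 0 < d.
Hypothesis sY : separated_flow T (-1) (fun u => - (2%:R * U u)) (fun u => - (2%:R * U u ^+ 2)) U d Y.
Hypothesis Y1 : forall u, 0 <= u <= T -> modulus (Y u) = 1.
Hypothesis dLam : forall u, 0 <= u <= T ->
  is_derive u (1 : R) Lam (Re ((-1)%:C - - (2%:R * U u ^+ 2) / (Y u - U u) ^+ 2)).
Let A u := Y u - U u.
Let c u : CC R := U u / A u.
Let tau u := Im (c u).

Let A0 u : 0 <= u <= T -> A u != 0.
Proof. by move=> uT; rewrite subr_eq0; have [] := sY.1 u uT. Qed.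

Let YA u : 0 <= u <= T -> Y u / A u = 1 + c u.
Proof. by move=> uT; rewrite /c -[Y u](subrK (U u)) mulrDl divff ?A0. Qed.

(** Since [Y / A = 1 + c] and [|Y| = |U| = 1], the point [c] is equidistant from [0] and [-1]. Only
    [tau] remains unknown. *)
Let Re_c u : 0 <= u <= T -> Re (c u) = - 2^-1.
Proof.
move=> uT; have : modulus (1 + c u) ^+ 2 = modulus (c u) ^+ 2.
  by rewrite -YA// /c !modulusM Y1// modulus_expi.
rewrite !modulus_sq Re_add Im_add /=; lra.
Qed.

Let dY u : 0 <= u <= T -> cderive Y u ((U u + Y u) / (U u - Y u) * Y u).
Proof.
move=> uT; have [YU] := sY.1 u uT; rewrite radial_field//.
Qed.

Let velocity u : 0 <= u <= T -> (U u + Y u) / (U u - Y u) = - (1 + 2%:R * c u).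
Proof.
move=> uT; have AE : U u - Y u = - A u by rewrite opprB.
rewrite AE invrN mulrN -[U u + Y u](_ : Y u + U u = _); last by rewrite addrC.
by rewrite mulrDl YA// -/(c u); ring.
Qed.

Lemma radial_dist_derive t a : 0 <= t <= T -> is_derive t (1 : R) w a ->
  is_derive t (1 : R) (fun u => ln (modulus (A u))) (2 * tau t ^+ 2 + a * tau t).
Proof.
move=> tT dw.
have dA : cderive A t ((U t + Y t) / (U t - Y t) * Y t - 'i * a%:C * U t).
  by apply: cderiveB; [exact: dY|exact: is_derive_expi].
apply: is_derive_fun_eq (is_derive_ln_modulus dA (A0 tT)) _.
have -> : ((U t + Y t) / (U t - Y t) * Y t - 'i * a%:C * U t) / A t =
    (U t + Y t) / (U t - Y t) * (Y t / A t) - 'i * a%:C * (U t / A t) by ring.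
rewrite YA// -/(c t) velocity//.
by rewrite /tau; case: (c t) (Re_c tT) => x y /= ->; field.
Qed.

Lemma radial_Lam_derive t : 0 <= t <= T ->
  is_derive t (1 : R) Lam (- (2^-1 + 2 * tau t ^+ 2)).
Proof.
move=> tT; apply: is_derive_fun_eq (dLam tT) _.
have -> : - (2%:R * U t ^+ 2) / (Y t - U t) ^+ 2 = - (2%:R * (c t * c t)).
  by rewrite /c -/(A t); field; exact: A0.
by rewrite /tau; case: (c t) (Re_c tT) => x y /= ->; field.
Qed.

Lemma radial_dominated_Lam : dominated T w Lam.
Proof.
apply: (@dominated_derive _ T w Lam _ (2^-1 + 2 * (d ^+ 2)^-1)) => u uT.
split; first exact: radial_Lam_derive uT.
have h := sY.2 u uT; have h0 := lt_le_trans d0 h.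
have h1 : (modulus (A u) ^+ 2)^-1 <= (d ^+ 2)^-1.
  by rewrite lef_pV2 ?posrE ?exprn_gt0// ler_pXn2r// nnegrE ltW.
have h2 : tau u ^+ 2 <= (modulus (A u) ^+ 2)^-1.
  have -> : (modulus (A u) ^+ 2)^-1 = modulus (c u) ^+ 2.
    by rewrite /c modulusM modulus_expi mul1r modulusV exprVn.
  by rewrite modulus_sq lerDr sqr_ge0.
have h3 := sqr_ge0 (tau u); have h4 := le_trans h2 h1.
by rewrite ler_norml; apply/andP; split; lra.
Qed.

Lemma radial_dominated_dist : dominated T w (fun t => ln (modulus (A t))).
Proof.
apply: (@dominated_ln_modulus _ T w Y U _ d (2 / d) d0) => [u uT|u v]; last exact: expi_lipschitz.
have h := sY.2 u uT; have h0 := lt_le_trans d0 h.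
split; [exact: h|exact: dY|].
rewrite !modulusM Y1// mulr1 modulusV modulusB; apply: ler_pM; rewrite ?modulus_ge0 ?invr_ge0 ?modulus_ge0//.
  by apply: le_trans (ler_modulusD _ _) _; rewrite Y1// modulus_expi; lra.
by rewrite lef_pV2 ?posrE.
Qed.

Lemma radial_continuous_field rho : continuous_itv 0 T (fun t => rho * tau t).
Proof.
have cY : ccontinuous T Y by apply: (cderive_ccontinuous T0) => u uT; exact: dY.
have cU : ccontinuous T U.
  apply/ccontinuousP => // t tT e e0.
  have [r r0 hr] := continuous_itvP cw tT e0.
  exists r => // s sT st; apply: le_lt_trans (hr s sT st).
  exact: expi_lipschitz.
have cA : ccontinuous T A by apply: ccontinuousD => //; exact: ccontinuousN.
have := ccontinuous_Im T0 (ccontinuousM (ccontinuous_cst T rho%:C)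
  (ccontinuousM cU (ccontinuousV T0 A0 cA))).
congr (continuous_itv 0 T _); apply/funext => t.
by rewrite Im_mul /= mul0r addr0.
Qed.

(** [ln |A|] and [2 Lam + t] have derivatives [2 tau^2 + w' tau] and [- 4 tau^2]. The term [t], the
    logarithm of the conformal radius, cancels the constant [-1] in [2 Lam']. *)
Lemma radial_boundary_energy rho v : (forall t, 0 <= t <= T -> expi (v t) = Y t) ->
  radial_rho_energy rho T w v = (radial_energy T w +
    (- (rho * (ln (modulus (A T)) - ln (modulus (A 0)))) -
     rho * (4 + rho) / 8 * (2 * (Lam T - Lam 0) + T))%:E)%E.
Proof.
move=> vY; rewrite /radial_rho_energy /radial_energy; case: ifPn => [/asboolP acw|_//].
pose Phi t := - rho * ln (modulus (A t)) + (- (rho * (4 + rho) / 8)) * (2 * Lam t + t).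
have dPhi t a : 0 < t < T -> is_derive t (1 : R) w a ->
    is_derive t (1 : R) Phi ((rho * tau t) ^+ 2 / 2 - a * (rho * tau t)).
  move=> /andP[/ltW t0 /ltW tT] dw; have tT' : 0 <= t <= T by rewrite t0.
  apply: is_derive_fun_eq (is_derive_funD
    (is_derive_fun_cmul _ (radial_dist_derive tT' dw))
    (is_derive_fun_cmul _ (is_derive_funD (is_derive_fun_cmul 2 (radial_Lam_derive tT'))
      (is_derive_fun_id t)))) _.
  by field.
have dom : dominated T w Phi.
  apply: dominatedD; apply: dominatedZ; first exact: radial_dominated_dist.
  apply: dominatedD; first by apply: dominatedZ; exact: radial_dominated_Lam.
  apply: (@dominated_derive _ T w _ (fun=> 1) 1) => u _.
  by split; [exact: is_derive_fun_id|rewrite normr1].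
have field_eq t : 0 <= t <= T -> rho / 2 * cot ((w t - v t) / 2) = rho * tau t.
  move=> tT; rewrite -mulrA cot_half_angle ?vY// -subr_eq0; exact: A0.
rewrite (energy_identity_on T0 acw (radial_continuous_field rho) field_eq dom dPhi).
by congr (_ + _%:E)%E; rewrite /Phi; ring.
Qed.

End radial_energy.

Theorem proposition2 (R : realType) (rho T : R) (hT : 0 <= T) :
  [/\
  forall (K : R -> set (CC R)) (g : R -> CC R -> CC R) (W : R -> R) (z0 : CC R)
    (theta : R -> R),
    chordal_family T K g W -> W 0 = 0 ->
    upper_half_plane R z0 -> ~ K T z0 ->
    (forall t : R, t \in `[0, T] ->
       [/\ 0 < theta t, theta t < pi &
           g t z0 - (W t)%:C
             = (modulus (g t z0 - (W t)%:C))%:C * expi (theta t)]) ->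
    chordal_rho_energy rho T W (fun t => g t z0) =
    (chordal_energy T W
     + (rho * ln (sin (theta T) / sin (theta 0))
        - rho * (8 + rho) / 8
          * ln (modulus (derive1 (g T) z0) * complex.Im (g T z0)
                / complex.Im z0))%:E)%E,
  forall (K : R -> set (CC R)) (g G : R -> CC R -> CC R) (W : R -> R) (x0 : R),
    chordal_family T K g W -> W 0 = 0 ->
    (forall t : R, t \in `[0, T] -> half_plane_reflection (K t) (g t) (G t)) ->
    x0 != 0 -> ~ K T x0%:C ->
    chordal_rho_energy rho T W (fun t => G t x0%:C) =
    (chordal_energy T W
     + (- (rho * ln (modulus ((W T)%:C - G T x0%:C) / modulus x0%:C))
        - rho * (4 + rho) / 4 * ln (modulus (derive1 (G T) x0%:C)))%:E)%E &
  forall (K : R -> set (CC R)) (g G : R -> CC R -> CC R) (w v : R -> R) (v0 : R),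
    radial_family T K g w -> w 0 = 0 ->
    (forall t : R, t \in `[0, T] -> disk_reflection (K t) (g t) (G t)) ->
    0 < v0 -> v0 < 2 * pi -> ~ K T (expi v0) ->
    {within `[0, T], continuous v} -> v 0 = v0 ->
    (forall t : R, t \in `[0, T] -> expi (v t) = G t (expi v0)) ->
    radial_rho_energy rho T w v =
    (radial_energy T w
     + (- (rho * ln (modulus (expi (w T) - G T (expi v0))
                     / modulus (expi (w 0) - expi v0)))
        - rho * (4 + rho) / 8
          * ln (modulus (derive1 (G T) (expi v0)) ^+ 2
                * modulus (derive1 (g T) 0)))%:E)%E].
Proof.
have T01 : 0 <= T <= T by rewrite hT lexx.
have T00 : 0 <= (0 : R) <= T by rewrite lexx.
have in0T t : 0 <= t <= T -> t \in `[0, T] by rewrite in_itv.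
split.
- move=> K g W z0 theta fam _ z0_gt0 Kz0 htheta.
  have [d [Y [Lam [d0 sY Yg dLam [Y0 dg]]]]] := chordal_interior_flow hT fam z0_gt0 Kz0.
  have y_gt0 u : 0 <= u <= T -> 0 < complex.Im (Y u).
    by move=> uT; rewrite Yg//; have [] := chordal_conformal fam uT z0_gt0 Kz0.
  (* Imaginary part of the polar form: [Im Y] equals [|Y - W| sin theta], because [W] is real. *)
  have sinE t : 0 <= t <= T -> ln (sin (theta t)) =
      ln (complex.Im (Y t)) - ln (modulus (Y t - (W t)%:C)).
    move=> tT; have [_ _ /(congr1 (@complex.Im R))] := htheta t (in0T t tT).
    rewrite -Yg// Im_sub Im_mul /= subr0 mul0r addr0 => ->.
    have m0 : 0 < modulus (Y t - (W t)%:C) by rewrite modulus_gt0 subr_eq0; have [] := sY.1 t tT.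
    have s0 : 0 < sin (theta t).
      by have [h1 h2 _] := htheta t (in0T t tT); rewrite sin_gt0_pi ?h1.
    by rewrite lnM ?posrE// addrAC subrr add0r.
  have sin0 t : 0 <= t <= T -> 0 < sin (theta t).
    by move=> tT; have [h1 h2 _] := htheta t (in0T t tT); rewrite sin_gt0_pi ?h1.
  rewrite (chordal_interior_energy hT (chordal_driving fam) d0 sY dLam rho y_gt0 Yg).
  rewrite ln_div ?posrE ?sin0// !sinE// dg -(Yg T T01) -Y0.
  have E0 := expR_gt0 (Lam T - Lam 0); have y0 := y_gt0 _ T00; have yT := y_gt0 _ T01.
  rewrite ln_div ?posrE ?mulr_gt0// lnM ?posrE// expRK.
  by congr (_ + _%:E)%E.
- move=> K g G W x0 fam W0 reflG x00 Kx0.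
  have x0W : x0 != W 0 by rewrite W0.
  have [d [Y [Lam [d0 sY YG dLam [Y0 dG]]]]] := chordal_boundary_flow hT fam reflG Kx0 x0W.
  have Im0 u : 0 <= u <= T -> complex.Im (Y u) = 0 by move=> /YG[].
  have YE u : 0 <= u <= T -> Y u = G u x0%:C by move=> /YG[].
  rewrite (chordal_boundary_energy hT (chordal_driving fam) d0 sY dLam rho Im0 YE).
  have mT : 0 < modulus (Y T - (W T)%:C) by rewrite modulus_gt0 subr_eq0; have [] := sY.1 T T01.
  have m0 : 0 < modulus (x0%:C : CC R) by rewrite modulusR normr_gt0.
  rewrite dG expRK -YE// (modulusB (W T)%:C) ln_div ?posrE// Y0 W0.
  by rewrite [x0%:C - 0%:C](_ : _ = x0%:C) ?subr0.
- move=> K g G w v v0 fam w0 reflG v0_gt0 v0_lt Kv0 _ _ vG.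
  have vw : expi v0 != expi (w 0) by apply: expi_neq; rewrite w0 subr0 v0_gt0.
  have [d [Y [Lam [d0 sY YG dLam [Y0 dG]]]]] := radial_boundary_flow hT fam reflG Kv0 vw.
  have Y1 u : 0 <= u <= T -> modulus (Y u) = 1 by move=> /YG[].
  have YE u : 0 <= u <= T -> Y u = G u (expi v0) by move=> /YG[].
  have vY u : 0 <= u <= T -> expi (v u) = Y u by move=> uT; rewrite YE// vG ?in0T.
  rewrite (radial_boundary_energy hT (radial_driving fam) d0 sY Y1 dLam rho vY).
  have mT : 0 < modulus (Y T - expi (w T)) by rewrite modulus_gt0 subr_eq0; have [] := sY.1 T T01.
  have m0 : 0 < modulus (expi v0 - expi (w 0)) by rewrite modulus_gt0 subr_eq0.
  have dg : modulus (derive1 (g T) 0) = expR T.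
    have dgT := disk_mapping_out_derive (radial_conformal_radius fam (in0T T T01)).
    by rewrite dgT modulusR gtr0_norm ?expR_gt0.
  congr (_ + _%:E)%E; congr (- _ - _ * _).
    by rewrite -YE// [in RHS]modulusB (modulusB (expi (w 0))) ln_div ?posrE// Y0.
  suff key a b : a = expR (Lam T - Lam 0) -> b = expR T ->
    2 * (Lam T - Lam 0) + T = ln (a ^+ 2 * b) by exact: key.
  move=> -> ->; rewrite lnM ?posrE ?exprn_gt0 ?expR_gt0//.
  by rewrite lnXn ?expR_gt0// !expRK mulr_natl.
Qed.
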